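(* Let $R$ be a left-noetherian ring and let $e\in R$ be an idempotent. Assume that the left $eRe$-module ${}_{eRe}eR$ has finite projective dimension. Then the triangle functor $\bar{S_e}\colon\mathbf{D}_{\mathrm{sg}}(R)\to\mathbf{D}_{\mathrm{sg}}(eRe)$ induced by the Schur functor $S_e=eR\otimes_R-$ is an equivalence if and only if the idempotent $e$ is singularly-complete.
   Context: For a left-noetherian ring $R$, $R\text{-mod}$ is the category of finitely generated left $R$-modules, $\mathbf{D}^b(R\text{-mod})$ its bounded derived category, $R\text{-proj}\subseteq R\text{-mod}$ the full subcategory of projective modules, and $\mathbf{K}^b(R\text{-proj})$ the bounded homotopy category, viewed as a thick triangulated subcategory of $\mathbf{D}^b(R\text{-mod})$. The singularity category of $R$ is the Verdier quotient $\mathbf{D}_{\mathrm{sg}}(R)=\mathbf{D}^b(R\text{-mod})/\mathbf{K}^b(R\text{-proj})$. For an idempotent $e\in R$, the ring $eRe$ is again left-noetherian, and $eR$ is an $eRe$-$R$-bimodule via multiplication in $R$. The Schur functor $S_e=eR\otimes_R-\colon R\text{-mod}\to eRe\text{-mod}$ is exact. Its essential kernel $\mathcal{B}_e$ is the full subcategory of $R\text{-mod}$ consisting of the modules $M$ with $eM=0$. $S_e$ extends to a triangle functor $S_e\colon\mathbf{D}^b(R\text{-mod})\to\mathbf{D}^b(eRe\text{-mod})$. When ${}_{eRe}eR$ has finite projective dimension, this functor sends $\mathbf{K}^b(R\text{-proj})$ into $\mathbf{K}^b(eRe\text{-proj})$ and so induces a unique triangle functor $\bar{S_e}\colon\mathbf{D}_{\mathrm{sg}}(R)\to\mathbf{D}_{\mathrm{sg}}(eRe)$.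 An idempotent $e\in R$ is regular if every module in $\mathcal{B}_{1-e}$ (i.e. every finitely generated left $R$-module $M$ with $(1-e)M=0$) has finite projective dimension over $R$. An idempotent $e$ is singularly-complete if the idempotent $1-e$ is regular (i.e. every module in $\mathcal{B}_e$ has finite projective dimension over $R$). *)

(* Defs.v *)
From HB Require Import structures.
From mathcomp Require Import all_boot all_order all_algebra.
From mathcomp Require Import zify.

Set Implicit Arguments.
Unset Strict Implicit.
Unset Printing Implicit Defensive.

Import GRing.Theory.
Local Open Scope ring_scope.

(* Equality of morphisms is the relation [heq], so that homotopy categories
   and localizations are formed without quotient types. *)
Record category := Category {
  obj :> Type;
  hom : obj -> obj -> Type;
  heq : forall X Y, hom X Y -> hom X Y -> Prop;
  idm : forall X, hom X X;
  comp : forall X Y Z, hom Y Z -> hom X Y -> hom X Z;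
  heq_refl : forall X Y (f : hom X Y), heq f f;
  heq_sym : forall X Y (f g : hom X Y), heq f g -> heq g f;
  heq_trans : forall X Y (f g h : hom X Y), heq f g -> heq g h -> heq f h;
  comp_heq : forall X Y Z (g g' : hom Y Z) (f f' : hom X Y),
    heq g g' -> heq f f' -> heq (comp g f) (comp g' f');
  comp_idl : forall X Y (f : hom X Y), heq (comp (idm Y) f) f;
  comp_idr : forall X Y (f : hom X Y), heq (comp f (idm X)) f;
  comp_assoc : forall X Y Z T (h : hom Z T) (g : hom Y Z) (f : hom X Y),
    heq (comp h (comp g f)) (comp (comp h g) f) }.

Arguments hom {c} X Y.
Arguments heq {c X Y} f g.
Arguments idm {c} X.
Arguments comp {c X Y Z} g f.

Declare Scope cat_scope.
Delimit Scope cat_scope with cat.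
Notation "f =~ g" := (heq f g) (at level 70, no associativity) : cat_scope.
Notation "g <o> f" := (comp g f) (at level 45, right associativity) : cat_scope.
Local Open Scope cat_scope.

Definition is_inverse (C : category) (X Y : C) (f : hom X Y) (g : hom Y X) :=
  g <o> f =~ idm X /\ f <o> g =~ idm Y.

Definition is_iso (C : category) (X Y : C) (f : hom X Y) :=
  exists g : hom Y X, is_inverse f g.

Definition isomorphic (C : category) (X Y : C) :=
  exists f : hom X Y, is_iso f.

Record functor (C D : category) := Functor {
  fob :> C -> D;
  fmap : forall X Y, hom X Y -> hom (fob X) (fob Y);
  fmap_heq : forall X Y (f g : hom X Y), f =~ g -> fmap f =~ fmap g;
  fmap_id : forall X, fmap (idm X) =~ idm (fob X);
  fmap_comp : forall X Y Z (g : hom Y Z) (f : hom X Y),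
    fmap (g <o> f) =~ fmap g <o> fmap f }.

Arguments fmap {C D} _ {X Y} _.

Definition functor_id (C : category) : functor C C :=
  @Functor C C (fun X => X) (fun X Y f => f) (fun X Y f g fg => fg)
    (fun X => heq_refl (idm X)) (fun X Y Z g f => heq_refl (g <o> f)).

Definition functor_comp (C D E : category) (G : functor D E)
    (F : functor C D) : functor C E :=
  @Functor C E (fun X => G (F X)) (fun X Y f => fmap G (fmap F f))
    (fun X Y f g fg => fmap_heq G (fmap_heq F fg))
    (fun X => heq_trans (fmap_heq G (fmap_id F X)) (fmap_id G (F X)))
    (fun X Y Z g f => heq_trans (fmap_heq G (fmap_comp F g f))
                                (fmap_comp G (fmap F g) (fmap F f))).

Definition nat_iso (C D : category) (F G : functor C D)
    (eta : forall X : C, hom (F X) (G X)) :=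
  (forall X, is_iso (eta X)) /\
  (forall X Y (f : hom X Y), eta Y <o> fmap F f =~ fmap G f <o> eta X).

Definition nat_isomorphic (C D : category) (F G : functor C D) :=
  exists eta : forall X : C, hom (F X) (G X), nat_iso eta.

Definition is_equivalence (C D : category) (F : functor C D) :=
  exists G : functor D C,
    nat_isomorphic (functor_comp G F) (functor_id C) /\
    nat_isomorphic (functor_comp F G) (functor_id D).

Lemma fmap_iso (C D : category) (F : functor C D) (X Y : C) (f : hom X Y) :
  is_iso f -> is_iso (fmap F f).
Proof.
case=> g [gf fg]; exists (fmap F g); split.
- apply: heq_trans (heq_sym (fmap_comp F g f)) _.
  exact: heq_trans (fmap_heq F gf) (fmap_id F X).
- apply: heq_trans (heq_sym (fmap_comp F f g)) _.
  exact: heq_trans (fmap_heq F fg) (fmap_id F Y).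
Qed.

Lemma idm_iso (C : category) (X : C) : is_iso (idm X).
Proof. by exists (idm X); split; apply: comp_idl. Qed.

Lemma comp_iso (C : category) (X Y Z : C) (g : hom Y Z) (f : hom X Y) :
  is_iso g -> is_iso f -> is_iso (g <o> f).
Proof.
move=> [g' [g'g gg']] [f' [f'f ff']]; exists (f' <o> g'); split.
- apply: heq_trans (heq_sym (comp_assoc f' g' (g <o> f))) _.
  apply: heq_trans f'f; apply: comp_heq; first exact: heq_refl.
  apply: heq_trans (comp_assoc g' g f) _.
  by apply: heq_trans (comp_idl f); apply: comp_heq g'g (heq_refl _).
- apply: heq_trans (heq_sym (comp_assoc g f (f' <o> g'))) _.
  apply: heq_trans gg'; apply: comp_heq; first exact: heq_refl.
  apply: heq_trans (comp_assoc f f' g') _.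
  by apply: heq_trans (comp_idl g'); apply: comp_heq ff' (heq_refl _).
Qed.

Section Localization.
Variables (C : category) (W : forall X Y : C, hom X Y -> Prop).

(* The Gabriel-Zisman localization C[W^-1] by generators and relations: the
   formal composites of morphisms of C and of formal inverses of morphisms
   in W, modulo the congruence generated by the equations of C and the
   equations making [Linv s] inverse to [Lof s]. *)
Inductive lhom : C -> C -> Type :=
| Lof X Y : hom X Y -> lhom X Y
| Linv X Y (s : hom X Y) : W s -> lhom Y X
| Lcomp X Y Z : lhom Y Z -> lhom X Y -> lhom X Z.

Inductive lheq : forall X Y, lhom X Y -> lhom X Y -> Prop :=
| lheq_refl X Y (f : lhom X Y) : lheq f f
| lheq_sym X Y (f g : lhom X Y) : lheq f g -> lheq g f
| lheq_trans X Y (f g h : lhom X Y) : lheq f g -> lheq g h -> lheq f h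
| lheq_comp X Y Z (g g' : lhom Y Z) (f f' : lhom X Y) :
    lheq g g' -> lheq f f' -> lheq (Lcomp g f) (Lcomp g' f')
| lheq_assoc X Y Z T (h : lhom Z T) (g : lhom Y Z) (f : lhom X Y) :
    lheq (Lcomp h (Lcomp g f)) (Lcomp (Lcomp h g) f)
| lheq_idl X Y (f : lhom X Y) : lheq (Lcomp (Lof (idm Y)) f) f
| lheq_idr X Y (f : lhom X Y) : lheq (Lcomp f (Lof (idm X))) f
| lheq_of X Y (f g : hom X Y) : f =~ g -> lheq (Lof f) (Lof g)
| lheq_ofM X Y Z (g : hom Y Z) (f : hom X Y) :
    lheq (Lof (g <o> f)) (Lcomp (Lof g) (Lof f))
| lheq_invl X Y (s : hom X Y) (Ws : W s) :
    lheq (Lcomp (Linv Ws) (Lof s)) (Lof (idm X))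
| lheq_invr X Y (s : hom X Y) (Ws : W s) :
    lheq (Lcomp (Lof s) (Linv Ws)) (Lof (idm Y)).

Definition localization : category :=
  @Category C lhom lheq (fun X => Lof (idm X)) Lcomp lheq_refl lheq_sym
    lheq_trans lheq_comp lheq_idl lheq_idr lheq_assoc.

Definition loc : functor C localization :=
  @Functor C localization (fun X => X) Lof lheq_of
    (fun X => lheq_refl (Lof (idm X))) lheq_ofM.

End Localization.

Arguments loc {C} W.

Section LocalizedFunctor.
Variables (C D : category).
Variables (W : forall X Y : C, hom X Y -> Prop).
Variables (V : forall X Y : D, hom X Y -> Prop).
Variable F : functor C D.
Hypothesis FW : forall X Y (f : hom X Y), W f -> V (fmap F f).

Fixpoint locmap X Y (m : lhom W X Y) : lhom V (F X) (F Y) :=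
  match m in lhom _ X Y return lhom V (F X) (F Y) with
  | Lof _ _ f => Lof V (fmap F f)
  | Linv _ _ s Ws => Linv (FW Ws)
  | Lcomp _ _ _ g f => Lcomp (locmap g) (locmap f)
  end.

Lemma locmap_heq X Y (f g : lhom W X Y) :
  lheq f g -> lheq (locmap f) (locmap g).
Proof.
elim=> {X Y f g} /=; try by move=> *; constructor.
- by move=> X Y f g h _ IH1 _; apply: lheq_trans.
- move=> X Y f; apply: lheq_trans (lheq_idl (locmap f)).
  by apply: lheq_comp; [apply/lheq_of/fmap_id | apply: lheq_refl].
- move=> X Y f; apply: lheq_trans (lheq_idr (locmap f)).
  by apply: lheq_comp; [apply: lheq_refl | apply/lheq_of/fmap_id].
- by move=> X Y f g fg; apply/lheq_of/fmap_heq.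
- move=> X Y Z g f; apply: lheq_trans (lheq_ofM _ _ _).
  exact/lheq_of/fmap_comp.
- move=> X Y s Ws; apply: lheq_trans (lheq_invl _) _.
  exact/lheq_of/heq_sym/fmap_id.
- move=> X Y s Ws; apply: lheq_trans (lheq_invr _) _.
  exact/lheq_of/heq_sym/fmap_id.
Qed.

Definition loc_functor : functor (localization W) (localization V) :=
  @Functor (localization W) (localization V) F locmap locmap_heq
    (fun X => lheq_of V (fmap_id F X))
    (fun X Y Z g f => lheq_refl (Lcomp (locmap g) (locmap f))).

End LocalizedFunctor.

(* Only the data of a triangulated category: the axioms are not needed to form
   Verdier quotients and to define triangle functors. *)
Record tri_category := TriCategory {
  tcat :> category;
  shift : functor tcat tcat;
  (* the class of distinguished triangles X -f-> Y -g-> Z -h-> X[1] *)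
  dist : forall (X Y Z : tcat),
    hom X Y -> hom Y Z -> hom Z (shift X) -> Prop }.

Arguments shift {t}.
Arguments dist {t X Y Z} f g h.

Definition triangle_iso (C : category) (S : functor C C) (X Y Z X' Y' Z' : C)
    (f : hom X Y) (g : hom Y Z) (h : hom Z (S X))
    (f' : hom X' Y') (g' : hom Y' Z') (h' : hom Z' (S X')) :=
  exists (a : hom X X') (b : hom Y Y') (c : hom Z Z'),
    [/\ is_iso a, is_iso b & is_iso c] /\
    [/\ b <o> f =~ f' <o> a, c <o> g =~ g' <o> b & fmap S a <o> h =~ h' <o> c].

Definition triangle_functor (T T' : tri_category) (F : functor T T') :=
  exists eta : forall X : T, hom (F (shift X)) (shift (F X)),
    @nat_iso T T' (functor_comp F shift) (functor_comp shift F) eta /\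
    forall (X Y Z : T) (f : hom X Y) (g : hom Y Z) (h : hom Z (shift X)),
      dist f g h -> dist (fmap F f) (fmap F g) (eta X <o> fmap F h).

Section VerdierQuotient.
Variables (T : tri_category) (N : T -> Prop).

(* The Verdier quotient T/N inverts the morphisms whose cone lies in N. *)
Definition cone_in (X Y : T) (f : hom X Y) :=
  exists (Z : T) (g : hom Y Z) (h : hom Z (shift X)), dist f g h /\ N Z.

Hypothesis shift_cone_in : forall (X Y : T) (f : hom X Y),
  cone_in f -> cone_in (fmap shift f).

Definition quotient_shift :
    functor (localization cone_in) (localization cone_in) :=
  loc_functor shift_cone_in.

Definition quotient_dist (X Y Z : localization cone_in)
    (f : hom X Y) (g : hom Y Z) (h : hom Z (quotient_shift X)) :=
  exists (X' Y' Z' : T)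
      (f' : hom X' Y') (g' : hom Y' Z') (h' : hom Z' (shift X')),
    dist f' g' h' /\
    triangle_iso (S := quotient_shift) f g h
      (fmap (loc cone_in) f') (fmap (loc cone_in) g') (fmap (loc cone_in) h').

Definition verdier_quotient : tri_category := TriCategory quotient_dist.

End VerdierQuotient.

Section Modules.
Variable R : pzRingType.
Implicit Types U V M P : lmodType R.

Definition submodule V (N : V -> Prop) :=
  N 0 /\ forall (a : R) x y, N x -> N y -> N (a *: x + y).

(* the intersection of the submodules containing A *)
Definition span V (A : V -> Prop) (x : V) :=
  forall N : V -> Prop, submodule N -> (forall y, A y -> N y) -> N x.

Definition fin_gen_sub V (N : V -> Prop) :=
  exists s : seq V, forall x, N x <-> span (fun y => y \in s) x.

Definition fin_gen V := fin_gen_sub (fun _ : V => True).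

Definition left_noetherian :=
  forall I : R^o -> Prop, submodule I -> fin_gen_sub I.

Definition projective P :=
  forall (U V : lmodType R) (p : {linear U -> V}) (f : {linear P -> V}),
    (forall v, exists u, p u = v) ->
    exists g : {linear P -> U}, forall x, p (g x) = f x.

Definition finite_pd M :=
  exists (P : nat -> lmodType R) (d : forall i, {linear P i.+1 -> P i})
      (eps : {linear P 0%N -> M}) (n : nat),
    [/\ forall i, projective (P i),
        forall i, (n < i)%N -> forall x : P i, x = 0,
        forall m, exists x, eps x = m,
        forall x, eps x = 0 <-> exists y, x = d 0%N y
      & forall i x, d i x = 0 <-> exists y, x = d i.+1 y].

Record fgmod := FgMod { fg_sort :> lmodType R; fg_fin : fin_gen fg_sort }.

Lemma submodule_span V (A : V -> Prop) : submodule (span A).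
Proof.
split=> [N [] // | a x y Ax Ay N sN AN].
by apply: sN.2; [apply: Ax | apply: Ay].
Qed.

Lemma span0 V (A : V -> Prop) : span A 0.
Proof. by case: (submodule_span A). Qed.

Lemma span_gen V (A : V -> Prop) x : A x -> span A x.
Proof. by move=> Ax N _; apply. Qed.

Lemma span_sub V (A B : V -> Prop) x :
  (forall y, A y -> span B y) -> span A x -> span B x.
Proof. by move=> AB; apply => //; apply: submodule_span. Qed.

Lemma submoduleD V (N : V -> Prop) x y :
  submodule N -> N x -> N y -> N (x + y).
Proof. by move=> sN Nx Ny; rewrite -[x]scale1r; apply: sN.2. Qed.

Lemma submoduleZ V (N : V -> Prop) a x : submodule N -> N x -> N (a *: x).
Proof. by move=> sN Nx; rewrite -[_ *: _]addr0; apply: sN.2 => //; case: sN. Qed.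

Lemma submoduleB V (N : V -> Prop) x y :
  submodule N -> N x -> N y -> N (x - y).
Proof.
by move=> sN Nx Ny; rewrite addrC -scaleN1r; apply: sN.2.
Qed.

Lemma fin_gen_pair U V : fin_gen U -> fin_gen V -> fin_gen (U * V)%type.
Proof.
move=> [s gs] [t gt].
exists ([seq (u, 0) | u <- s] ++ [seq (0, v) | v <- t]) => -[u v].
split=> // _ N sN Ng.
have Nu : N (u, 0).
  apply: ((gs u).1 I (fun x => N (x, 0))) => [|y ys].
    split=> [|a x y Nx Ny]; first by case: sN.
    have -> : (a *: x + y, 0) = a *: ((x, 0) : U * V) + (y, 0) :> (U * V).
      by congr pair; rewrite /= scaler0 addr0.
    exact: sN.2.
  by apply: Ng; rewrite mem_cat; apply/orP; left; apply/mapP; exists y.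
have Nv : N (0, v).
  apply: ((gt v).1 I (fun x => N (0, x))) => [|y ys].
    split=> [|a x y Nx Ny]; first by case: sN.
    have -> : (0, a *: x + y) = a *: ((0, x) : U * V) + (0, y) :> (U * V).
      by congr pair; rewrite /= scaler0 addr0.
    exact: sN.2.
  by apply: Ng; rewrite mem_cat; apply/orP; right; apply/mapP; exists y.
have -> : (u, v) = (u, 0) + (0, v) :> (U * V).
  by congr pair; rewrite /= ?addr0 ?add0r.
exact: (submoduleD sN).
Qed.

Lemma noetherian_sub V (s : seq V) (N : V -> Prop) :
  left_noetherian -> submodule N ->
  (forall x, N x -> span (fun y => y \in s) x) -> fin_gen_sub N.
Proof.
move=> hR; elim: s N => [|g s IH] N sN Ns.
  by exists [::] => x; split=> [/Ns // | ]; apply.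
have split_g x : span (fun y => y \in g :: s) x ->
    exists r y, span (fun y => y \in s) y /\ x = r *: g + y.
  move=> /(_ (fun x => exists r y,
    span (fun y => y \in s) y /\ x = r *: g + y)); apply.
    split=> [|a _ _ [r [y [sy ->]]] [r' [y' [sy' ->]]]].
      by exists 0, 0; split; [apply: span0 | rewrite scale0r addr0].
    exists (a * r + r'), (a *: y + y'); split.
      exact: (submodule_span _).2.
    by rewrite scalerDr scalerDl scalerA addrACA.
  move=> y; rewrite inE => /orP[/eqP-> | ys].
    by exists 1, 0; split; [apply: span0 | rewrite scale1r addr0].
  by exists 0, y; split; [apply: span_gen | rewrite scale0r add0r].
have lin_g (a r r' : R) (x x' : V) :
    a *: x + x' - (a * r + r') *: g = a *: (x - r *: g) + (x' - r' *: g).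
  by rewrite scalerDl opprD scalerBr scalerA addrACA.
pose J (r : R) := exists2 x, N x & span (fun y => y \in s) (x - r *: g).
have sJ : @submodule R^o J.
  split.
    by exists 0; [case: sN | rewrite scale0r subr0; apply: span0].
  move=> a r r' [x Nx Hx] [x' Nx' Hx']; exists (a *: x + x'); first exact: sN.2.
  by have := lin_g a r r' x x'; rewrite /= => ->; apply: (submodule_span _).2.
have [a Ja] := hR J sJ.
have [t [tN tJ]] : exists t : seq V, (forall x, x \in t -> N x) /\
    forall r : R, r \in (a : seq R) -> exists2 x, span (fun y => y \in t) x
      & span (fun y => y \in s) (x - r *: g).
  have: forall r : R, r \in (a : seq R) -> J r by move=> r ra; apply: (Ja r).2; apply: span_gen.
  elim: (a) => [|r a' IHa] Ja'; first by exists [::].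
  have [|t [tN tJ]] := IHa; first by move=> r' r'a; apply: Ja'; rewrite inE r'a orbT.
  have [x Nx Hx] := Ja' r (mem_head _ _).
  exists (x :: t); split=> [y|r'].
    by rewrite inE => /orP[/eqP->|/tN].
  rewrite inE => /orP[/eqP->|/tJ[y ty Hy]].
    by exists x => //; apply: span_gen; apply: mem_head.
  exists y => //; apply: span_sub ty => z zt.
  by apply: span_gen; rewrite inE zt orbT.
have tall r : J r -> exists2 x, span (fun y => y \in t) x
      & span (fun y => y \in s) (x - r *: g).
  move=> /(Ja r).1 /(_ (fun r : R => exists2 x, span (fun y => y \in t) x
      & span (fun y => y \in s) (x - r *: g))); apply; last exact: tJ.
  split.
    by exists 0; [apply: span0 | rewrite scale0r subr0; apply: span0].
  move=> b r1 r2 [x tx Hx] [x' tx' Hx']; exists (b *: x + x').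
    exact: (submodule_span _).2.
  by have := lin_g b r1 r2 x x'; rewrite /= => ->; apply: (submodule_span _).2.
have sNt x : span (fun y => y \in t) x -> N x by apply.
have [||u Hu] := IH (fun x => N x /\ span (fun y => y \in s) x).
- split; first by split; [case: sN | apply: span0].
  move=> b x y [Nx sx] [Ny sy]; split; first exact: sN.2.
  exact: (submodule_span _).2.
- by move=> x [].
exists (t ++ u) => x; split=> [Nx|]; last first.
  apply=> // y; rewrite mem_cat => /orP[/tN // | yu].
  by have /(Hu y).2[] : span (fun z => z \in u) y by apply: span_gen.
have [r [y [sy Dx]]] := split_g x (Ns x Nx).
have [|z tz Hz] := tall r.
  by exists x => //; rewrite Dx addrC addKr.
have uxz : span (fun y => y \in u) (x - z).
  apply/Hu; split; first by apply: submoduleB => //; apply: sNt.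
  have -> : x - z = y - (z - r *: g).
    by rewrite Dx opprB addrA [y + _]addrC.
  exact: (submoduleB (submodule_span _)) sy Hz.
rewrite -[x](subrK z); apply: (submoduleD (submodule_span _)).
  apply: span_sub uxz => w wu; apply: span_gen; by rewrite mem_cat wu orbT.
apply: span_sub tz => w wt; apply: span_gen; by rewrite mem_cat wt.
Qed.

Lemma span_finite V (A : V -> Prop) (s : seq V) :
  (forall x, x \in s -> span A x) ->
  exists t : seq V, (forall x, x \in t -> A x) /\
    forall x, x \in s -> span (fun y => y \in t) x.
Proof.
have cat_l (t u : seq V) x : span (fun y => y \in t) x ->
    span (fun y => y \in t ++ u) x.
  by apply: span_sub => y yt; apply: span_gen; rewrite mem_cat yt.
have cat_r (t u : seq V) x : span (fun y => y \in u) x ->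
    span (fun y => y \in t ++ u) x.
  by apply: span_sub => y yt; apply: span_gen; rewrite mem_cat yt orbT.
have cat_A (t u : seq V) : (forall x, x \in t -> A x) ->
    (forall x, x \in u -> A x) -> forall x, x \in t ++ u -> A x.
  by move=> tA uA x; rewrite mem_cat => /orP[/tA|/uA].
elim: s => [|x s IH] sA; first by exists [::].
have [|t [tA ts]] := IH; first by move=> y ys; apply: sA; rewrite inE ys orbT.
suff [u [uA ux]] : exists u : seq V, (forall y, y \in u -> A y) /\
    span (fun y => y \in u) x.
  exists (u ++ t); split; first exact: cat_A.
  by move=> y; rewrite inE => /orP[/eqP->|/ts]; [apply: cat_l | apply: cat_r].
have /(_ (fun x => exists u : seq V, (forall y, y \in u -> A y) /\
    span (fun y => y \in u) x)) := sA x (mem_head _ _).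
apply.
  split.
    by exists [::]; split=> //; apply: span0.
  move=> a y z [u [uA uy]] [v [vA vz]]; exists (u ++ v); split.
    exact: cat_A.
  by apply: (submodule_span _).2; [apply: cat_l | apply: cat_r].
move=> y Ay; exists [:: y]; split=> [z|].
  by rewrite inE => /eqP->.
by apply: span_gen; apply: mem_head.
Qed.

End Modules.

Definition mklin (R : pzRingType) (U V : lmodType R) (f : U -> V)
    (lin_f : linear f) : {linear U -> V} :=
  HB.pack f (GRing.isLinear.Build R U V *:%R f lin_f).

Section Complexes.
Variable R : pzRingType.

Record cpx := Cpx {
  ct :> int -> fgmod R;
  cd : forall n, {linear ct n -> ct (n + 1)};
  cdd : forall n x, cd (n + 1) (cd n x) = 0;
  cbound : exists N : nat,
    forall n : int, (N < `|n|)%N -> forall x : ct n, x = 0 }.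

Record cmap (X Y : cpx) := Cmap {
  cfun :> forall n, {linear X n -> Y n};
  cfunE : forall n x, cfun (n + 1) (cd X n x) = cd Y n (cfun n x) }.

(* The component of a homotopy in degree n+1 is [h n]; every integer is of
   the form n+1. *)
Definition homotopic (X Y : cpx) (f g : cmap X Y) :=
  exists h : forall n, {linear X (n + 1) -> Y n},
    forall n x, f (n + 1) x - g (n + 1) x =
      cd Y n (h n x) + h (n + 1) (cd X (n + 1) x).

Lemma eq_homotopic X Y (f g : cmap X Y) :
  (forall n x, f n x = g n x) -> homotopic f g.
Proof.
move=> fg; exists (fun n => \0 : {linear X (n + 1) -> Y n}) => n x.
by rewrite fg subrr linear0 addr0.
Qed.

Lemma homotopic_refl X Y (f : cmap X Y) : homotopic f f.
Proof. exact: eq_homotopic. Qed.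

Lemma homotopic_sym X Y (f g : cmap X Y) : homotopic f g -> homotopic g f.
Proof.
move=> [h Hh]; exists (fun n => \- h n : {linear X (n + 1) -> Y n}) => n x /=.
by rewrite -opprB Hh opprD linearN.
Qed.

Lemma homotopic_trans X Y (f g k : cmap X Y) :
  homotopic f g -> homotopic g k -> homotopic f k.
Proof.
move=> [h Hh] [h' Hh'].
exists (fun n => h n \+ h' n : {linear X (n + 1) -> Y n}) => n x /=.
by rewrite -(subrKA (g (n + 1) x)) Hh Hh' linearD addrACA.
Qed.

Definition cmap_id (X : cpx) : cmap X X :=
  @Cmap X X (fun n => idfun : {linear X n -> X n}) (fun n x => erefl).

Lemma cmap_compE X Y Z (g : cmap Y Z) (f : cmap X Y) n x :
  g (n + 1) (f (n + 1) (cd X n x)) = cd Z n (g n (f n x)).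
Proof. by rewrite !cfunE. Qed.

Definition cmap_comp X Y Z (g : cmap Y Z) (f : cmap X Y) : cmap X Z :=
  @Cmap X Z (fun n => g n \o f n : {linear X n -> Z n}) (cmap_compE g f).

Lemma homotopic_comp X Y Z (g g' : cmap Y Z) (f f' : cmap X Y) :
  homotopic g g' -> homotopic f f' ->
  homotopic (cmap_comp g f) (cmap_comp g' f').
Proof.
move=> [k Hk] [h Hh].
exists (fun n => (g n \o h n) \+ (k n \o f' (n + 1))
          : {linear X (n + 1) -> Z n}) => n x /=.
rewrite -(subrKA (g (n + 1) (f' (n + 1) x))) -linearB Hh Hk.
by rewrite !linearD /= !cfunE addrACA.
Qed.

Definition Kb : category :=
  @Category cpx cmap homotopic cmap_id cmap_comp homotopic_refl homotopic_sym
    homotopic_trans homotopic_comp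
    (fun X Y f => eq_homotopic (fun n x => erefl))
    (fun X Y f => eq_homotopic (fun n x => erefl))
    (fun X Y Z T h g f => eq_homotopic (fun n x => erefl)).

(* [f] induces injective and surjective maps on cohomology. *)
Definition quasi_iso (X Y : Kb) (f : hom X Y) :=
  forall n : int,
    (forall x : X (n + 1), cd X (n + 1) x = 0 ->
       (exists y, f (n + 1) x = cd Y n y) -> exists w, x = cd X n w) /\
    (forall y : Y (n + 1), cd Y (n + 1) y = 0 ->
       exists x w, cd X (n + 1) x = 0 /\ y = f (n + 1) x + cd Y n w).

Section Shift.
Variable X : cpx.

Lemma shift_cdd n x :
  (\- cd X (n + 1 + 1)) ((\- cd X (n + 1)) x) = 0.
Proof. by rewrite /= linearN cdd !oppr0. Qed.

Lemma shift_bound : exists N : nat,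
  forall n : int, (N < `|n|)%N -> forall x : X (n + 1), x = 0.
Proof. by have [N XN] := cbound X; exists N.+1 => n nN; apply: XN; lia. Qed.

Definition shift_cpx : cpx :=
  @Cpx (fun n => X (n + 1))
    (fun n => \- cd X (n + 1) : {linear X (n + 1) -> X (n + 1 + 1)})
    shift_cdd shift_bound.

End Shift.

Lemma shift_cmapE X Y (f : cmap X Y) n (x : shift_cpx X n) :
  f (n + 1 + 1) (cd (shift_cpx X) n x) = cd (shift_cpx Y) n (f (n + 1) x).
Proof. by rewrite /= linearN cfunE. Qed.

Definition shift_cmap X Y (f : cmap X Y) : cmap (shift_cpx X) (shift_cpx Y) :=
  @Cmap (shift_cpx X) (shift_cpx Y) (fun n => f (n + 1)) (shift_cmapE f).

Lemma shift_homotopic X Y (f g : cmap X Y) :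
  homotopic f g -> homotopic (shift_cmap f) (shift_cmap g).
Proof.
move=> [h Hh].
exists (fun n => \- h (n + 1)
          : {linear shift_cpx X (n + 1) -> shift_cpx Y n}) => n x /=.
by rewrite Hh !linearN !opprK.
Qed.

Definition Kb_shift : functor Kb Kb :=
  @Functor Kb Kb shift_cpx shift_cmap shift_homotopic
    (fun X => eq_homotopic (fun n x => erefl))
    (fun X Y Z g f => eq_homotopic (fun n x => erefl)).

Lemma shift_quasi_iso (X Y : Kb) (f : hom X Y) :
  quasi_iso f -> quasi_iso (fmap Kb_shift f).
Proof.
move=> qf n; have [finj fsurj] := qf (n + 1); split=> /=.
  move=> x /eqP; rewrite oppr_eq0 => /eqP dx [y fx].
  have [|w ->] := finj x dx; first by exists (- y); rewrite fx linearN.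
  by exists (- w); rewrite linearN opprK.
move=> y /eqP; rewrite oppr_eq0 => /eqP dy.
have [x [w [dx ->]]] := fsurj y dy.
by exists x, (- w); rewrite dx oppr0 linearN opprK.
Qed.

Section Cone.
Variables (X Y : cpx) (f : cmap X Y).

Definition cone_ct (n : int) : fgmod R :=
  FgMod (fin_gen_pair (fg_fin (X (n + 1))) (fg_fin (Y n))).

Definition cone_fun n (p : X (n + 1) * Y n) : X (n + 1 + 1) * Y (n + 1) :=
  (- cd X (n + 1) p.1, f (n + 1) p.1 + cd Y n p.2).

Lemma cone_fun_linear n : linear (@cone_fun n).
Proof.
move=> a [x y] [x' y']; congr pair => /=.
  by rewrite (linearP (cd X (n + 1))) opprD scalerN.
by rewrite (linearP (f (n + 1))) (linearP (cd Y n)) addrACA scalerDr.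
Qed.

Definition cone_cd n : {linear cone_ct n -> cone_ct (n + 1)} :=
  mklin (@cone_fun_linear n).

Lemma cone_cdd n x : cone_cd (n + 1) (cone_cd n x) = 0.
Proof.
case: x => x y; congr pair; rewrite /=.
  by rewrite linearN cdd !oppr0.
by rewrite linearN cfunE linearD cdd addr0 addNr.
Qed.

Lemma cone_bound : exists N : nat,
  forall n : int, (N < `|n|)%N -> forall x : cone_ct n, x = 0.
Proof.
have [N XN] := shift_bound X; have [M YM] := cbound Y.
exists (maxn N M) => n; rewrite gtn_max => /andP[nN nM] [x y].
by congr pair; [apply: XN | apply: YM].
Qed.

Definition cone : cpx := Cpx cone_cdd cone_bound.

Lemma cone_in_linear n : linear (fun y : Y n => (0, y) : cone n).
Proof.
by move=> a y y'; congr pair; rewrite /= ?scaler0 ?addr0.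
Qed.

Lemma cone_inE n (y : Y n) :
  mklin (@cone_in_linear (n + 1)) (cd Y n y)
  = cd cone n (mklin (@cone_in_linear n) y).
Proof. by congr pair; rewrite /= ?linear0 ?oppr0 ?add0r. Qed.

Definition cone_incl : cmap Y cone := Cmap cone_inE.

Definition cone_proj : cmap cone (shift_cpx X) :=
  @Cmap cone (shift_cpx X)
    (fun n => fst : {linear (X (n + 1)%R * Y n)%type -> X (n + 1)})
    (fun n x => erefl).

End Cone.

Definition Db_cat : category := localization quasi_iso.

Definition Db_shift : functor Db_cat Db_cat := loc_functor shift_quasi_iso.

(* The distinguished triangles are those isomorphic in the derived category
   to some X -> Y -> cone u -> X[1] with u a chain map. *)
Definition Db_dist (X Y Z : Db_cat)
    (f : hom X Y) (g : hom Y Z) (h : hom Z (Db_shift X)) :=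
  exists (X' Y' : cpx) (u : cmap X' Y'),
    triangle_iso (S := Db_shift) f g h
      (fmap (loc quasi_iso) (u : @hom Kb X' Y'))
      (fmap (loc quasi_iso) (cone_incl u : @hom Kb _ _))
      (fmap (loc quasi_iso) (cone_proj u : @hom Kb _ (Kb_shift X'))).

Definition Db : tri_category := TriCategory Db_dist.

(* K^b(R-proj) as an isomorphism-closed subcategory of D^b(R-mod) *)
Definition perfect (X : Db) :=
  exists P : cpx, (forall n, projective (P n)) /\ isomorphic X (P : Db).

Lemma shift_perfect X : perfect X -> perfect (Db_shift X).
Proof.
move=> [P [projP [f isof]]]; exists (shift_cpx P); split=> [n|].
  exact: projP.
by exists (fmap Db_shift f); apply: fmap_iso.
Qed.

Lemma iso_perfect (X Y : Db) : isomorphic X Y -> perfect Y -> perfect X.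
Proof.
move=> [f isof] [P [projP [g isog]]]; exists P; split=> //.
by exists (g <o> f); apply: comp_iso.
Qed.

Section ConeShift.
Variables (X Y : cpx) (u : cmap X Y).

Definition sgn_fun n (p : X (n + 1 + 1) * Y (n + 1)) :
  X (n + 1 + 1) * Y (n + 1) := (- p.1, p.2).

Lemma sgn_linear n : linear (@sgn_fun n).
Proof. by move=> a [x y] [x' y']; congr pair; rewrite /= opprD scalerN. Qed.

Lemma sgnE n (p : cone (shift_cmap u) n) :
  mklin (@sgn_linear (n + 1)) (cd (cone (shift_cmap u)) n p)
  = cd (shift_cpx (cone u)) n (mklin (@sgn_linear n) p).
Proof.
case: p => x y; congr pair => /=.
  by rewrite (linearN (cd X (n + 1 + 1))).
by rewrite (linearN (u (n + 1 + 1))) opprD opprK.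
Qed.

Lemma sgn'E n (p : shift_cpx (cone u) n) :
  mklin (@sgn_linear (n + 1)) (cd (shift_cpx (cone u)) n p)
  = cd (cone (shift_cmap u)) n (mklin (@sgn_linear n) p).
Proof.
case: p => x y; congr pair => /=.
  by rewrite (linearN (cd X (n + 1 + 1))).
by rewrite (linearN (u (n + 1 + 1))) opprD.
Qed.

Lemma cone_shift :
  isomorphic (cone (shift_cmap u) : Kb) (shift_cpx (cone u) : Kb).
Proof.
pose f : cmap (cone (shift_cmap u)) (shift_cpx (cone u))
  := @Cmap (cone (shift_cmap u)) (shift_cpx (cone u))
       (fun n => mklin (@sgn_linear n)) sgnE.
pose g : cmap (shift_cpx (cone u)) (cone (shift_cmap u))
  := @Cmap (shift_cpx (cone u)) (cone (shift_cmap u))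
       (fun n => mklin (@sgn_linear n)) sgn'E.
by exists f, g; split; apply: eq_homotopic => n [x y]; congr pair; apply: opprK.
Qed.

End ConeShift.

Lemma shift_cone_perfect (X Y : Db) (f : hom X Y) :
  cone_in perfect f -> cone_in perfect (fmap (@shift Db) f).
Proof.
case=> Z [g [h [[X' [Y' [u [a [b [c [[isoa isob isoc] [bf _ _]]]]]]]] perfZ]]].
have perf_u : perfect (cone u : Db).
  case: isoc => c' [c'c cc']; apply: iso_perfect perfZ.
  by exists c', c.
have [k isok] := cone_shift u.
have perf_su : perfect (cone (shift_cmap u) : Db).
  apply: iso_perfect (shift_perfect perf_u).
  exists (fmap (loc quasi_iso) k); exact: (@fmap_iso _ _ (loc quasi_iso) _ _ k isok).
pose sa := fmap Db_shift a; pose sb := fmap Db_shift b.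
have isosa : is_iso sa by exact: (@fmap_iso _ _ Db_shift _ _ a isoa).
have isosb : is_iso sb by exact: (@fmap_iso _ _ Db_shift _ _ b isob).
have [ssa [_ ssaK]] : is_iso (fmap Db_shift sa) by exact: (@fmap_iso _ _ Db_shift _ _ sa isosa).
pose i : @hom Db (shift_cpx Y') (cone (shift_cmap u)) :=
  fmap (loc quasi_iso) (cone_incl (shift_cmap u) : @hom Kb _ _).
pose p : @hom Db (cone (shift_cmap u)) (Db_shift (shift_cpx X')) :=
  fmap (loc quasi_iso) (cone_proj (shift_cmap u) : @hom Kb _ (Kb_shift _)).
exists (cone (shift_cmap u)), (i <o> sb), (ssa <o> p); split=> //.
exists (shift_cpx X'), (shift_cpx Y'), (shift_cmap u), sa, sb, (idm _).
split; first by split=> //; apply: idm_iso.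
split.
- apply: heq_trans (heq_sym (fmap_comp Db_shift b f)) _.
  apply: heq_trans (fmap_heq Db_shift bf) _.
  exact: (fmap_comp Db_shift).
- exact: comp_idl.
- apply: heq_trans (heq_sym (comp_idr _)).
  apply: heq_trans (comp_assoc _ _ _) _.
  by apply: heq_trans (comp_idl p); apply: comp_heq ssaK (heq_refl _).
Qed.

Definition Dsg : tri_category := verdier_quotient shift_cone_perfect.

Definition sg_quotient : functor Db Dsg := loc (cone_in perfect).

End Complexes.

Arguments quasi_iso {R X Y} f.
Arguments perfect {R} X.

(* eM = 0, for M finitely generated: the essential kernel of S_e *)
Definition ess_kernel (R : pzRingType) (e : R) (M : fgmod R) :=
  forall m : M, e *: m = 0.

Definition regular (R : pzRingType) (e : R) :=
  forall M : fgmod R, ess_kernel (1 - e) M -> finite_pd M.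

Definition singularly_complete (R : pzRingType) (e : R) := regular (1 - e).

Section Corner.
Variables (R : pzRingType) (e : R).

(* the ring eRe, with unit e *)
Definition corner & e * e = e := {x : R | e * x * e == x}.

Variable he : e * e = e.
Notation eRe := (corner he).

HB.instance Definition _ := [isSub of eRe for @sval _ _].
HB.instance Definition _ := [Choice of eRe by <:].

Lemma cornerP (x : R) : e * x * e == x -> e * x = x /\ x * e = x.
Proof.
move=> /eqP ex; split; rewrite -{1}ex; first by rewrite !mulrA he.
by rewrite -mulrA he.
Qed.

Lemma corner0_subproof : e * 0 * e == 0.
Proof. by rewrite mulr0 mul0r. Qed.
Lemma cornerN_subproof (x : eRe) : e * (- val x) * e == - val x.
Proof. by rewrite mulrN mulNr (eqP (valP x)). Qed.
Lemma cornerD_subproof (x y : eRe) : e * (val x + val y) * e == val x + val y.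
Proof. by rewrite mulrDr mulrDl (eqP (valP x)) (eqP (valP y)). Qed.
Lemma corner1_subproof : e * e * e == e.
Proof. by rewrite !he. Qed.
Lemma cornerM_subproof (x y : eRe) : e * (val x * val y) * e == val x * val y.
Proof.
have [ex _] := cornerP (valP x); have [_ ye] := cornerP (valP y).
by rewrite mulrA ex -mulrA ye.
Qed.

Definition corner0 : eRe := exist _ 0 corner0_subproof.
Definition cornerN (x : eRe) : eRe := exist _ (- val x) (cornerN_subproof x).
Definition cornerD (x y : eRe) : eRe :=
  exist _ (val x + val y) (cornerD_subproof x y).
Definition corner1 : eRe := exist _ e corner1_subproof.
Definition cornerM (x y : eRe) : eRe :=
  exist _ (val x * val y) (cornerM_subproof x y).

Lemma corner_addA : associative cornerD.
Proof. by move=> x y z; apply: val_inj; apply: addrA. Qed.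
Lemma corner_addC : commutative cornerD.
Proof. by move=> x y; apply: val_inj; apply: addrC. Qed.
Lemma corner_add0 : left_id corner0 cornerD.
Proof. by move=> x; apply: val_inj; apply: add0r. Qed.
Lemma corner_addN : left_inverse corner0 cornerN cornerD.
Proof. by move=> x; apply: val_inj; apply: addNr. Qed.
HB.instance Definition _ := GRing.isZmodule.Build eRe
  corner_addA corner_addC corner_add0 corner_addN.

Lemma corner_mulA : associative cornerM.
Proof. by move=> x y z; apply: val_inj; apply: mulrA. Qed.
Lemma corner_mul1l : left_id corner1 cornerM.
Proof. by move=> x; apply: val_inj; case: (cornerP (valP x)). Qed.
Lemma corner_mul1r : right_id corner1 cornerM.
Proof. by move=> x; apply: val_inj; case: (cornerP (valP x)). Qed.
Lemma corner_mulDl : left_distributive cornerM +%R.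
Proof. by move=> x y z; apply: val_inj; apply: mulrDl. Qed.
Lemma corner_mulDr : right_distributive cornerM +%R.
Proof. by move=> x y z; apply: val_inj; apply: mulrDr. Qed.
HB.instance Definition _ := GRing.Zmodule_isPzRing.Build eRe
  corner_mulA corner_mul1l corner_mul1r corner_mulDl corner_mulDr.

(* The left eRe-module eM. It is a model of the tensor product of eR and M
   over R: see [schur_tensor] below. For M = R it is the eRe-module eR. *)
Definition schur & e * e = e := fun M : lmodType R => {m : M | e *: m == m}.

Section SchurModule.
Variable M : lmodType R.
Notation eM := (schur he M).

HB.instance Definition _ := [isSub of eM for @sval _ _].
HB.instance Definition _ := [Choice of eM by <:].

Lemma schurP (m : eM) : e *: val m = val m.
Proof. exact/eqP/(valP m). Qed.

Lemma schur_proof (m : M) : e *: (e *: m) == e *: m.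
Proof. by rewrite scalerA he. Qed.
Definition to_schur (m : M) : eM := exist _ (e *: m) (schur_proof m).

Lemma to_schurK (m : eM) : to_schur (val m) = m.
Proof. by apply: val_inj; apply: schurP. Qed.

Lemma schur0_subproof : e *: (0 : M) == 0.
Proof. by rewrite scaler0. Qed.
Lemma schurN_subproof (x : eM) : e *: (- val x) == - val x.
Proof. by rewrite scalerN schurP. Qed.
Lemma schurD_subproof (x y : eM) : e *: (val x + val y) == val x + val y.
Proof. by rewrite scalerDr !schurP. Qed.
Lemma schurZ_subproof (a : eRe) (x : eM) :
  e *: (val a *: val x) == val a *: val x.
Proof. by rewrite scalerA; have [-> _] := cornerP (valP a). Qed.

Definition schur0 : eM := exist _ 0 schur0_subproof.
Definition schurN (x : eM) : eM := exist _ (- val x) (schurN_subproof x).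
Definition schurD (x y : eM) : eM :=
  exist _ (val x + val y) (schurD_subproof x y).
Definition schurZ (a : eRe) (x : eM) : eM :=
  exist _ (val a *: val x) (schurZ_subproof a x).

Lemma schur_addA : associative schurD.
Proof. by move=> x y z; apply: val_inj; apply: addrA. Qed.
Lemma schur_addC : commutative schurD.
Proof. by move=> x y; apply: val_inj; apply: addrC. Qed.
Lemma schur_add0 : left_id schur0 schurD.
Proof. by move=> x; apply: val_inj; apply: add0r. Qed.
Lemma schur_addN : left_inverse schur0 schurN schurD.
Proof. by move=> x; apply: val_inj; apply: addNr. Qed.
HB.instance Definition _ := GRing.isZmodule.Build eM
  schur_addA schur_addC schur_add0 schur_addN.

Lemma schur_scaleA a b (v : eM) : schurZ a (schurZ b v) = schurZ (a * b) v.
Proof. by apply: val_inj; apply: scalerA. Qed.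
Lemma schur_scale1 : left_id 1 schurZ.
Proof. by move=> v; apply: val_inj; apply: schurP. Qed.
Lemma schur_scaleDr : right_distributive schurZ +%R.
Proof. by move=> a u v; apply: val_inj; apply: scalerDr. Qed.
Lemma schur_scaleDl v : {morph schurZ^~ v : a b / a + b}.
Proof. by move=> a b; apply: val_inj; apply: scalerDl. Qed.
HB.instance Definition _ := GRing.Zmodule_isLmodule.Build eRe eM
  schur_scaleA schur_scale1 schur_scaleDr schur_scaleDl.

Lemma schur_valD (x y : eM) : val (x + y) = val x + val y.
Proof. by []. Qed.
Lemma schur_valN (x : eM) : val (- x) = - val x.
Proof. by []. Qed.
Lemma schur_valZ (a : eRe) (x : eM) : val (a *: x) = val a *: val x.
Proof. by []. Qed.

End SchurModule.

Notation eR := (schur he R^o).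

Section Tensor.
Variable M : lmodType R.

Definition eR_mulr (x : eR) (r : R) : eR.
Proof.
exists ((val x : R) * r); apply/eqP.
have := schurP x; rewrite /GRing.scale /= => ex.
by rewrite mulrA ex.
Defined.

Definition schur_pair (x : eR) (m : M) : schur he M.
Proof.
exists ((val x : R) *: m); apply/eqP.
have := schurP x; rewrite {1}/GRing.scale /= => ex.
by rewrite scalerA ex.
Defined.

Definition balanced (A : zmodType) (phi : eR -> M -> A) :=
  [/\ forall x y m, phi (x + y) m = phi x m + phi y m,
      forall x m n, phi x (m + n) = phi x m + phi x n
    & forall x r m, phi (eR_mulr x r) m = phi x (r *: m)].

(* eM, with the pairing (x, m) |-> xm, has the universal property of the
   tensor product of eR and M over R, compatibly with the eRe-actions. *)
Lemma schur_tensor :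
  [/\ balanced schur_pair,
      forall a x m, schur_pair (a *: x) m = a *: schur_pair x m
    & forall (A : zmodType) (phi : eR -> M -> A), balanced phi ->
      exists2 psi : schur he M -> A,
        (forall x y, psi (x + y) = psi x + psi y) /\
        (forall x m, psi (schur_pair x m) = phi x m)
      & forall psi' : schur he M -> A,
        (forall x y, psi' (x + y) = psi' x + psi' y) ->
        (forall x m, psi' (schur_pair x m) = phi x m) -> psi' =1 psi].
Proof.
split.
- split.
  + by move=> x y m; apply: val_inj; apply: scalerDl.
  + by move=> x m n; apply: val_inj; apply: scalerDr.
  + by move=> x r m; apply: val_inj; rewrite /= scalerA.
- by move=> a x m; apply: val_inj; rewrite /= scalerA.
move=> A phi [phiDl phiDr phiM].
have ee : e *: (e : R^o) == (e : R^o) by apply/eqP; apply: he.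
pose e' : eR := exist _ (e : R^o) ee.
have e'x (x : eR) : eR_mulr e' (val x) = x.
  by apply: val_inj; have := schurP x; rewrite /GRing.scale /=.
have e'm (m : schur he M) : schur_pair e' (val m) = m.
  by apply: val_inj; apply: schurP.
exists (fun m => phi e' (val m)).
  split=> [x y | x m]; first by rewrite schur_valD phiDr.
  by rewrite /= -phiM e'x.
by move=> psi' _ psi'E m; rewrite -[in LHS](e'm m) psi'E.
Qed.

End Tensor.

Section SchurMap.
Variables (M N : lmodType R) (f : {linear M -> N}).

Lemma schur_map_subproof (m : schur he M) : e *: f (val m) == f (val m).
Proof. by rewrite -linearZ schurP. Qed.
Definition schur_map (m : schur he M) : schur he N :=
  exist _ (f (val m)) (schur_map_subproof m).

Lemma schur_map_linear : linear schur_map.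
Proof. by move=> a x y; apply: val_inj; rewrite /= linearP. Qed.
Definition schur_lin : {linear schur he M -> schur he N} :=
  mklin schur_map_linear.

End SchurMap.

Hypothesis hR : left_noetherian R.

Lemma schur_fin_gen (M : fgmod R) : fin_gen (schur he M).
Proof.
have [s sM] := fg_fin M.
pose A (m : M) := e *: m = m.
have [||t tA] := @noetherian_sub R M s (span A) hR.
- exact: submodule_span.
- by move=> x _; apply: (sM x).1.
have [|u [uA ut]] := @span_finite R M A t.
  by move=> x xt; apply: (tA x).2; apply: span_gen.
exists (map (@to_schur M) u) => x; split=> // _ K sK uK.
pose N (m : M) := forall r : R, K (to_schur (r *: m)).
have NA : N (val x).
  have : span (fun y => y \in u) (val x).
    have /(tA (val x)).1 : span A (val x) by apply: span_gen; apply: schurP.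
    exact: span_sub.
  move=> /(_ N); apply.
    split=> [r|a m m' Nm Nm' r].
      by rewrite scaler0; have -> : to_schur (0 : M) = 0 :> schur he M;
        [apply: val_inj; apply: scaler0 | case: sK].
    have -> : to_schur (r *: (a *: m + m'))
        = to_schur ((r * a) *: m) + to_schur (r *: m') :> schur he M.
      by apply: val_inj; rewrite /= scalerDr scalerA scalerDr.
    by apply: (submoduleD sK).
  move=> y yu r.
  have ere : e * (e * r * e) * e == e * r * e.
    by rewrite !mulrA he -[_ * e * e]mulrA he.
  have -> : to_schur (r *: y) = (exist _ (e * r * e) ere : eRe) *: to_schur y.
    by apply: val_inj; rewrite /= -{1}(uA y yu) !scalerA -!mulrA he.
  by apply: (submoduleZ _ sK); apply: uK; apply: map_f.
by have := NA 1; rewrite scale1r to_schurK.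
Qed.

Definition schur_fg (M : fgmod R) : fgmod eRe := FgMod (schur_fin_gen M).

Section SchurComplex.
Variable X : cpx R.

Lemma schur_cdd n (x : schur he (X n)) :
  schur_lin (cd X (n + 1)) (schur_lin (cd X n) x) = 0.
Proof. by apply: val_inj; apply: cdd. Qed.

Lemma schur_bound : exists N : nat,
  forall n : int, (N < `|n|)%N -> forall x : schur he (X n), x = 0.
Proof.
have [N XN] := cbound X; exists N => n nN x.
by apply: val_inj; apply: (XN n nN).
Qed.

Definition schur_cpx : cpx eRe :=
  @Cpx eRe (fun n => schur_fg (X n)) (fun n => schur_lin (cd X n))
    schur_cdd schur_bound.

End SchurComplex.

Lemma schur_cmapE X Y (f : cmap X Y) n (x : schur_cpx X n) :
  schur_lin (f (n + 1)) (cd (schur_cpx X) n x)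
  = cd (schur_cpx Y) n (schur_lin (f n) x).
Proof. by apply: val_inj; apply: cfunE. Qed.

Definition schur_cmap X Y (f : cmap X Y) : cmap (schur_cpx X) (schur_cpx Y) :=
  @Cmap _ (schur_cpx X) (schur_cpx Y) (fun n => schur_lin (f n))
    (schur_cmapE f).

Lemma schur_homotopic X Y (f g : cmap X Y) :
  homotopic f g -> homotopic (schur_cmap f) (schur_cmap g).
Proof.
move=> [h Hh]; exists (fun n => schur_lin (h n)) => n x.
by apply: val_inj; apply: Hh.
Qed.

Lemma schur_cmap_id X : homotopic (schur_cmap (cmap_id X)) (cmap_id _).
Proof. by apply: eq_homotopic => n x; apply: val_inj. Qed.

Lemma schur_cmap_comp X Y Z (g : cmap Y Z) (f : cmap X Y) :
  homotopic (schur_cmap (cmap_comp g f))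
            (cmap_comp (schur_cmap g) (schur_cmap f)).
Proof. by apply: eq_homotopic => n x; apply: val_inj. Qed.

Definition schur_Kb : functor (Kb R) (Kb eRe) :=
  @Functor (Kb R) (Kb eRe) schur_cpx schur_cmap schur_homotopic
    schur_cmap_id schur_cmap_comp.

Lemma schur_quasi_iso (X Y : Kb R) (f : hom X Y) :
  quasi_iso f -> quasi_iso (fmap schur_Kb f).
Proof.
move=> qf n; have [finj fsurj] := qf n; split.
  move=> x /(congr1 val)/= dx [y /(congr1 val)/= fx].
  have [|w Dx] := finj (val x) dx; first by exists (val y).
  exists (to_schur w); apply: val_inj.
  apply: etrans (esym (schurP x)) _.
  by rewrite Dx -linearZ.
move=> y /(congr1 val)/= dy.
have [x [w [dx Dy]]] := fsurj (val y) dy.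
exists (to_schur x), (to_schur w); split; apply: val_inj => /=.
  by rewrite linearZ /= dx scaler0.
apply: etrans (esym (schurP y)) _.
by rewrite Dy scalerDr -!linearZ.
Qed.

Definition schur_Db : functor (Db R) (Db eRe) := loc_functor schur_quasi_iso.

(* By the universal property of the localization, the second condition
   determines F up to natural isomorphism. *)
Definition induced_by_schur (F : functor (Dsg R) (Dsg eRe)) :=
  triangle_functor F /\
  nat_isomorphic (functor_comp F (sg_quotient R))
                 (functor_comp (sg_quotient eRe) schur_Db).

End Corner.

(* Main.v *)
(* A bounded complex is called perf when it is quasi-isomorphic to a bounded
   complex of finitely generated projectives; on D^b(R-mod) this is
   perfectness. D_sg(R) is then the localization of K^b(R-mod) at the chain
   maps with perf cone, which admit a calculus of left fractions.

   If e is singularly-complete, a bounded complex X with S_e X acyclic is perf,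
   because its cohomology modules are killed by e. Hence the counit
   Re (x)_{eRe} S_e X -> X has perf cone, and N |-> Re (x)_{eRe} N, although it
   is not exact, sends quasi-isomorphisms and maps with perf cone to maps with
   perf cone: its value on an acyclic complex becomes acyclic under S_e, and it
   preserves projectives. It therefore induces a quasi-inverse of the induced
   functor on singularity categories.

   Conversely, if the induced functor is faithful and eM = 0, then M is zero in
   D_sg(R). By the calculus of fractions M is, up to shift, a homotopy retract
   of a perf complex, and a sufficiently high syzygy of M is then projective. *)

From HB Require Import structures.
From mathcomp Require Import all_boot all_order all_algebra zify boolp.
From Corelib Require Import Setoid Morphisms.
Require Import Defs.

Set Implicit Arguments.
Unset Strict Implicit.
Unset Printing Implicit Defensive.

Import Order.TTheory GRing.Theory Num.Theory.
Local Open Scope ring_scope.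
Local Open Scope cat_scope.

(** * Equalities in abelian groups *)

(** Three obstacles shape the argument. Morphisms of a localization are formal words modulo a
    congruence: equalities of words can be built but not analysed, and two words are told apart only
    by a functor out of the localization. Cohomology plays this role for quasi-isomorphisms, and
    fractions with a fixed target play it for maps with perf cone; this is why D_sg is compared with
    a single localization of K^b.

    The derived tensor product with Re need not stay bounded, since Re may have infinite projective
    dimension as a right eRe-module. The underived one suffices because e(Re (x) N) = N holds
    without deriving anything.

    A homotopy retract of a perf complex is not visibly perf, since an idempotent up to homotopy
    would have to be split. The splitting is moved into one degree of a long truncated resolution,
    where it becomes an honest retraction of modules. *)

Inductive zexp := ZVar of nat | ZZero | ZOpp of zexp | ZAdd of zexp & zexp.

Fixpoint zeval (V : zmodType) (l : seq V) (t : zexp) : V :=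
  match t with
  | ZVar i => l`_i
  | ZZero => 0
  | ZOpp a => - zeval l a
  | ZAdd a b => zeval l a + zeval l b
  end.

Fixpoint zcoef (t : zexp) (i : nat) : int :=
  match t with
  | ZVar j => (i == j)%:Z
  | ZZero => 0
  | ZOpp a => - zcoef a i
  | ZAdd a b => zcoef a i + zcoef b i
  end.

(** Normal form of an expression: an integer combination of the atoms. Variables beyond the end of
    [l] evaluate to 0, so they contribute no term. *)
Lemma zeval_sum (V : zmodType) (l : seq V) (t : zexp) :
  zeval l t = \sum_(i < size l) l`_i *~ zcoef t i.
Proof.
elim: t => [j||a IHa|a IHa b IHb] /=.
- case: (ltnP j (size l)) => [jl | lj].
    rewrite (bigD1 (Ordinal jl)) //= eqxx mulr1z big1 ?addr0 // => i ij.
    by rewrite -val_eqE /= in ij; rewrite (negbTE ij) mulr0z.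
  rewrite nth_default // big1 // => i _.
  by rewrite (ltn_eqF (leq_trans (ltn_ord i) lj)) mulr0z.
- by rewrite big1 // => i _; rewrite mulr0z.
- by rewrite IHa -sumrN; apply: eq_bigr => i _; rewrite mulrNz.
- by rewrite IHa IHb -big_split; apply: eq_bigr => i _; rewrite mulrzDr.
Qed.

Lemma zeval_eq (V : zmodType) (l : seq V) (n : nat) (a b : zexp) :
  size l = n -> all (fun i => zcoef a i == zcoef b i) (iota 0 n) ->
  zeval l a = zeval l b.
Proof.
move=> ln /allP ab; rewrite !zeval_sum; apply: eq_bigr => i _.
by rewrite (eqP (ab i _)) // mem_iota -ln /=.
Qed.

(** Atoms are compared by unification, so terms that are only convertible share a variable. *)
Ltac zmod_index x l :=
  lazymatch l with
  | cons ?y ?l' =>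
    match goal with
    | _ => let _ := match goal with _ => unify x y end in constr:(0%N)
    | _ => let i := zmod_index x l' in constr:(S i)
    end
  end.

Ltac zmod_atoms t l :=
  lazymatch t with
  | @GRing.add _ ?a ?b => let l' := zmod_atoms a l in zmod_atoms b l'
  | @GRing.opp _ ?a => zmod_atoms a l
  | @GRing.zero _ => l
  | _ => match goal with
         | _ => let _ := zmod_index t l in l
         | _ => constr:(cons t l)
         end
  end.

Ltac zmod_reify t l :=
  lazymatch t with
  | @GRing.add _ ?a ?b =>
    let a' := zmod_reify a l in let b' := zmod_reify b l in
    constr:(ZAdd a' b')
  | @GRing.opp _ ?a => let a' := zmod_reify a l in constr:(ZOpp a')
  | @GRing.zero _ => constr:(ZZero)
  | _ => let i := zmod_index t l in constr:(ZVar i)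
  end.

Ltac zmod_size l :=
  lazymatch l with
  | cons _ ?l' => let n := zmod_size l' in constr:(S n)
  | _ => constr:(0%N)
  end.

Ltac zmod :=
  simpl;
  lazymatch goal with
  | |- @eq ?T ?x ?y =>
    let l0 := constr:(@nil T) in
    let l1 := zmod_atoms x l0 in
    let l := zmod_atoms y l1 in
    let a := zmod_reify x l in
    let b := zmod_reify y l in
    let n := zmod_size l in
    refine (@zeval_eq _ l n a b erefl _); vm_compute; exact erefl
  end.


Lemma eq_lin1 (V : zmodType) (x y a b : V) : x = y -> a - b = x - y -> a = b.
Proof. by move=> -> ab; apply/eqP; rewrite -subr_eq0 ab subrr. Qed.

Lemma eq_lin2 (V : zmodType) (x y z t a b : V) :
  x = y -> z = t -> a - b = (x - y) + (z - t) -> a = b.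
Proof. by move=> -> ->; rewrite !subrr addr0 => ab; apply/eqP; rewrite -subr_eq0 ab. Qed.

(** Proves an equation in an abelian group whose difference of sides is plus or minus that of [H];
    [zlin2] tries the four sign choices for a sum of two hypotheses. *)
Ltac zlin1 H :=
  simpl; first [apply: (eq_lin1 H); zmod | apply: (eq_lin1 (esym H)); zmod].
Ltac zlin2 H K :=
  simpl; first [apply: (eq_lin2 H K); zmod | apply: (eq_lin2 (esym H) K); zmod
        | apply: (eq_lin2 H (esym K)); zmod
        | apply: (eq_lin2 (esym H) (esym K)); zmod].

(** * Localizations *)

#[local] Hint Resolve heq_refl : core.

#[export] Instance heq_equivalence (C : category) (X Y : C) :
  Equivalence (@heq C X Y).
Proof. by split; [exact: heq_refl | exact: heq_sym | exact: heq_trans]. Qed.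

#[export] Instance comp_proper (C : category) (X Y Z : C) :
  Proper (heq ==> heq ==> heq)%signature (@comp C X Y Z).
Proof. by move=> g g' gg f f' ff; apply: comp_heq. Qed.

#[export] Instance fmap_proper (C D : category) (F : functor C D) (X Y : C) :
  Proper (heq ==> heq)%signature (@fmap C D F X Y).
Proof. by move=> f f' ff; apply: fmap_heq. Qed.

Section CatLemmas.
Variable C : category.

Lemma heq_iso (X Y : C) (f g : hom X Y) : f =~ g -> is_iso f -> is_iso g.
Proof. by move=> fg [h [hf fh]]; exists h; split; rewrite -fg. Qed.

Lemma iso_comp_l (X Y Z : C) (g : hom Y Z) (f : hom X Y) :
  is_iso f -> is_iso (g <o> f) -> is_iso g.
Proof.
move=> [f' [f'f ff']] isogf.
have isof' : is_iso f' by exists f.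
apply: heq_iso (comp_iso isogf isof').
by rewrite -comp_assoc ff' comp_idr.
Qed.

Lemma iso_comp_r (X Y Z : C) (g : hom Y Z) (f : hom X Y) :
  is_iso g -> is_iso (g <o> f) -> is_iso f.
Proof.
move=> [g' [g'g gg']] isogf.
have isog' : is_iso g' by exists g.
apply: heq_iso (comp_iso isog' isogf).
by rewrite comp_assoc g'g comp_idl; reflexivity.
Qed.

End CatLemmas.

(** Invertibility is a proposition while [lift_map] must produce a morphism, so an inverse is picked
    by choice. *)
Definition iso_inv (C : category) (X Y : C) (f : hom X Y) (h : is_iso f) :
  hom Y X := proj1_sig (cid h).

Lemma iso_invP (C : category) (X Y : C) (f : hom X Y) (h : is_iso f) :
  is_inverse f (iso_inv h).
Proof. exact: proj2_sig (cid h). Qed.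

(** * Universal property of a localization *)

Section LocLift.
Variables (C E : category) (W : forall X Y : C, hom X Y -> Prop).
Variable H : functor C E.
Hypothesis HW : forall (X Y : C) (f : hom X Y), W f -> is_iso (fmap H f).

Fixpoint lift_map X Y (m : lhom W X Y) : hom (H X) (H Y) :=
  match m in lhom _ X Y return hom (H X) (H Y) with
  | Lof _ _ f => fmap H f
  | Linv _ _ s Ws => iso_inv (HW Ws)
  | Lcomp _ _ _ g f => lift_map g <o> lift_map f
  end.

Lemma lift_map_heq X Y (f g : lhom W X Y) :
  lheq f g -> lift_map f =~ lift_map g.
Proof.
elim=> {X Y f g} /=.
- by move=> X Y f; reflexivity.
- by move=> X Y f g _ ->; reflexivity.
- by move=> X Y f g h _ -> _ ->; reflexivity.
- by move=> X Y Z g g' f f' _ -> _ ->; reflexivity.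
- by move=> X Y Z T h g f; apply: comp_assoc.
- by move=> X Y f; rewrite fmap_id; apply: comp_idl.
- by move=> X Y f; rewrite fmap_id; apply: comp_idr.
- by move=> X Y f g fg; apply: fmap_heq.
- by move=> X Y Z g f; apply: fmap_comp.
- by move=> X Y s Ws; rewrite fmap_id; case: (iso_invP (HW Ws)).
- by move=> X Y s Ws; rewrite fmap_id; case: (iso_invP (HW Ws)).
Qed.

Definition loc_lift : functor (localization W) E :=
  @Functor (localization W) E H lift_map lift_map_heq
    (fun X => fmap_id H X)
    (fun X Y Z g f => heq_refl (lift_map g <o> lift_map f)).

End LocLift.

Section LocNat.
Variables (C E : category) (W : forall X Y : C, hom X Y -> Prop).
Variables F G : functor (localization W) E.
Variable eta : forall X : C, hom (F X) (G X).

Lemma Linv_inverse (X Y : C) (s : hom X Y) (Ws : W s) :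
  is_inverse (Lof W s : @hom (localization W) X Y) (Linv Ws).
Proof. by split; [apply: lheq_invl | apply: lheq_invr]. Qed.

(** Naturality is tested on generators: the square of [s] yields that of its formal inverse by
    cancelling [s] on both sides, and squares paste along composites. *)
Lemma loc_natural :
  (forall (X Y : C) (f : hom X Y),
     eta Y <o> fmap F (Lof W f) =~ fmap G (Lof W f) <o> eta X) ->
  forall (X Y : localization W) (m : hom X Y),
    eta Y <o> fmap F m =~ fmap G m <o> eta X.
Proof.
move=> nat X Y; elim=> {X Y} [X Y f|X Y s Ws|X Y Z g IHg f IHf].
- exact: nat.
- have [l r] := Linv_inverse Ws.
  have E1 : fmap G (Linv Ws) <o> fmap G (Lof W s) =~ idm (G X).
    by rewrite -(fmap_comp G (Linv Ws) (Lof W s)) l; apply: fmap_id.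
  have E2 : fmap F (Lof W s) <o> fmap F (Linv Ws) =~ idm (F Y).
    by rewrite -(fmap_comp F (Lof W s) (Linv Ws)) r; apply: fmap_id.
  rewrite -(comp_idl (eta X <o> _)) -E1 -(comp_assoc _ _ (eta X <o> _)).
  rewrite (comp_assoc _ (eta X)) -nat -(comp_assoc (eta Y)) E2 comp_idr.
  by reflexivity.
- rewrite (fmap_comp F g f) (fmap_comp G g f).
  by rewrite comp_assoc IHg -comp_assoc IHf comp_assoc; reflexivity.
Qed.

End LocNat.

(** * Setoids and opposite categories *)

Section SetoidCategory.
Variables (I : Type) (T : I -> Type) (R : forall i, T i -> T i -> Prop).
Hypothesis RR : forall i, Equivalence (@R i).

Record smap i j := Smap {
  sfun :> T i -> T j;
  sfunP : forall x y, R x y -> R (sfun x) (sfun y) }.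

(** Stands in for the category of sets as a target for cohomology and for fractions; quotients by
    the relations are never formed. *)
Definition setoid_cat : category.
Proof.
apply: (@Category I smap (fun i j f g => forall x, R (f x) (g x))
  (fun i => @Smap i i id (fun _ _ h => h))
  (fun i j k g f => @Smap i k (g \o f) (fun x y h => sfunP g (sfunP f h)))).
- by move=> i j f x; reflexivity.
- by move=> i j f g fg x; symmetry.
- by move=> i j f g h fg gh x; rewrite fg; apply: gh.
- move=> i j k g g' f f' gg ff x /=; transitivity (g (f' x)) => //.
  exact: sfunP.
- by move=> i j f x /=; reflexivity.
- by move=> i j f x /=; reflexivity.
- by move=> i j k l h g f x /=; reflexivity.
Defined.

Lemma setoid_iso (i j : setoid_cat) (f : hom i j) :
  (forall x y, R (sfun f x) (sfun f y) -> R x y) ->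
  (forall y, exists x, R (sfun f x) y) -> is_iso f.
Proof.
move=> finj fsurj; pose g y := proj1_sig (cid (fsurj y)).
have gP y : R (sfun f (g y)) y := proj2_sig (cid (fsurj y)).
have gR x y : R x y -> R (g x) (g y).
  by move=> xy; apply: finj; rewrite !gP.
exists (Smap gR : @hom setoid_cat j i); split=> x /=; last exact: gP.
by apply: finj; rewrite gP; reflexivity.
Qed.

Lemma setoid_iso_inj (i j : setoid_cat) (f : hom i j) x y :
  is_iso f -> R (sfun f x) (sfun f y) -> R x y.
Proof.
move=> [g [gf _]] /(sfunP g) gxy.
by transitivity (sfun g (sfun f x)); [symmetry; exact: gf | rewrite gxy; exact: gf].
Qed.

Lemma setoid_iso_surj (i j : setoid_cat) (f : hom i j) y :
  is_iso f -> exists x, R (sfun f x) y.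
Proof. by move=> [g [_ fg]]; exists (sfun g y); apply: fg. Qed.

End SetoidCategory.

Section Opposite.
Variable C : category.

Definition opp_cat : category :=
  @Category C (fun X Y => @hom C Y X) (fun X Y => @heq C Y X) (@idm C)
    (fun X Y Z g f => f <o> g)
    (fun X Y f => heq_refl f) (fun X Y f g => @heq_sym C Y X f g)
    (fun X Y f g h => @heq_trans C Y X f g h)
    (fun X Y Z g g' f f' gg ff => comp_heq ff gg)
    (fun X Y f => comp_idr f) (fun X Y f => comp_idl f)
    (fun X Y Z T h g f => heq_sym (comp_assoc f g h)).

Lemma opp_iso (X Y : C) (f : @hom C X Y) :
  is_iso f -> @is_iso opp_cat Y X f.
Proof. by move=> [g [gf fg]]; exists g; split. Qed.

End Opposite.

(** * Calculus of left fractions *)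

Section Fractions.
Variables (C : category) (V : forall X Y : C, hom X Y -> Prop).
Hypothesis V_id : forall X : C, V (idm X).
Hypothesis V_comp : forall (X Y Z : C) (g : hom Y Z) (f : hom X Y),
  V g -> V f -> V (g <o> f).
Hypothesis V_heq : forall (X Y : C) (f g : hom X Y), f =~ g -> V f -> V g.
Hypothesis V_ore : forall (X X1 Y : C) (u : hom X X1) (f : hom X Y), V u ->
  exists (Z : C) (u' : hom Y Z) (f' : hom X1 Z), V u' /\ f' <o> u =~ u' <o> f.
Hypothesis V_cancel : forall (X X1 Y : C) (u : hom X X1) (f g : hom X1 Y),
  V u -> f <o> u =~ g <o> u ->
  exists (Z : C) (w : hom Y Z), V w /\ w <o> f =~ w <o> g.

Let V_proper (X Y : C) : Proper (heq ==> iff) (@V X Y).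
Proof. by move=> f g fg; split; apply: V_heq; rewrite // fg. Qed.
#[local] Existing Instance V_proper.

Variable Y : C.

(** A roof X -> [fden] <- Y standing for the composite of [fnum] with the inverse of [fs]. With Y
    fixed, precomposition is the only operation required, so fractions are never composed with each
    other. *)
Record fraction (X : C) := Fraction {
  fden : C; fs : hom Y fden; fsV : V fs; fnum : hom X fden }.

Definition frac_eq X (p q : fraction X) :=
  exists (Z : C) (a : hom (fden p) Z) (b : hom (fden q) Z),
    [/\ V (a <o> fs p), a <o> fs p =~ b <o> fs q
      & a <o> fnum p =~ b <o> fnum q].

Lemma frac_equivalence X : Equivalence (@frac_eq X).
Proof.
split.
- move=> [Y' s Vs f]; exists Y', (idm _), (idm _); split; try reflexivity.
  exact: V_comp.
- move=> [Y1 s Vs f] [Y2 t Vt g] [Z [a [b [/= Vas ab1 ab2]]]].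
  exists Z, b, a; split=> /=; [exact: V_heq ab1 _ | |]; exact: heq_sym.
- move=> [Y1 s Vs f] [Y2 t Vt g] [Y3 w Vw h].
  move=> [Z1 [a [b [/= Vas ab1 ab2]]]] [Z2 [c [d [/= Vct cd1 cd2]]]].
  have Vbt : V (b <o> t) by apply: V_heq Vas.
  (* The Ore square brings the two refinements of the middle denominator [t] to a common target.
     There [q c] and [p b] agree only after precomposition with [t]; cancelling it costs the further
     map [r]. *)
  have [Z [p [q [Vp qp]]]] := V_ore (b <o> t) Vct.
  have qpt : (q <o> c) <o> t =~ (p <o> b) <o> t by rewrite -!comp_assoc.
  have [Z' [r [Vr rE]]] := V_cancel Vt qpt.
  exists Z', (r <o> p <o> a), (r <o> q <o> d); split=> /=.
  + by rewrite -!comp_assoc; apply: V_comp Vr (V_comp Vp Vas).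
  + by rewrite -!comp_assoc ab1 -cd1 -qp.
  + rewrite -!comp_assoc ab2 -cd2.
    by have := comp_heq (heq_sym rE) (heq_refl g); rewrite -!comp_assoc.
Qed.

Lemma precomp_frac_eq X X1 (u : hom X X1) (p q : fraction X1) :
  frac_eq p q ->
  frac_eq (Fraction (fsV p) (fnum p <o> u)) (Fraction (fsV q) (fnum q <o> u)).
Proof.
move=> [Z [a [b [h1 h2 h3]]]]; exists Z, a, b; split=> //=.
by rewrite !comp_assoc h3; reflexivity.
Qed.

(** Fractions into Y are contravariant in their source, like the representable functor of the
    localization that they describe; hence the opposite category. *)
Definition frac_cat : category := opp_cat (setoid_cat frac_equivalence).

Definition frac_functor : functor C frac_cat.
Proof.
apply: (@Functor C frac_cat (fun X => X)
  (fun X X1 u => Smap (@precomp_frac_eq X X1 u))).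
- move=> X X1 f g fg p /=; exists (fden p), (idm _), (idm _); split=> /=.
  + by apply: V_comp => //; apply: fsV.
  + by reflexivity.
  + by rewrite fg; reflexivity.
- move=> X p /=; exists (fden p), (idm _), (idm _); split=> /=.
  + by apply: V_comp => //; apply: fsV.
  + by reflexivity.
  + by rewrite comp_idr; reflexivity.
- move=> X Y' Z g f p /=; exists (fden p), (idm _), (idm _); split=> /=.
  + by apply: V_comp => //; apply: fsV.
  + by reflexivity.
  + by rewrite !comp_assoc.
Defined.

(** Precomposition with [u] is injective on fractions by cancellation and surjective by the Ore
    condition. *)
Lemma frac_functor_V (X X1 : C) (u : hom X X1) :
  V u -> is_iso (fmap frac_functor u).
Proof.
move=> Vu; apply: opp_iso; apply: setoid_iso.
- move=> [Y1 s Vs f] [Y2 t Vt g] [Z [a [b [/= Vas ab1 ab2]]]].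
  have abu : (a <o> f) <o> u =~ (b <o> g) <o> u by rewrite -!comp_assoc.
  have [Z' [r [Vr rE]]] := V_cancel Vu abu.
  exists Z', (r <o> a), (r <o> b); split=> /=.
  + by rewrite -!comp_assoc; apply: V_comp.
  + by rewrite -!comp_assoc ab1; reflexivity.
  + by rewrite -!comp_assoc.
- move=> [Y1 s Vs f]; have [Z [u' [f' [Vu' E]]]] := V_ore f Vu.
  exists (Fraction (V_comp Vu' Vs) f'), Z, (idm _), u'; split=> /=.
  + by apply: V_comp => //; apply: V_comp.
  + by rewrite comp_idl; reflexivity.
  + by rewrite comp_idl.
Qed.

End Fractions.

(** Both morphisms act on the identity fraction of Y through the lifted functor. The results are the
    fractions with denominator [idm Y] and numerators [f] and [g], and their equivalence is the
    required [w]. *)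
Lemma loc_eq (C : category) (V : forall X Y : C, hom X Y -> Prop)
    (V_id : forall X : C, V _ _ (idm X))
    (V_comp : forall (X Y Z : C) (g : hom Y Z) (f : hom X Y),
       V Y Z g -> V X Y f -> V X Z (g <o> f))
    (V_heq : forall (X Y : C) (f g : hom X Y), f =~ g -> V X Y f -> V X Y g)
    (V_ore : forall (X X1 Y : C) (u : hom X X1) (f : hom X Y), V X X1 u ->
       exists (Z : C) (u' : hom Y Z) (f' : hom X1 Z),
         V Y Z u' /\ f' <o> u =~ u' <o> f)
    (V_cancel : forall (X X1 Y : C) (u : hom X X1) (f g : hom X1 Y),
       V X X1 u -> f <o> u =~ g <o> u ->
       exists (Z : C) (w : hom Y Z), V Y Z w /\ w <o> f =~ w <o> g)
    (X Y : C) (f g : hom X Y) :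
  fmap (loc V) f =~ fmap (loc V) g ->
  exists (Z : C) (w : hom Y Z), V Y Z w /\ w <o> f =~ w <o> g.
Proof.
pose H := loc_lift (frac_functor_V V_id V_comp V_heq V_ore V_cancel Y).
move=> /(fmap_heq H) /(_ (Fraction (V_id Y) (idm Y))) [Z [a [b [/= Va ab1 ab2]]]].
have ab : a =~ b by rewrite -(comp_idr a) ab1 comp_idr; reflexivity.
exists Z, a; split; first exact: (V_heq _ _ _ _ (comp_idr a) Va).
move: ab2; rewrite !comp_idl => ->; rewrite ab; reflexivity.
Qed.

(** * Submodules and quotient modules *)

Section SubModule.
Variables (R : pzRingType) (V : lmodType R) (N : V -> Prop).
Hypothesis sN : submodule N.

(** The anonymous argument keeps the closure proof in the type, where the module instances can find
    it; [quotm] uses the same device. *)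
Definition subm & submodule N := {x : V | `[< N x >]}.
Notation K := (subm sN).

HB.instance Definition _ := [isSub of K for @sval _ _].
HB.instance Definition _ := [Choice of K by <:].

Lemma subm_closed : GRing.subsemimod_closed (fun x : V => `[< N x >]).
Proof.
have [N0 Nlin] := sN; split; first split.
- exact/asboolP.
- by move=> x y /asboolP Nx /asboolP Ny; apply/asboolP; apply: submoduleD.
- by move=> a x /asboolP Nx; apply/asboolP; apply: submoduleZ.
Qed.

HB.instance Definition _ :=
  GRing.SubChoice_isSubLmodule.Build R V _ K subm_closed.

End SubModule.

Section SubQuotient.
Variables (R : pzRingType) (V : lmodType R) (N : V -> Prop).
Hypothesis sN : submodule N.

Lemma submodule_object : exists (K : lmodType R) (k : {linear K -> V}),
  injective k /\ forall x, N x <-> exists y, x = k y.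
Proof.
exists (subm sN : lmodType R), (val : {linear subm sN -> V}); split; first exact: val_inj.
move=> x; split=> [Nx | [y ->]]; last exact/asboolP/(valP y).
by exists (exist _ x (asboolT Nx)).
Qed.

(** A canonical element of the coset of [x]: [choose] depends only on the extension of its predicate
    once the seed satisfies it. The quotient module is then the subtype of canonical elements. *)
Definition crep (x : V) : V := choose (fun y => `[< N (x - y) >]) x.

Lemma crepP x : N (x - crep x).
Proof.
apply/asboolP; rewrite /crep; apply: (chooseP (P := fun y => `[< N (x - y) >])).
by apply/asboolP; rewrite subrr; case: sN.
Qed.

Lemma crepE x y : N (x - y) -> crep x = crep y.
Proof.
move=> Nxy; rewrite /crep.
have E : (fun z => `[< N (x - z) >]) =1 (fun z => `[< N (y - z) >]).
  move=> z; apply: asbool_equiv_eq; split=> H.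
    have -> : y - z = (x - z) - (x - y) by zmod.
    exact: submoduleB.
  have -> : x - z = (x - y) + (y - z) by zmod.
  exact: submoduleD.
rewrite (eq_choose E); apply: choose_id; apply/asboolP; last first.
  by rewrite subrr; case: sN.
have -> : y - x = 0 - (x - y) by zmod.
by apply: submoduleB => //; case: sN.
Qed.

Lemma crepK x : crep (crep x) = crep x.
Proof. by apply/esym/crepE/crepP. Qed.

Definition quotm & submodule N := {x : V | crep x == x}.
Notation Q := (quotm sN).

HB.instance Definition _ := [isSub of Q for @sval _ _].
HB.instance Definition _ := [Choice of Q by <:].

Definition qpi (x : V) : Q := exist _ (crep x) (introT eqP (crepK x)).

Lemma qpiK (q : Q) : qpi (val q) = q.
Proof. by apply: val_inj; apply/eqP/(valP q). Qed.

Lemma qpiE x y : N (x - y) -> qpi x = qpi y.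
Proof. by move=> Nxy; apply: val_inj; apply: crepE. Qed.

Lemma qpi_lin a x y : N ((a *: x + y) - (a *: crep x + crep y)).
Proof.
have -> : (a *: x + y) - (a *: crep x + crep y)
  = a *: (x - crep x) + (y - crep y) by rewrite scalerBr; zmod.
by apply: sN.2; apply: crepP.
Qed.

Definition q0 : Q := qpi 0.
Definition qN (x : Q) : Q := qpi (- val x).
Definition qD (x y : Q) : Q := qpi (val x + val y).
Definition qZ (a : R) (x : Q) : Q := qpi (a *: val x).

Let NE x y : N x -> x = y -> N y. Proof. by move=> Nx <-. Qed.
Let NN x : N x -> N (- x).
Proof. by move=> Nx; rewrite -scaleN1r; apply: submoduleZ. Qed.

Lemma q_addC : commutative qD.
Proof. by move=> x y; rewrite /qD addrC. Qed.
Lemma q_addA : associative qD.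
Proof.
move=> x y z; apply: qpiE => /=.
apply: NE (submoduleB sN (crepP (val x + val y)) (crepP (val y + val z))) _.
by zmod.
Qed.
Lemma q_add0 : left_id q0 qD.
Proof.
move=> x; rewrite -[RHS]qpiK; apply: qpiE => /=.
by apply: NE (NN (crepP 0)) _; zmod.
Qed.
Lemma q_addN : left_inverse q0 qN qD.
Proof.
move=> x; apply: qpiE => /=.
by apply: NE (NN (crepP (- val x))) _; zmod.
Qed.
HB.instance Definition _ := GRing.isZmodule.Build Q q_addA q_addC q_add0 q_addN.

Lemma q_scaleA a b (v : Q) : qZ a (qZ b v) = qZ (a * b) v.
Proof.
apply: qpiE => /=; rewrite -scalerA.
by apply: NE (NN (submoduleZ a sN (crepP (b *: val v)))) _; rewrite scalerBr; zmod.
Qed.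
Lemma q_scale1 : left_id 1 qZ.
Proof. by move=> v; rewrite /qZ scale1r qpiK. Qed.
Lemma q_scaleDr : right_distributive qZ +%R.
Proof.
move=> a u v; apply: qpiE => /=.
set x := a *: val u; set y := a *: val v.
apply: NE (submoduleB sN (submoduleD sN (crepP x) (crepP y))
  (submoduleZ a sN (crepP (val u + val v)))) _.
by rewrite scalerBr scalerDr /x /y; zmod.
Qed.
Lemma q_scaleDl v : {morph qZ^~ v : a b / a + b}.
Proof.
move=> a b; apply: qpiE => /=; rewrite scalerDl.
by apply: NE (submoduleD sN (crepP (a *: val v)) (crepP (b *: val v))) _; zmod.
Qed.
HB.instance Definition _ := GRing.Zmodule_isLmodule.Build R Q
  q_scaleA q_scale1 q_scaleDr q_scaleDl.

Lemma qpi_linear : linear qpi.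
Proof.
move=> a x y; apply: qpiE => /=.
set u := crep x; set v := crep y.
by apply: NE (submoduleD sN (qpi_lin a x y) (crepP (a *: u))) _; rewrite /u /v; zmod.
Qed.

Lemma quotient_object : exists (Q : lmodType R) (p : {linear V -> Q}),
  (forall q, exists x, q = p x) /\ forall x, p x = 0 <-> N x.
Proof.
exists (Q : lmodType R), (mklin qpi_linear); split=> [q|x].
  by exists (val q); rewrite /= qpiK.
split=> /= [/(congr1 val)/= E | Nx].
  apply: NE (submoduleB sN (crepP x) (crepP 0)) _; rewrite E.
  by zmod.
by apply: (qpiE (y := 0)); rewrite subr0.
Qed.

End SubQuotient.

(** * Lifting, descent and projective covers of modules *)

Section LinLift.
Variable R : pzRingType.
Implicit Types U V W K P Q : lmodType R.

Lemma lin_lift U V K (k : {linear K -> V}) (f : {linear U -> V}) :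
  injective k -> (forall x, exists y, f x = k y) ->
  exists g : {linear U -> K}, forall x, k (g x) = f x.
Proof.
move=> kinj fk; pose g x := proj1_sig (cid (fk x)).
have gP x : k (g x) = f x by rewrite /g; case: cid.
have glin : linear g by move=> a x y; apply: kinj; rewrite linearP !gP linearP.
by exists (mklin glin).
Qed.

Lemma lin_descend V W Q (p : {linear V -> Q}) (f : {linear V -> W}) :
  (forall q, exists x, q = p x) -> (forall x, p x = 0 -> f x = 0) ->
  exists g : {linear Q -> W}, forall x, g (p x) = f x.
Proof.
move=> psurj pf; pose s q := proj1_sig (cid (psurj q)).
have sP q : q = p (s q) by rewrite /s; case: cid.
have gP x : f (s (p x)) = f x.
  by apply/eqP; rewrite -subr_eq0 -linearB pf // linearB -sP subrr.
have glin : linear (fun q => f (s q)).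
  move=> a x y; rewrite -linearP {1}(sP x) {1}(sP y) -linearP.
  exact: gP.
by exists (mklin glin).
Qed.

Lemma bij_inverse U V (f : {linear U -> V}) :
  injective f -> (forall y, exists x, y = f x) ->
  exists g : {linear V -> U}, cancel f g /\ cancel g f.
Proof.
move=> finj fsurj.
have [g gP] := @lin_lift V V U f idfun finj fsurj.
by exists g; split=> // x; apply: finj; rewrite gP.
Qed.

(** [projective] asks for [p] to be onto. When only the image of [f] lies in that of [p], both maps
    are corestricted to the image of [p] first. *)
Lemma proj_lift P U V (p : {linear U -> V}) (f : {linear P -> V}) :
  projective P -> (forall x, exists u, f x = p u) ->
  exists g : {linear P -> U}, forall x, p (g x) = f x.
Proof.
move=> projP fp.
have sI : submodule (fun v => exists u, v = p u).
  split=> [|a _ _ [u ->] [v ->]]; first by exists 0; rewrite linear0.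
  by exists (a *: u + v); rewrite linearP.
have [K [k [kinj kP]]] := submodule_object sI.
have [|p' p'E] := @lin_lift U V K k p kinj; first by move=> u; apply/kP; exists u.
have [|f' f'E] := @lin_lift P V K k f kinj; first by move=> x; apply/kP.
have [|g gE] := projP U K p' f'.
  move=> y; have [u Eu] := (kP (k y)).2 (ex_intro _ y erefl).
  by exists u; apply: kinj; rewrite p'E.
by exists g => x; rewrite -p'E gE f'E.
Qed.

Lemma proj_retract P Q (i : {linear P -> Q}) (r : {linear Q -> P}) :
  cancel i r -> projective Q -> projective P.
Proof.
move=> ri projQ U V p f psurj.
have [g gE] := projQ U V p (f \o r : {linear Q -> V}) psurj.
by exists (g \o i : {linear P -> U}) => x; rewrite /= gE /= ri.
Qed.

Lemma projective_regular : projective R^o.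
Proof.
move=> U V p f psurj; have [u pu] := psurj (f 1).
have glin : linear (fun r : R^o => (r : R) *: u).
  by move=> a x y; rewrite scalerDl -scalerA.
exists (mklin glin) => x /=; rewrite linearZ pu -linearZ; congr (f _).
exact: mulr1.
Qed.

Lemma pair_left_linear U V : linear (fun u : U => (u, 0 : V)).
Proof. by move=> a x y; congr pair; rewrite /= scaler0 addr0. Qed.
Lemma pair_right_linear U V : linear (fun v : V => (0 : U, v)).
Proof. by move=> a x y; congr pair; rewrite /= scaler0 addr0. Qed.
Definition pairl U V : {linear U -> (U * V)%type} := mklin (@pair_left_linear U V).
Definition pairr U V : {linear V -> (U * V)%type} := mklin (@pair_right_linear U V).
Definition fstl U V : {linear (U * V)%type -> U} := fst.
Definition sndl U V : {linear (U * V)%type -> V} := snd.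

Lemma copair_linear U V W (f : {linear U -> W}) (g : {linear V -> W}) :
  linear (fun x : U * V => f x.1 + g x.2).
Proof. by move=> a x y; rewrite !linearP scalerDr; zmod. Qed.
Definition copair U V W (f : {linear U -> W}) (g : {linear V -> W}) :
  {linear (U * V)%type -> W} := mklin (copair_linear f g).

Lemma mkpair_linear U V W (f : {linear W -> U}) (g : {linear W -> V}) :
  linear (fun x : W => (f x, g x)).
Proof. by move=> a x y; rewrite !linearP. Qed.
Definition mkpair U V W (f : {linear W -> U}) (g : {linear W -> V}) :
  {linear W -> (U * V)%type} := mklin (mkpair_linear f g).

Lemma pairE U V (x : U * V) : x = pairl U V x.1 + pairr U V x.2.
Proof. by case: x => u v; congr pair; rewrite /= ?addr0 ?add0r. Qed.

Lemma projective_pair P Q :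
  projective P -> projective Q -> projective (P * Q)%type.
Proof.
move=> projP projQ U V p f psurj.
have [g gE] := projP U V p (f \o @pairl P Q : {linear P -> V}) psurj.
have [h hE] := projQ U V p (f \o @pairr P Q : {linear Q -> V}) psurj.
exists (copair g h) => x; rewrite /= linearD gE hE /=.
by rewrite [in RHS](pairE x) linearD.
Qed.

Lemma projective0 P : (forall x : P, x = 0) -> projective P.
Proof.
move=> P0 U V p f _; exists (\0 : {linear P -> U}) => x.
by rewrite (P0 x) !linear0.
Qed.

Lemma fin_gen_surj U V (f : {linear U -> V}) :
  (forall y, exists x, y = f x) -> fin_gen U -> fin_gen V.
Proof.
move=> fsurj [s sU]; exists (map f s) => y; split=> // _ N sN sNy.
have [x ->] := fsurj y.
apply: ((sU x).1 I (fun x => N (f x))) => [|z zs].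
  by split=> [|a u v Nu Nv]; rewrite ?linear0 ?linearP; [case: sN | apply: sN.2].
by apply: sNy; apply: map_f.
Qed.

Lemma fin_gen_regular : fin_gen R^o.
Proof.
exists [:: 1] => x; split=> // _ N sN N1.
have -> : x = (x : R) *: (1 : R^o) by rewrite /GRing.scale /= mulr1.
by apply: submoduleZ sN _; apply: N1; rewrite inE.
Qed.

Lemma fin_gen0 V : (forall x : V, x = 0) -> fin_gen V.
Proof. by move=> V0; exists [::] => x; split=> // _; rewrite (V0 x); apply: span0. Qed.

(** The class [Z] carries a property of R over to the free cover. It is instantiated by a bound on
    the projective dimension of the Schur image. *)
Lemma free_cover (Z : lmodType R -> Prop) V :
  Z R^o -> (forall U V, Z U -> Z V -> Z (U * V)%type) -> fin_gen V ->
  exists (F : lmodType R) (p : {linear F -> V}),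
    [/\ fin_gen F, projective F, Z F & forall y, exists x, y = p x].
Proof.
move=> Z1 ZM [s sV].
suff [F [p [fF projF ZF pP]]] : exists (F : lmodType R) (p : {linear F -> V}),
    [/\ fin_gen F, projective F, Z F &
        forall y, span (fun z => z \in s) y -> exists x, y = p x].
  by exists F, p; split=> // y; apply: pP; apply/sV.
elim: s {sV} => [|v s [F [p [fF projF ZF pP]]]].
  (* [Z] need not contain the zero module, so the empty family of generators is covered by R mapped
     to zero. *)
  exists R^o, (\0 : {linear R^o -> V}); split=> //.
  - exact: fin_gen_regular.
  - exact: projective_regular.
  move=> y /(_ (fun y => y = 0)) ->; first by exists 0.
    by split=> // a _ _ -> ->; rewrite scaler0 addr0.
  by [].
have hlin : linear (fun r : R^o => (r : R) *: v).
  by move=> a x y; rewrite scalerDl -scalerA.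
exists (R^o * F)%type, (copair (mklin hlin) p); split.
- exact: fin_gen_pair fin_gen_regular fF.
- exact: projective_pair projective_regular projF.
- exact: ZM.
move=> y Hy; apply: (Hy (fun z => exists x, z = copair (mklin hlin) p x)).
  split=> [|a _ _ [u ->] [w ->]]; first by exists 0; rewrite linear0.
  by exists (a *: u + w); rewrite linearP.
move=> z; rewrite inE => /orP[/eqP->|zs].
  by exists (1, 0); rewrite /= scale1r linear0 addr0.
have [x ->] := pP z (span_gen zs).
by exists (0, x); rewrite /= scale0r add0r.
Qed.

Lemma proj_cover V : fin_gen V ->
  exists (F : fgmod R) (p : {linear F -> V}),
    projective F /\ forall y, exists x, y = p x.
Proof.
move=> fV; have [F [p [fF projF _ pP]]] :=
  @free_cover (fun _ => True) V I (fun _ _ _ _ => I) fV.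
by exists (FgMod fF), p.
Qed.

Lemma kernel_submodule U V (f : {linear U -> V}) : submodule (fun x => f x = 0).
Proof.
by split=> [|a x y fx fy]; rewrite ?linear0 // linearP fx fy scaler0 addr0.
Qed.

Lemma image_submodule U V (f : {linear U -> V}) :
  submodule (fun x => exists u, x = f u).
Proof.
split=> [|a _ _ [u ->] [v ->]]; first by exists 0; rewrite linear0.
by exists (a *: u + v); rewrite linearP.
Qed.

Lemma fin_gen_submodule V (N : V -> Prop) K (k : {linear K -> V}) :
  left_noetherian R -> fin_gen V -> submodule N -> injective k ->
  (forall x, N x <-> exists y, x = k y) -> fin_gen K.
Proof.
move=> hR [s sV] sN kinj kP.
have [|t tN] := @noetherian_sub R V s N hR sN; first by move=> x _; apply/sV.
have [t' Et] : exists t', t = map k t'.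
  have : forall y, y \in t -> exists z, y = k z.
    by move=> y yt; apply: (kP y).1; apply: (tN y).2; apply: span_gen.
  elim: t {tN} => [|x t IH] H; first by exists [::].
  have [|t' ->] := IH; first by move=> y yt; apply: H; rewrite inE yt orbT.
  by have [y ->] := H x (mem_head _ _); exists (y :: t').
exists t' => y; split=> // _ L sL Lt.
have [N0 Nlin] := sN.
have := (tN (k y)).1 ((kP (k y)).2 (ex_intro _ y erefl)).
move=> /(_ (fun x => exists2 z, x = k z & L z)) [].
- split; first by exists 0; [rewrite linear0 | case: sL].
  by move=> a _ _ [u -> Lu] [v -> Lv]; exists (a *: u + v); [rewrite linearP | apply: sL.2].
- by move=> x; rewrite Et => /mapP[z zt ->]; exists z => //; apply: Lt.
by move=> z /kinj ->.
Qed.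

Lemma kernel_object (hR : left_noetherian R) (M : fgmod R) V (f : {linear M -> V}) :
  exists (K : fgmod R) (k : {linear K -> M}),
    injective k /\ forall x, f x = 0 <-> exists y, x = k y.
Proof.
have sK := kernel_submodule f.
have [K [k [kinj kP]]] := submodule_object sK.
by exists (FgMod (fin_gen_submodule hR (fg_fin M) sK kinj kP)), k.
Qed.

End LinLift.

(** * Projective dimension *)

Section ProjectiveDimension.
Variable R : pzRingType.

Definition short_exact (K P M : lmodType R)
    (k : {linear K -> P}) (p : {linear P -> M}) :=
  [/\ injective k, forall m, exists x, m = p x
    & forall x, p x = 0 <-> exists y, x = k y].

(** Projective dimension through iterated syzygies, a form suited to induction, unlike the indexed
    resolutions of [finite_pd]. *)
Fixpoint pd_le (n : nat) (M : lmodType R) : Prop :=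
  match n with
  | 0 => projective M
  | n.+1 => exists (K P : lmodType R) (k : {linear K -> P})
      (p : {linear P -> M}), [/\ short_exact k p, projective P & pd_le n K]
  end.

(** Only resolutions with finitely generated terms are complexes in the sense of [cpx]. *)
Fixpoint fg_pd_le (n : nat) (M : fgmod R) : Prop :=
  match n with
  | 0 => projective M
  | n.+1 => exists (K P : fgmod R) (k : {linear K -> P})
      (p : {linear P -> M}), [/\ short_exact k p, projective P & fg_pd_le n K]
  end.

Lemma short_exact_pair (K P M K' P' M' : lmodType R)
    (k : {linear K -> P}) (p : {linear P -> M})
    (k' : {linear K' -> P'}) (p' : {linear P' -> M'}) :
  short_exact k p -> short_exact k' p' ->
  exists (k2 : {linear (K * K')%type -> (P * P')%type})
    (p2 : {linear (P * P')%type -> (M * M')%type}), short_exact k2 p2.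
Proof.
move=> [kinj psurj pk] [k'inj p'surj pk'].
exists (mkpair (k \o @fstl _ K K') (k' \o @sndl _ K K')).
exists (mkpair (p \o @fstl _ P P') (p' \o @sndl _ P P')).
split.
- move=> [x x'] [y y']; rewrite /= => -[/kinj-> /k'inj->] //.
- move=> [m m']; have [x ->] := psurj m; have [x' ->] := p'surj m'.
  by exists (x, x').
- move=> [x x']; split.
    rewrite /= => -[/pk[y ->] /pk'[y' ->]].
    by exists (y, y').
  move=> [[y y']]; rewrite /= => -[-> ->].
  by congr pair; [apply/pk; exists y | apply/pk'; exists y'].
Qed.

Lemma pd_le_pair n (A B : lmodType R) :
  pd_le n A -> pd_le n B -> pd_le n (A * B)%type.
Proof.
elim: n A B => [|n IH] A B /=; first exact: projective_pair.
move=> [K [P [k [p [ex projP pdK]]]]] [K' [P' [k' [p' [ex' projP' pdK']]]]].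
have [k2 [p2 ex2]] := short_exact_pair ex ex'.
exists (K * K')%type, (P * P')%type, k2, p2; split=> //.
  exact: projective_pair.
exact: IH.
Qed.

Lemma pd_le_proj n (P : lmodType R) : projective P -> pd_le n P.
Proof.
elim: n P => [|n IH] P projP //=.
have sP : submodule (fun x : P => x = 0) by split=> // a _ _ -> ->; rewrite scaler0 addr0.
have [K [k [kinj kP]]] := submodule_object sP.
exists K, P, k, (idfun : {linear P -> P}); split=> //.
  by split=> // m; exists m.
apply: IH; apply: projective0 => x; apply: kinj; rewrite linear0.
by apply/kP; exists x.
Qed.

(** A form of Schanuel's argument: for a cover [Q] of [L], the syzygy of [L] is a retract of the
    syzygy of [B] plus [Q]. Covering [L] afresh makes the new resolution finitely generated even
    though that of [B] is not. *)
Lemma pd_le_retract (hR : left_noetherian R) n (L : fgmod R) (B : lmodType R)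
    (i : {linear L -> B}) (r : {linear B -> L}) :
  cancel i r -> pd_le n B -> fg_pd_le n L.
Proof.
elim: n L B i r => [|n IH] L B i r ri /=; first exact: proj_retract ri.
move=> [B' [P [k [p [[kinj psurj pk] projP pdB']]]]].
have [Q [q [projQ qsurj]]] := proj_cover (fg_fin L).
have [L' [l [linj lq]]] := kernel_object hR q.
have [|i' i'E] := @proj_lift _ Q P B p (i \o q : {linear Q -> B}) projQ.
  by move=> x; have [u E] := psurj (i (q x)); exists u.
have [|r' r'E] := @proj_lift _ P Q L q (r \o p : {linear P -> L}) projP.
  by move=> x; have [u E] := qsurj (r (p x)); exists u.
have [|i1 i1E] := @lin_lift _ L' P B' k (i' \o l : {linear L' -> P}) kinj.
  move=> x; apply/pk; rewrite /= i'E /= (lq (l x)).2 ?linear0 //.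
  by exists x.
(* The retraction is r' k on [B'] and 1 - r' i' on [Q]. Both land in ker q, because p k = 0 and q r'
   i' = r p i' = r i q = q. *)
have [|g gE] := @lin_lift _ (B' * Q)%type Q L' l
    ((r' \o k \o @fstl _ B' Q) \+ (@sndl _ B' Q \- (r' \o i' \o @sndl _ B' Q))
      : {linear (B' * Q)%type -> Q}) linj.
  move=> [b x]; apply/lq; rewrite /= linearD linearB !r'E /= i'E /= ri subrr.
  by rewrite (pk (k b)).2 ?linear0 ?addr0 //; exists b.
exists L', Q, l, q; split=> //.
apply: (IH L' (B' * Q)%type (mkpair i1 l) g).
  move=> x; apply: linj; rewrite gE /= i1E /=.
  by zmod.
by apply: pd_le_pair => //; apply: pd_le_proj.
Qed.

Lemma finite_pd_le (M : lmodType R) : finite_pd M -> exists n, pd_le n M.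
Proof.
move=> [P [d [eps [n [projP Pn epsM epsK dK]]]]].
(* Induction on the number [k] of remaining terms; for k = 0 the module is a quotient of [P n.+1],
   which vanishes. *)
suff H k i : (k + i = n.+1)%N -> forall (N : lmodType R) (f : {linear P i -> N}),
    (forall y, exists x, f x = y) -> (forall x, f x = 0 <-> exists y, x = d i y) ->
    pd_le k N.
  by exists n.+1; apply: (H n.+1 0%N (addn0 _) M eps epsM epsK).
elim: k i => [|k IH] i ki N f fsurj fK /=.
  apply: projective0 => y; have [x <-] := fsurj y.
  by rewrite (Pn i _ x) ?linear0 // -ki add0n.
have [K [l [linj lP]]] := submodule_object (kernel_submodule f).
have [|g gE] := @lin_lift _ (P i.+1) (P i) K l (d i) linj.
  by move=> x; apply/lP; apply/fK; exists x.
exists K, (P i), l, f; split=> //.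
  by split=> // m; have [x <-] := fsurj m; exists x.
apply: (IH i.+1 _ K g).
- by rewrite -ki addnS.
- move=> y; have [x Ex] := (fK (l y)).1 ((lP (l y)).2 (ex_intro _ y erefl)).
  by exists x; apply: linj; rewrite gE.
- move=> x; rewrite -dK -gE; split=> [->|]; first by rewrite linear0.
  by rewrite -{1}(linear0 l) => /linj.
Qed.

(** A module is a retract of itself, so [pd_le_retract] trades an arbitrary resolution for a
    finitely generated one. *)
Lemma finite_pd_fg (hR : left_noetherian R) (M : fgmod R) :
  finite_pd M -> exists n, fg_pd_le n M.
Proof.
move=> /finite_pd_le[n pdM]; exists n.
exact: (@pd_le_retract hR n M M idfun idfun).
Qed.

End ProjectiveDimension.

(** * Complexes *)

Lemma int_pred (n : int) : exists m : int, n = m + 1.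
Proof. by exists (n - 1); rewrite subrK. Qed.

Section Families.
Variable R : pzRingType.
Implicit Types A B : int -> lmodType R.

(** Transport between degrees such as n - 1 + 1 and n, which are equal but not convertible. *)
Definition castl A m n (e : m = n) : {linear A m -> A n} :=
  match e in _ = k return {linear A m -> A k} with erefl => idfun end.

Lemma castl_id A m (e : m = m) x : castl A e x = x.
Proof. by rewrite (eq_irrelevance e erefl). Qed.

Lemma castl_trans A m n k (e : m = n) (e' : n = k) (e'' : m = k) x :
  castl A e' (castl A e x) = castl A e'' x.
Proof. by subst n; subst k; rewrite !castl_id. Qed.

Lemma castl_comp A (f : int -> int) m n (e : m = n) (e' : f m = f n) x :
  castl (fun k => A (f k)) e x = castl A e' x.
Proof. by subst n; rewrite !castl_id. Qed.

Lemma castl_inj A m n (e : m = n) : injective (castl A e).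
Proof. by subst n. Qed.

(* Every integer is of the form n+1, so a family of maps may be given by its
   components in degrees n+1. *)
Definition reidx A B (phi : forall n : int, {linear A (n + 1) -> B (n + 1)})
    (n : int) : {linear A n -> B n} :=
  match subrK 1 n in _ = k return {linear A k -> B k} with
    erefl => phi (n - 1) end.

Lemma reidxE A B (phi : forall n : int, {linear A (n + 1) -> B (n + 1)}) n x :
  reidx phi (n + 1) x = phi n x.
Proof.
rewrite /reidx; move: (subrK 1 (n + 1)).
move: (n + 1 - 1) (addrK 1 n) => m Em; subst m => e.
by rewrite (eq_irrelevance e erefl).
Qed.

Lemma single_family A B (b : int) (phi : {linear A b -> B b}) :
  exists f : forall n, {linear A n -> B n},
    (forall x, f b x = phi x) /\ forall n, n <> b -> forall x, f n x = 0.
Proof.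
exists (fun n => match @eqP _ b n with
  | ReflectT e => match e in _ = k return {linear A k -> B k} with
                    erefl => phi end
  | ReflectF _ => (\0 : {linear A n -> B n})
  end); split=> [x|n nb x].
  by case: eqP => [e|//]; rewrite (eq_irrelevance e erefl).
by case: eqP => // e; case: nb.
Qed.

End Families.

Section ComplexTools.
Variable R : pzRingType.
Implicit Types X Y Z P A : cpx R.

Notation castX X e := (castl (fun n => X n : lmodType R) e).

Lemma cd_castl X m n (e : m = n) (e' : m + 1 = n + 1) x :
  cd X n (castX X e x) = castX X e' (cd X m x).
Proof. by subst n; rewrite !castl_id. Qed.

Lemma cfun_castl X Y (f : cmap X Y) m n (e : m = n) x :
  f n (castX X e x) = castX Y e (f m x).
Proof. by subst n; rewrite !castl_id. Qed.

Lemma homotopy_difference X Y (f : cmap X Y)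
    (h : forall n, {linear X (n + 1) -> Y n}) :
  exists f' : cmap X Y, homotopic f f' /\
    forall n x, f' (n + 1) x = f (n + 1) x - (cd Y n (h n x) + h (n + 1) (cd X (n + 1) x)).
Proof.
pose phi n : {linear X (n + 1) -> Y (n + 1)} :=
  f (n + 1) \- ((cd Y n \o h n) \+ (h (n + 1) \o cd X (n + 1))).
pose f' := reidx (A := fun n => X n : lmodType R) (B := fun n => Y n : lmodType R) phi.
have f'E n x : f' (n + 1) x = f (n + 1) x - (cd Y n (h n x) + h (n + 1) (cd X (n + 1) x)).
  by rewrite /f' reidxE.
have f'd n x : f' (n + 1) (cd X n x) = cd Y n (f' n x).
  have [m Em] := int_pred n; subst n; rewrite !f'E !linearB !linearD /= !cdd cfunE.
  by rewrite linear0; zmod.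
exists (@Cmap R X Y f' f'd); split=> //; exists h => n x; rewrite /= f'E.
by zmod.
Qed.

Definition cmap0 X Y : cmap X Y :=
  @Cmap R X Y (fun n => \0 : {linear X n -> Y n}) (fun n x => esym (linear0 (cd Y n))).

Lemma homotopic0_eq X Y (f : cmap X Y) :
  (forall n x, f n x = 0) -> homotopic f (cmap0 X Y).
Proof. by move=> f0; apply: eq_homotopic => n x; rewrite f0. Qed.

Lemma cmap_bound X Y (f : cmap X Y) : exists N : int,
  forall n, N < n -> forall x, f n x = 0.
Proof.
have [N XN] := cbound X; exists N%:Z => n Nn x.
by rewrite (XN n _ x) ?linear0 //; lia.
Qed.

(** The index is off by one: this is exactness in degree [n + 1], so that the incoming differential
    needs no cast. *)
Definition exact_at X n :=
  forall x : X (n + 1), cd X (n + 1) x = 0 -> exists y, x = cd X n y.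

Definition acyclic X := forall n, exact_at X n.

Lemma exact_at0 X n : (forall x : X (n + 1), x = 0) -> exact_at X n.
Proof. by move=> X0 x _; exists 0; rewrite linear0 (X0 x). Qed.

(** The long exact sequence of the cone done by hand: exactness of the cone in degree n + 1 combines
    injectivity in degree n + 2 with surjectivity in degree n + 1. *)
Lemma quasi_iso_acyclic X Y (f : cmap X Y) :
  quasi_iso (f : @hom (Kb R) X Y) <-> acyclic (cone f).
Proof.
split=> [qf n [x y] /= [/eqP]|acf n].
  rewrite oppr_eq0 => /eqP dx fxy.
  have [/(_ x dx) finj _] := qf (n + 1); have [_ fsurj] := qf n.
  have [|w Ew] := finj.
    by exists (- y); rewrite linearN; apply/eqP; rewrite -addr_eq0; apply/eqP.
  have [|x' [w' [dx' Ey]]] := fsurj (f (n + 1) w + y).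
    by rewrite linearD -cfunE -Ew.
  exists (x' - w, w'); rewrite /cone_fun /= !linearB /= dx' -Ew; congr pair.
    by zmod.
  by rewrite -[RHS]addrA [- _ + _]addrC addrA -Ey; zmod.
have [m Em] := int_pred n; subst n; split=> [x dx [y fx]|y dy].
  have [|[a b] [Ea Eb]] := acf m (x, - y).
    by rewrite /= /cone_fun /= dx fx linearN subrr oppr0.
  by exists (- a); rewrite linearN Ea.
have [|[a b] [Ea Eb]] := acf (m + 1) (0, y).
  by rewrite /= /cone_fun /= !linear0 dy add0r ?oppr0.
exists a, b; split=> //.
by apply/eqP; rewrite -oppr_eq0 -Ea.
Qed.

(** The map is killed one degree at a time from the top. Once it vanishes above a degree, its values
    there are cocycles of [A], hence coboundaries, and projectivity lifts it through the
    differential to a homotopy. *)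
Lemma homotopy_above P A (f : cmap P A) (c : int) :
  (forall n, projective (P n)) ->
  (forall n, c < n + 1 -> exact_at A n) ->
  exists f' : cmap P A, homotopic f f' /\
    forall n, c < n -> forall x, f' n x = 0.
Proof.
move=> projP exA; have [N fN] := cmap_bound f.
suff H (k : nat) : exists f' : cmap P A, homotopic f f' /\
    forall n, c < n -> N - k%:Z < n -> forall x, f' n x = 0.
  have [f' [ff' f'0]] := H `|N - c|%N; exists f'; split=> // n cn x.
  by apply: f'0 => //; lia.
elim: k => [|k [f' [ff' f'0]]].
  by exists f; split; [exact: homotopic_refl | move=> n _ n0; apply: fN; lia].
have [b0|cb] := boolP (N - k%:Z <= c).
  exists f'; split=> // n cn nk x; apply: f'0 => //; lia.
have [m Em] := int_pred (N - k%:Z).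
have [|h0 h0E] := @proj_lift R (P (m + 1)) (A m) (A (m + 1)) (cd A m) (f' (m + 1)) (projP _).
  move=> x; apply: exA; first by rewrite -Em ltNge.
  by rewrite -cfunE f'0 //; lia.
have [h [hm hn]] := single_family (A := fun n => P (n + 1) : lmodType R)
  (B := fun n => A n : lmodType R) h0.
have [f'' [f'f'' f''E]] := homotopy_difference f' h.
exists f''; split; first exact: homotopic_trans ff' f'f''.
move=> n cn nk x; have [l El] := int_pred n; subst n.
rewrite f''E (hn (l + 1)) ?addr0; last by lia.
have [El|lm] := eqVneq l m; first by subst l; rewrite hm h0E subrr.
by rewrite hn; [rewrite linear0 subr0 f'0 //; lia | apply/eqP].
Qed.

Lemma homotopic_null P A (f : cmap P A) (c : int) :
  (forall n, projective (P n)) -> (forall n, c < n + 1 -> exact_at A n) ->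
  (forall n, n <= c -> forall x : P n, x = 0) -> homotopic f (cmap0 P A).
Proof.
move=> projP exA P0; have [f' [ff' f'0]] := homotopy_above f projP exA.
apply: homotopic_trans ff' (homotopic0_eq _) => n x.
have [nc|cn] := boolP (n <= c); first by rewrite (P0 n nc x) linear0.
by apply: f'0; rewrite ltNge.
Qed.

(** A null-homotopy of P -> Y -> cone s has two components: the one in [X] is a chain map lifting
    [f], and the one in [Y] is the homotopy comparing the two. *)
Lemma lift_above P X Y (s : cmap X Y) (f : cmap P Y) (c : int) :
  (forall n, projective (P n)) ->
  (forall n, c < n + 1 -> exact_at (cone s) n) ->
  (forall n, n <= c -> forall x : P n, x = 0) ->
  exists g : cmap P X, homotopic (cmap_comp s g) f.
Proof.
move=> projP exs P0.
have [H HE] := homotopic_null (cmap_comp (cone_incl s) f) projP exs P0.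
pose phi n : {linear P (n + 1) -> X (n + 1)} := (@fstl R _ _) \o H n.
pose t n : {linear P (n + 1) -> Y n} := (@sndl R _ _) \o H n.
pose g := reidx (A := fun n => P n : lmodType R) (B := fun n => X n : lmodType R) phi.
have gE n x : g (n + 1) x = (H n x).1 by rewrite /g reidxE.
have HE1 n x : (H (n + 1) (cd P (n + 1) x)).1 = cd X (n + 1) (H n x).1.
  have := congr1 fst (HE n x); rewrite /= subr0 => /esym/eqP.
  by rewrite addr_eq0 eqr_opp => /eqP/esym.
have HE2 n x : f (n + 1) x = s (n + 1) (H n x).1 + cd Y n (H n x).2
    + (H (n + 1) (cd P (n + 1) x)).2.
  by have := congr1 snd (HE n x); rewrite /= subr0.
have gd n x : g (n + 1) (cd P n x) = cd X n (g n x).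
  by have [m Em] := int_pred n; subst n; rewrite !gE HE1.
exists (@Cmap R P X g gd); apply: homotopic_sym; exists t => n x.
rewrite /= gE HE2; zmod.
Qed.

Lemma cpx_bounds X : exists N : int, 0 <= N /\
  forall n, (n < - N) || (N < n) -> forall x : X n, x = 0.
Proof.
have [N XN] := cbound X; exists N%:Z; split=> // n nN x.
by apply: XN; lia.
Qed.

Lemma lift_quasi_iso P X Y (s : cmap X Y) (f : cmap P Y) :
  (forall n, projective (P n)) -> quasi_iso (s : @hom (Kb R) X Y) ->
  exists g : cmap P X, homotopic (cmap_comp s g) f.
Proof.
move=> projP /quasi_iso_acyclic acs; have [N [N0 PN]] := cpx_bounds P.
apply: (lift_above f (c := - N - 1) projP) => [n _|n nN x]; first exact: acs.
by apply: PN; apply/orP; left; lia.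
Qed.

End ComplexTools.

Notation castX X e := (castl (fun n => X n : lmodType _) e).

(** * Quasi-isomorphisms *)

Section QuasiIso.
Variable R : pzRingType.
Implicit Types X Y Z P A : cpx R.

Notation qis f := (quasi_iso (f : @hom (Kb R) _ _)).
Notation ldb f := (fmap (loc (@quasi_iso R)) (f : @hom (Kb R) _ _)).

(** * Cohomology as a functor on the homotopy category *)

Section Cohomology.
Variable n : int.

Definition cocycle X := {x : X (n + 1) | cd X (n + 1) x = 0}.
Definition cohomologous X (x y : cocycle X) :=
  exists w, sval x - sval y = cd X n w.

Lemma cohomologous_equivalence X : Equivalence (@cohomologous X).
Proof.
split.
- by move=> x; exists 0; rewrite linear0 subrr.
- by move=> x y [w E]; exists (- w); rewrite linearN -E; zmod.
- move=> x y z [w E] [w' E']; exists (w + w'); rewrite linearD -E -E'; zmod.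
Qed.

Definition coh_fun X Y (f : cmap X Y) (x : cocycle X) : cocycle Y.
Proof.
exists (f (n + 1) (sval x)).
abstract by rewrite -cfunE (svalP x) linear0.
Defined.

Lemma coh_fun_eq X Y (f : cmap X Y) (x y : cocycle X) :
  cohomologous x y -> cohomologous (coh_fun f x) (coh_fun f y).
Proof. by move=> [w E]; exists (f n w); rewrite /= -linearB E cfunE. Qed.

Definition cohomology : functor (Kb R) (setoid_cat cohomologous_equivalence).
Proof.
apply: (@Functor (Kb R) (setoid_cat cohomologous_equivalence) (fun X => X)
  (fun X Y f => Smap (@coh_fun_eq X Y f))).
- move=> X Y f g [h hE] [x dx] /=; exists (h n x).
  by rewrite /= hE dx linear0 addr0.
- by move=> X x /=; exists 0; rewrite /= linear0 subrr.
- by move=> X Y Z g f x /=; exists 0; rewrite /= linear0 subrr.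
Defined.

Lemma cohomology_iso X Y (f : cmap X Y) :
  is_iso (fmap cohomology f) <->
  (forall x : X (n + 1), cd X (n + 1) x = 0 ->
     (exists y, f (n + 1) x = cd Y n y) -> exists w, x = cd X n w) /\
  (forall y : Y (n + 1), cd Y (n + 1) y = 0 ->
     exists x w, cd X (n + 1) x = 0 /\ y = f (n + 1) x + cd Y n w).
Proof.
split=> [isof|[finj fsurj]].
  split=> [x dx [y fx]|y dy].
    have x0 : cd X (n + 1) 0 = 0 by rewrite linear0.
    have [|w E] := setoid_iso_inj (x := exist _ x dx) (y := exist _ 0 x0) isof.
      by exists y; rewrite /= linear0 subr0.
    by exists w; rewrite -E subr0.
  have [[x dx] [w /= E]] := setoid_iso_surj (exist _ y dy) isof.
  by exists x, (- w); split=> //; rewrite linearN -E; zmod.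
apply: setoid_iso => [[x dx] [y dy] [w /= E]|[y dy]].
  have [||v Ev] := finj (x - y); last by exists v.
    by rewrite linearB dx dy subrr.
  by exists w; rewrite linearB.
have [x [w [dx Ey]]] := fsurj y dy.
by exists (exist _ x dx), (- w); rewrite /= Ey linearN; zmod.
Qed.

End Cohomology.

Lemma quasi_iso_coh X Y (f : cmap X Y) :
  qis f <-> forall n, is_iso (fmap (cohomology n) f).
Proof.
by split=> H n; [apply/cohomology_iso; apply: H | apply/cohomology_iso; apply: H].
Qed.

(** Inverting a class can make further maps invertible. Here it does not, because cohomology factors
    through the localization and detects quasi-isomorphisms. *)
Lemma quasi_iso_Db X Y (f : cmap X Y) : qis f <-> is_iso (ldb f).
Proof.
split=> [qf|isof].
  exists (Linv qf : @hom (localization (@quasi_iso R)) Y X).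
  by split; [apply: lheq_invl | apply: lheq_invr].
apply/quasi_iso_coh => n.
have cohP (X' Y' : Kb R) (g : hom X' Y') : quasi_iso g ->
    is_iso (fmap (cohomology n) g) by move/quasi_iso_coh.
exact: (fmap_iso (loc_lift cohP) isof).
Qed.

Lemma quasi_iso_homotopic X Y (f g : cmap X Y) : homotopic f g -> qis f -> qis g.
Proof.
move=> fg /quasi_iso_Db qf; apply/quasi_iso_Db; apply: heq_iso qf.
exact: (@fmap_heq _ _ (loc (@quasi_iso R)) X Y f g fg).
Qed.

Lemma quasi_iso_comp X Y Z (g : cmap Y Z) (f : cmap X Y) :
  qis g -> qis f -> qis (cmap_comp g f).
Proof.
move=> /quasi_iso_Db qg /quasi_iso_Db qf; apply/quasi_iso_Db.
apply: heq_iso (comp_iso qg qf); apply: heq_sym.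
exact: (@fmap_comp _ _ (loc (@quasi_iso R)) X Y Z g f).
Qed.

Lemma quasi_iso_cancel X Y Z (g : cmap Y Z) (f : cmap X Y) :
  qis g -> qis (cmap_comp g f) -> qis f.
Proof.
move=> /quasi_iso_Db qg /quasi_iso_Db qgf; apply/quasi_iso_Db.
apply: iso_comp_r qg _; apply: heq_iso qgf.
exact: (@fmap_comp _ _ (loc (@quasi_iso R)) X Y Z g f).
Qed.

Lemma quasi_iso_bij X Y (f : cmap X Y) :
  (forall n, injective (f n)) -> (forall n y, exists x, y = f n x) -> qis f.
Proof.
move=> finj fsurj n; split=> [x _ [y fx]|y dy].
  by have [w Ew] := fsurj _ y; exists w; apply: (finj (n + 1)); rewrite fx Ew cfunE.
have [x Ex] := fsurj _ y; exists x, 0; rewrite linear0 addr0; split=> //.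
by apply: (finj (n + 1 + 1)); rewrite cfunE -Ex dy linear0.
Qed.

(* Maps out of a bounded complex of projectives are the same in the homotopy
   category and in the derived category. *)
Lemma Db_map_from_proj P X Y (m : lhom (@quasi_iso R) X Y) (g : cmap P X) :
  (forall n, projective (P n)) ->
  exists g' : cmap P Y, ldb g' =~ (m : @hom (Db_cat R) X Y) <o> ldb g.
Proof.
move=> projP; elim: m g => {X Y} [X Y f|X Y s qs|X Y Z m' IH' m IH] g.
- exists (cmap_comp f g).
  exact: (@fmap_comp _ _ (loc (@quasi_iso R)) P X Y f g).
- have [g' g'E] := lift_quasi_iso g projP qs; exists g'.
  have E : ldb s <o> ldb g' =~ ldb g.
    apply: heq_trans (heq_sym (@fmap_comp _ _ (loc (@quasi_iso R)) _ _ _ s g')) _.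
    exact: (@fmap_heq _ _ (loc (@quasi_iso R)) _ _ _ _ g'E).
  rewrite -E (comp_assoc (Linv qs : @hom (Db_cat R) _ _)).
  have [-> _] := Linv_inverse qs.
  by rewrite comp_idl; reflexivity.
- have [g1 g1E] := IH g; have [g2 g2E] := IH' g1; exists g2.
  rewrite g2E g1E; exact: (@comp_assoc (Db_cat R)).
Qed.

Definition perf X := exists P : cpx R,
  (forall n, projective (P n)) /\ exists p : cmap P X, qis p.

(** An isomorphism in the derived category out of a bounded complex of projectives is represented by
    a chain map, which is then a quasi-isomorphism. *)
Lemma perfectP X : perfect (X : Db R) <-> perf X.
Proof.
split=> [[P [projP [f [g [gf fg]]]]]|[P [projP [p qp]]]]; exists P; split=> //.
  have [g' g'E] := Db_map_from_proj g (cmap_id P) projP.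
  exists g'; apply/quasi_iso_Db; apply: (@heq_iso (Db_cat R) _ _ g).
    rewrite g'E -[X in X =~ _](@comp_idr (Db_cat R)).
    by reflexivity.
  by exists f.
have [g [gp pg]] := (quasi_iso_Db p).1 qp.
by exists g, (ldb p).
Qed.

Lemma perf_qis X Y (f : cmap X Y) : qis f -> perf X -> perf Y.
Proof.
move=> qf [P [projP [p qp]]]; exists P; split=> //.
by exists (cmap_comp f p); apply: quasi_iso_comp.
Qed.

Lemma perf_qis_r X Y (f : cmap X Y) : qis f -> perf Y -> perf X.
Proof.
move=> qf [P [projP [p qp]]]; exists P; split=> //.
have [g gE] := lift_quasi_iso p projP qf; exists g.
by apply: quasi_iso_cancel qf (quasi_iso_homotopic (homotopic_sym gE) qp).
Qed.

Section ConeMap.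
Variables (P Q X Y : cpx R) (v : cmap P Q) (u : cmap X Y).
Variables (p : cmap P X) (q : cmap Q Y).

(* The homotopy enters the map of cones, so the square need only commute in
   the homotopy category. *)
Lemma cone_map_quasi_iso :
  homotopic (cmap_comp q v) (cmap_comp u p) -> qis p -> qis q ->
  exists F : cmap (cone v) (cone u), qis F.
Proof.
move=> [h hE] qp qq.
pose Ff n (z : P (n + 1) * Q n) : X (n + 1) * Y n := (p (n + 1) z.1, q n z.2 + h n z.1).
have Flin n : linear (Ff n).
  by move=> a x y; congr pair; rewrite /= !linearP //= scalerDr; zmod.
have FE n z : mklin (Flin (n + 1)) (cd (cone v) n z) = cd (cone u) n (mklin (Flin n) z).
  case: z => x y; rewrite /= /cone_fun /Ff /=; congr pair.
    by rewrite linearN cfunE.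
  rewrite linearD linearN cfunE linearD.
  have := hE n x; rewrite /= => /eqP; rewrite subr_eq => /eqP ->.
  by zmod.
exists (@Cmap R (cone v) (cone u) (fun n => mklin (Flin n)) FE).
move=> n; split.
  move=> [x y] /= [/eqP]; rewrite oppr_eq0 => /eqP dx vxy [[a b]] [px qy].
  have [|w Ew] := (qp (n + 1)).1 x dx; first by exists (- a); rewrite linearN.
  (* Up to a coboundary, (x, y) is (0, y'). Then a' is a cocycle, cohomologous to some p x0, and y'
     - v x0 is a coboundary since its image under q is one. *)
  subst x; pose a' := a + p (n + 1) w; pose b' := b + h n w.
  pose y' := y + v (n + 1) w.
  have dy' : cd Q (n + 1) y' = 0 by rewrite linearD -cfunE -[RHS]vxy; zmod.
  have da' : cd X (n + 1) a' = 0 by rewrite linearD -cfunE px; zmod.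
  have hEw := hE n w; rewrite /= in hEw.
  have qy' : q (n + 1) y' = u (n + 1) a' + cd Y n b'.
    rewrite !linearD -(subrK (u (n + 1) (p (n + 1) w)) (q (n + 1) (v (n + 1) w))) hEw.
    by rewrite -[q (n + 1) y](addrK (h (n + 1) (cd P (n + 1) w))) qy; zmod.
  have [x0 [a0 [dx0 Ea']]] := (qp n).2 a' da'.
  have hEx0 := hE n x0; rewrite /= dx0 linear0 addr0 in hEx0.
  have [||z Ez] := (qq n).1 (y' - v (n + 1) x0).
  - by rewrite linearB dy' -cfunE dx0 linear0 subrr.
  - exists (u n a0 + b' - h n x0); rewrite linearB qy' Ea' linearD cfunE !linearD linearN -hEx0.
    by zmod.
  exists (x0 - w, z); rewrite /cone_fun /= linearB dx0; congr pair; first by zmod.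
  by rewrite -Ez linearB /y'; zmod.
move=> [a b] /= [/eqP]; rewrite oppr_eq0 => /eqP da uab.
(* The first component lifts to a cocycle x. The obstruction v x to completing it becomes a
   coboundary under q, hence equals some d w, and the remaining error is a cocycle that y1
   absorbs. *)
have [x [a0 [dx Ea]]] := (qp (n + 1)).2 a da.
pose b' := b + u (n + 1) a0.
have hEx := hE (n + 1) x; rewrite /= dx linear0 addr0 in hEx.
have upb : u (n + 1 + 1) (p (n + 1 + 1) x) + cd Y (n + 1) b' = 0.
  by move: uab; rewrite Ea !linearD cfunE => uab; zlin1 uab.
have qv : q (n + 1 + 1) (v (n + 1 + 1) x) = cd Y (n + 1) (h (n + 1) x - b').
  by rewrite linearB; zlin2 hEx upb.
have [||w Ew] := (qq (n + 1)).1 (v (n + 1 + 1) x).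
- by rewrite -cfunE dx linear0.
- by exists (h (n + 1) x - b').
have [|y1 [b1 [dy1 Eb]]] := (qq n).2 (b' + q (n + 1) w - h (n + 1) x).
  by rewrite linearB linearD -cfunE -Ew qv linearB; zmod.
exists (x, y1 - w), (- a0, b1); split.
  by rewrite /cone_fun /= dx oppr0 linearB dy1 -Ew; congr pair; zmod.
rewrite /Ff /cone_fun /= !linearN linearB opprK; congr pair.
  by [].
by rewrite /b' /= in Eb *; zlin1 Eb.
Qed.

End ConeMap.

Lemma perf_cone X Y (u : cmap X Y) : perf X -> perf Y -> perf (cone u).
Proof.
move=> [P [projP [p qp]]] [Q [projQ [q qq]]].
have [v vE] := lift_quasi_iso (cmap_comp u p) projP qq.
have [F qF] := cone_map_quasi_iso vE qp qq.
exists (cone v); split; last by exists F.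
by move=> n; apply: projective_pair; [apply: projP | apply: projQ].
Qed.

Lemma perf_shift X : perf X -> perf (shift_cpx X).
Proof.
move=> [P [projP [p qp]]]; exists (shift_cpx P); split; first by move=> n; apply: projP.
by exists (shift_cmap p); apply: shift_quasi_iso.
Qed.

Section Unshift.
Variable X : cpx R.

Let eqn (n : int) : n - 1 + 1 = n + 1 - 1. Proof. by lia. Qed.

Lemma unshift_cdd n x :
  (castX X (eqn (n + 1)) \o (\- cd X (n + 1 - 1))) ((castX X (eqn n) \o (\- cd X (n - 1))) x) = 0.
Proof.
have e : n - 1 + 1 + 1 = n + 1 - 1 + 1 by lia.
by rewrite /= linearN (cd_castl (eqn n) e) linearN cdd !(oppr0, linear0).
Qed.

Lemma unshift_bound : exists N : nat,
  forall n : int, (N < `|n|)%N -> forall x : X (n - 1), x = 0.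
Proof. by have [N XN] := cbound X; exists N.+1 => n nN; apply: XN; lia. Qed.

(** The inverse of the shift, with casts in the differential since n - 1 + 1 and n + 1 - 1 are
    different terms. It serves to remove a shift from a resolution. *)
Definition unshift : cpx R :=
  @Cpx R (fun n => X (n - 1))
    (fun n => castX X (eqn n) \o (\- cd X (n - 1)))
    unshift_cdd unshift_bound.

End Unshift.

Lemma quasi_iso_unshift X Y (f : cmap X Y) : qis (shift_cmap f) -> qis f.
Proof.
move=> qf n; have [m Em] := int_pred n; subst n; have [finj fsurj] := qf m.
split=> [x dx [y fx]|y dy].
  have [||w Ew] := finj x; first by rewrite /= dx oppr0.
    by exists (- y); rewrite /= linearN opprK.
  by exists (- w); rewrite linearN.
have [|x [w [dx Ey]]] := fsurj y; first by rewrite /= dy oppr0.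
exists x, (- w); split; first by apply/eqP; rewrite -oppr_eq0; apply/eqP.
by rewrite Ey /= linearN.
Qed.

Lemma perf_unshift X : perf (shift_cpx X) -> perf X.
Proof.
move=> [P [projP [p qp]]]; exists (unshift P); split; first by move=> n; apply: projP.
have e1 (n : int) : n + 1 - 1 = n by rewrite addrK.
pose v0 n : {linear unshift P n -> X n} := castX X (subrK 1 n) \o p (n - 1).
have vE n x : v0 (n + 1) (cd (unshift P) n x) = cd X n (v0 n x).
  rewrite /v0 /= cfun_castl !linearN cfunE /= !linearN opprK.
  have e : n - 1 + 1 + 1 = n + 1 by lia.
  rewrite (cd_castl (X := X) (subrK 1 n) e).
  have e'' : n - 1 + 1 + 1 = n + 1 - 1 + 1 by lia.
  rewrite (castl_comp (A := fun k => X k) (f := fun k => k + 1) _ e'').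
  exact: (castl_trans (A := fun k => X k)).
pose v : cmap (unshift P) X := @Cmap R (unshift P) X v0 vE.
(* Shifting [unshift P] back gives [P] only up to casts; [w] is that isomorphism, and the shift of
   [v] is [p] after [w]. *)
pose w0 n : {linear shift_cpx (unshift P) n -> P n} := castX P (e1 n).
have wE n x : w0 (n + 1) (cd (shift_cpx (unshift P)) n x) = cd P n (w0 n x).
  rewrite /w0 /= !linearN opprK.
  have e : n + 1 - 1 + 1 = n + 1 by lia.
  rewrite (cd_castl (X := P) (e1 n) e).
  exact: (castl_trans (A := fun k => P k)).
pose w : cmap (shift_cpx (unshift P)) P := @Cmap R _ P w0 wE.
exists v; apply: quasi_iso_unshift.
have qw : qis w.
  apply: quasi_iso_bij => n; first exact: castl_inj.
  move=> y; exists (castX P (esym (e1 n)) y); rewrite /= /w0.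
  by rewrite (castl_trans (A := fun k => P k) _ _ erefl).
apply: quasi_iso_homotopic (quasi_iso_comp qp qw).
apply: eq_homotopic => n x /=; rewrite /w0 cfun_castl.
exact: (castl_comp (A := fun k => X k) (f := fun k => k + 1)).
Qed.

(** * Short exact sequences of complexes *)

Definition ses X Y Z (f : cmap X Y) (g : cmap Y Z) :=
  forall n, short_exact (f n) (g n).

Lemma cone_incl_ses X Y (u : cmap X Y) : ses (cone_incl u) (cone_proj u).
Proof.
move=> n; split.
- by move=> y y' /= [].
- by move=> x; exists (x, 0).
- move=> [x y]; split=> [/= -> | [y' [-> _]] //].
  by exists y.
Qed.

(** The comparison map forgets the component in [X] and applies [g] to the other one; it commutes
    with the differentials because g f = 0. *)
Lemma ses_cone X Y Z (f : cmap X Y) (g : cmap Y Z) : ses f g ->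
  exists G : cmap (cone f) Z, qis G.
Proof.
move=> fg.
pose Gf n (z : X (n + 1) * Y n) : Z n := g n z.2.
have Glin n : linear (Gf n) by move=> a x y; rewrite /Gf /= linearP.
have gf n x : g n (f n x) = 0 by have [_ _ H] := fg n; apply/H; exists x.
have GE n z : mklin (Glin (n + 1)) (cd (cone f) n z) = cd Z n (mklin (Glin n) z).
  by case: z => x y; rewrite /= /Gf /cone_fun /= linearD gf add0r cfunE.
exists (@Cmap R (cone f) Z (fun n => mklin (Glin n)) GE) => n; split.
  move=> [x y] /= [/eqP]; rewrite oppr_eq0 => /eqP dx fxy [c]; rewrite /Gf /= => gy.
  have [finj gsurj gK] := fg n; have [finj1 gsurj1 gK1] := fg (n + 1).
  have [finj2 _ _] := fg (n + 1 + 1).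
  have [b Eb] := gsurj c; subst c.
  have [|a Ea] := (gK1 (y - cd Y n b)).1; first by rewrite linearB gy cfunE subrr.
  exists (a, b); rewrite /cone_fun /= -Ea; congr pair; last by zmod.
  apply: finj2; rewrite linearN cfunE -Ea linearB cdd subr0.
  by apply/eqP; rewrite -addr_eq0 fxy.
move=> c dc; have [finj2 _ gK2] := fg (n + 1 + 1); have [_ gsurj1 _] := fg (n + 1).
have [finj3 _ _] := fg (n + 1 + 1 + 1).
have [b Eb] := gsurj1 c; subst c.
have [|a Ea] := (gK2 (cd Y (n + 1) b)).1; first by rewrite cfunE.
exists (- a, b), 0; rewrite linear0 addr0; split=> //=.
rewrite /cone_fun /= !linearN Ea addNr; congr pair.
by rewrite opprK; apply: finj3; rewrite cfunE -Ea cdd linear0.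
Qed.

Lemma perf_ses_r X Y Z (f : cmap X Y) (g : cmap Y Z) :
  ses f g -> perf X -> perf Y -> perf Z.
Proof.
by move=> fg pX pY; have [G qG] := ses_cone fg; apply: perf_qis qG (perf_cone f pX pY).
Qed.

(** Rotation: Y[1] is the quotient of [cone (cone_incl f)], which is quasi-isomorphic to X[1], by
    [cone f], which is quasi-isomorphic to Z. *)
Lemma perf_ses_m X Y Z (f : cmap X Y) (g : cmap Y Z) :
  ses f g -> perf X -> perf Z -> perf Y.
Proof.
move=> fg pX pZ; have [G qG] := ses_cone fg.
have pC : perf (cone f) := perf_qis_r qG pZ.
have [H qH] := ses_cone (cone_incl_ses f).
have pI : perf (cone (cone_incl f)) := perf_qis_r qH (perf_shift pX).
exact/perf_unshift/(perf_ses_r (cone_incl_ses (cone_incl f))).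
Qed.

Lemma perf_ses_l X Y Z (f : cmap X Y) (g : cmap Y Z) :
  ses f g -> perf Y -> perf Z -> perf X.
Proof.
move=> fg pY pZ; have [G qG] := ses_cone fg.
apply: perf_unshift; apply: (perf_ses_r (cone_incl_ses f) pY).
exact: perf_qis_r qG pZ.
Qed.

Lemma perf_acyclic X : acyclic X -> perf X.
Proof.
move=> acX; pose Z0 : lmodType R := 'rV[R]_0.
have Z00 (x : Z0) : x = 0 by apply/rowP => -[].
pose Z := @Cpx R (fun n => FgMod (fin_gen0 Z00)) (fun n => \0 : {linear Z0 -> Z0})
  (fun n x => erefl) (ex_intro _ 0%N (fun n _ x => Z00 x)).
exists Z; split; first by move=> n; apply: projective0.
exists (cmap0 Z X) => n; split=> [x _ _|y dy].
  by exists 0; rewrite (Z00 x).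
by have [w Ew] := acX n y dy; exists 0, w; rewrite add0r.
Qed.

End QuasiIso.

Notation qis f := (quasi_iso (f : @hom (Kb _) _ _)).
Notation ldb f := (fmap (loc (@quasi_iso _)) (f : @hom (Kb _) _ _)).

(** * Morphisms of complexes with perfect cone *)

Section PerfectCone.
Variable R : pzRingType.
Implicit Types X Y Z : cpx R.

Definition perf_cone_map (X Y : Kb R) (u : hom X Y) := perf (cone u).
Notation V u := (@perf_cone_map _ _ u).

Lemma perf_cone_qis X Y (u : cmap X Y) : qis u -> V u.
Proof. by move=> /quasi_iso_acyclic; apply: perf_acyclic. Qed.

Lemma quasi_iso_id X : qis (cmap_id X).
Proof. by apply: quasi_iso_bij => n // y; exists y. Qed.

Lemma perf_cone_id (X : Kb R) : V (idm X).
Proof. exact/perf_cone_qis/quasi_iso_id. Qed.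

Lemma perf_cone_heq (X Y : Kb R) (f g : hom X Y) : f =~ g -> V f -> V g.
Proof.
move=> fg; have [F qF] := @cone_map_quasi_iso R X Y X Y f g (cmap_id X) (cmap_id Y)
  fg (quasi_iso_id X) (quasi_iso_id Y).
exact: perf_qis qF.
Qed.

Lemma perf_cone_comp (X Y Z : Kb R) (v : hom Y Z) (u : hom X Y) :
  V v -> V u -> V (v <o> u).
Proof.
move=> Vv Vu.
(* The octahedral axiom: the cone of the connecting map w : cone v -> cone u[1]
   is quasi-isomorphic to cone (vu)[1]. *)
pose wf n (p : Y (n + 1) * Z n) : X (n + 1 + 1) * Y (n + 1) := (0, p.1).
have wlin n : linear (wf n) by move=> a x y; congr pair; rewrite /= ?scaler0 ?addr0.
have wE n p : mklin (wlin (n + 1)) (cd (cone v) n p) = cd (shift_cpx (cone u)) n (mklin (wlin n) p).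
  by case: p => y z; congr pair; rewrite /= !linear0 // add0r.
pose w : cmap (cone v) (shift_cpx (cone u)) := @Cmap R (cone v) (shift_cpx (cone u)) (fun n => mklin (wlin n)) wE.
have pw : perf (cone w) by apply: perf_cone => //; apply: perf_shift.
pose gf n (p : (Y (n + 1 + 1) * Z (n + 1)) * (X (n + 1 + 1) * Y (n + 1))) :
  X (n + 1 + 1) * Z (n + 1) := (p.2.1, p.1.2 + v (n + 1) p.2.2).
have glin n : linear (gf n).
  by move=> a x y; congr pair; rewrite /= linearP scalerDr; zmod.
pose vu : cmap X Z := cmap_comp v u.
have gE n p : mklin (glin (n + 1)) (cd (cone w) n p) = cd (shift_cpx (cone vu)) n (mklin (glin n) p).
  case: p => -[y' z'] [x y]; rewrite /= /wf /gf /cone_fun /=; congr pair; first by zmod.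
  by rewrite /= linearB !linearD cfunE; zmod.
pose g : cmap (cone w) (shift_cpx (cone vu)) :=
  @Cmap R (cone w) (shift_cpx (cone vu)) (fun n => mklin (glin n)) gE.
suff qg : qis g by apply: perf_unshift; apply: perf_qis qg pw.
move=> n; split.
  move=> [[y' z'] [x y]] [E1 E2 E3 E4] [[a b] [E5 E6]].
  move: E1 E2 E3 E4 E5 E6; rewrite /= => E1 E2 E3 E4 E5 E6.
  exists ((y + u (n + 1 + 1) a, b), (a, 0)).
  rewrite /= /wf /cone_fun /=; congr pair; congr pair; rewrite /=.
  + by rewrite linearD -cfunE; move: E4; rewrite E5 opprK => E4; zlin1 E4.
  + rewrite !linearD; zlin1 E6.
  + by rewrite E5; zmod.
  + by rewrite linear0; zmod.
move=> [x z] [/= E1 E2].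
exists ((u (n + 1 + 1 + 1) x, z), (x, 0)), 0; split.
  rewrite /= /wf /cone_fun /=; congr pair; congr pair; rewrite /=.
  + by rewrite -cfunE; move: E1 => /eqP; rewrite !oppr_eq0 => /eqP->; rewrite linear0 oppr0 oppr0.
  + by rewrite -[RHS]E2.
  + by rewrite add0r E1.
  + by rewrite linear0; zmod.
by rewrite /= /gf /cone_fun /=; congr pair; rewrite /= ?linear0 ?addr0 ?subr0 ?oppr0.
Qed.

Section SumComplex.
Variables X Y : cpx R.

Definition sum_cd n : {linear (X n * Y n)%type -> (X (n + 1)%R * Y (n + 1)%R)%type} :=
  mkpair (cd X n \o @fstl R _ _) (cd Y n \o @sndl R _ _).

Lemma sum_cdd n x : sum_cd (n + 1) (sum_cd n x) = 0.
Proof. by rewrite /= !cdd. Qed.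

Lemma sum_bound : exists N : nat,
  forall n : int, (N < `|n|)%N -> forall x : X n * Y n, x = 0.
Proof.
have [N XN] := cbound X; have [M YM] := cbound Y.
exists (maxn N M) => n; rewrite gtn_max => /andP[nN nM] [x y].
by congr pair; [apply: XN | apply: YM].
Qed.

Definition sum_cpx : cpx R :=
  @Cpx R (fun n => FgMod (fin_gen_pair (fg_fin (X n)) (fg_fin (Y n))))
    sum_cd sum_cdd sum_bound.

End SumComplex.

(** Z is the homotopy pushout, the cone of (u, -f). Its quotient by Y is [cone u], so [u'] and [u]
    have quasi-isomorphic cones, and the summand X[1] of Z carries the homotopy making the square
    commute. *)
Lemma perf_cone_ore (X X1 Y : Kb R) (u : hom X X1) (f : hom X Y) : V u ->
  exists (Z : Kb R) (u' : hom Y Z) (f' : hom X1 Z), V u' /\ f' <o> u =~ u' <o> f.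
Proof.
move=> Vu.
pose kf n : {linear X n -> (X1 n * Y n)%type} := mkpair (u n) (\- f n).
have kE n x : kf (n + 1) (cd X n x) = cd (sum_cpx X1 Y) n (kf n x).
  by rewrite /= !cfunE linearN.
pose k : cmap X (sum_cpx X1 Y) := @Cmap R X (sum_cpx X1 Y) kf kE.
have u'lin n : linear (fun y : Y n => (0, (0, y)) : cone k n).
  by move=> a y y'; congr pair; [|congr pair]; rewrite /= ?scaler0 ?addr0.
have u'E n y : mklin (u'lin (n + 1)) (cd Y n y) = cd (cone k) n (mklin (u'lin n) y).
  by congr pair; [|congr pair]; rewrite /= ?linear0 ?oppr0 ?add0r ?linear0.
have f'lin n : linear (fun z : X1 n => (0, (z, 0)) : cone k n).
  by move=> a y y'; congr pair; [|congr pair]; rewrite /= ?scaler0 ?addr0.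
have f'E n z : mklin (f'lin (n + 1)) (cd X1 n z) = cd (cone k) n (mklin (f'lin n) z).
  by congr pair; [|congr pair]; rewrite /= ?linear0 ?oppr0 ?add0r ?linear0.
pose u' : cmap Y (cone k) := @Cmap R Y (cone k) (fun n => mklin (u'lin n)) u'E.
pose f' : cmap X1 (cone k) := @Cmap R X1 (cone k) (fun n => mklin (f'lin n)) f'E.
exists (cone k), u', f'; split.
  pose gf n (p : X (n + 1) * (X1 n * Y n)) : X (n + 1) * X1 n := (p.1, p.2.1).
  have glin n : linear (gf n) by move=> a x y.
  have gE n p : mklin (glin (n + 1)) (cd (cone k) n p) = cd (cone u) n (mklin (glin n) p).
    by case: p => x [z y].
  pose g : cmap (cone k) (cone u) := @Cmap R (cone k) (cone u) (fun n => mklin (glin n)) gE.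
  have [|G qG] := @ses_cone R _ _ _ u' g; last exact: perf_qis_r qG Vu.
  move=> n; split.
  - by move=> y y' [].
  - by move=> [x z]; exists (x, (z, 0)).
  - move=> [x [z y]]; split=> [[/= -> ->]|[y' [-> -> _]] //].
    by exists y.
exists (fun n => mkpair idfun (mkpair \0 \0) : {linear X (n + 1) -> cone k n}) => n x.
by congr pair; [|congr pair]; rewrite /= ?linear0; zmod.
Qed.

(** The homotopy between f u and g u extends f - g to a map k from [cone u] to Y. The inclusion of Y
    in [cone k] kills f - g, and its cone is quasi-isomorphic to the shift of [cone u]. *)
Lemma perf_cone_cancel (X X1 Y : Kb R) (u : hom X X1) (f g : hom X1 Y) :
  V u -> f <o> u =~ g <o> u ->
  exists (Z : Kb R) (w : hom Y Z), V w /\ w <o> f =~ w <o> g.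
Proof.
move=> Vu [h hE].
pose kf n (p : X (n + 1) * X1 n) : Y n := f n p.2 - g n p.2 + h n p.1.
have klin n : linear (kf n).
  by move=> a x y; rewrite /kf (linearP (f n)) (linearP (g n)) (linearP (h n)) scalerDr scalerBr; zmod.
have kE n p : mklin (klin (n + 1)) (cd (cone u) n p) = cd Y n (mklin (klin n) p).
  case: p => x z; rewrite /= /kf /cone_fun /= !linearD !linearN !cfunE.
  by have H := hE n x; rewrite /= in H; zlin1 H.
pose k : cmap (cone u) Y := @Cmap R (cone u) Y (fun n => mklin (klin n)) kE.
exists (cone k), (cone_incl k); split.
  have [G qG] := ses_cone (cone_incl_ses k).
  exact: perf_qis_r qG (perf_shift Vu).
exists (fun n => mkpair (mkpair \0 idfun) \0 : {linear X1 (n + 1) -> cone k n}) => n z.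
congr pair; [congr pair|]; rewrite /= ?linear0 ?oppr0 ?addr0 ?subrr //.
- by rewrite add0r addNr.
- by rewrite /kf /= linear0 addr0.
Qed.

Notation lsg f := (fmap (sg_quotient R) (ldb f)).

Lemma perf_cone_sg_iso X Y (u : cmap X Y) : V u -> is_iso (lsg u).
Proof.
move=> Vu.
have Wu : cone_in (@perfect R) (ldb u : @hom (Db R) _ _).
  exists (cone u), (ldb (cone_incl u)), (ldb (cone_proj u) : @hom (Db R) _ (shift (X : Db R))).
  split; last exact/perfectP.
  exists X, Y, u, (idm _), (idm _), (idm _); split; first by split; apply: idm_iso.
  split.
  - by rewrite comp_idl comp_idr; reflexivity.
  - by rewrite comp_idl comp_idr; reflexivity.
  - by rewrite fmap_id comp_idl comp_idr; reflexivity.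
by exists (Linv Wu : @hom (Dsg R) _ _); split; [apply: lheq_invl | apply: lheq_invr].
Qed.

(** * Universal property of the singularity category over K^b *)

Section DsgLift.
Variables (E : category) (H : functor (Kb R) E).
Hypothesis Hq : forall (X Y : Kb R) (f : hom X Y), quasi_iso f -> is_iso (fmap H f).
Hypothesis HV : forall (X Y : Kb R) (f : hom X Y), V f -> is_iso (fmap H f).

(** A distinguished triangle is isomorphic to that of a chain map, so a morphism of D^b with perfect
    cone is a chain map with perf cone up to isomorphisms. *)
Lemma Dsg_lift_iso (X Y : Db R) (f : hom X Y) :
  cone_in (@perfect R) f -> is_iso (fmap (loc_lift Hq) f).
Proof.
move=> [Z [g [h [[X' [Y' [u [a [b [c [[isoa isob isoc] [bf _ _]]]]]]]] perfZ]]]].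
have Vu : V (u : @hom (Kb R) X' Y').
  apply/perfectP; case: isoc => c' [c'c cc']; apply: iso_perfect perfZ.
  by exists c', c.
have isou : is_iso (fmap (loc_lift Hq) (ldb u)) by exact: HV.
apply: (iso_comp_r (fmap_iso (loc_lift Hq) isob)).
apply: heq_iso (comp_iso isou (fmap_iso (loc_lift Hq) isoa)).
rewrite -(fmap_comp (loc_lift Hq) b f) -(fmap_comp (loc_lift Hq) (ldb u) a).
exact/fmap_heq/heq_sym.
Qed.

Definition Dsg_lift : functor (Dsg R) E := loc_lift Dsg_lift_iso.

End DsgLift.

(** The equality is pushed to the localization of K^b at the maps with perf cone, where fractions
    decide it. *)
Lemma sg_eq X Y (f g : cmap X Y) : lsg f =~ lsg g ->
  exists Z (w : cmap Y Z), perf (cone w) /\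
    homotopic (cmap_comp w f) (cmap_comp w g).
Proof.
move=> fg.
have locV (A B : Kb R) (s : hom A B) : V s -> is_iso (fmap (loc perf_cone_map) s).
  move=> Vs; exists (Linv Vs : @hom (localization perf_cone_map) B A).
  by split; [apply: lheq_invl | apply: lheq_invr].
have locq (A B : Kb R) (s : hom A B) : quasi_iso s -> is_iso (fmap (loc perf_cone_map) s).
  by move=> qs; apply/locV/perf_cone_qis.
have := fmap_heq (Dsg_lift locq locV) fg.
by apply: (loc_eq perf_cone_id perf_cone_comp perf_cone_heq perf_cone_ore perf_cone_cancel).
Qed.

End PerfectCone.

Notation lsg f := (fmap (sg_quotient _) (ldb f)).

(** * Projective resolutions *)

Section Stalk.
Variable R : pzRingType.

Lemma row0 (x : 'rV[R]_0) : x = 0. Proof. by apply/rowP => -[]. Qed.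

Definition zero_fgmod : fgmod R := FgMod (fin_gen0 row0).

Section If.
Variables (M : fgmod R).

(** In degree c the stalk complex is a conditional on [c == c], which does not reduce to [M]; these
    two maps pass between the forms. *)
Definition if_in b (e : true = b) : {linear M -> (if b then M else zero_fgmod : fgmod R)} :=
  match e in _ = b return {linear M -> (if b then M else zero_fgmod : fgmod R)} with
  | erefl => idfun end.
Definition if_out b (e : true = b) : {linear (if b then M else zero_fgmod : fgmod R) -> M} :=
  match e in _ = b return {linear (if b then M else zero_fgmod : fgmod R) -> M} with
  | erefl => idfun end.

Lemma if_inK b (e : true = b) : cancel (if_in e) (if_out e).
Proof. by case: _ / e. Qed.
Lemma if_outK b (e : true = b) : cancel (if_out e) (if_in e).
Proof. by case: _ / e. Qed.

End If.

Variables (M : fgmod R) (c : int).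

Definition stalk_ct (n : int) : fgmod R := if n == c then M else zero_fgmod.

Lemma stalk_ct0 n : n <> c -> forall x : stalk_ct n, x = 0.
Proof. by rewrite /stalk_ct; case: eqP => // _ _ x; apply: row0. Qed.

Lemma stalk_bound : exists N : nat,
  forall n : int, (N < `|n|)%N -> forall x : stalk_ct n, x = 0.
Proof. by exists `|c|%N => n cn; apply: stalk_ct0 => E; move: cn; rewrite E; lia. Qed.

Definition stalk : cpx R :=
  @Cpx R stalk_ct (fun n => \0 : {linear stalk_ct n -> stalk_ct (n + 1)})
    (fun n x => erefl) stalk_bound.

Definition stalk_in : {linear M -> stalk c} := if_in M (esym (eqxx c)).
Definition stalk_out : {linear stalk c -> M} := if_out M (esym (eqxx c)).

Lemma stalk_inK : cancel stalk_in stalk_out. Proof. exact: if_inK. Qed.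
Lemma stalk_outK : cancel stalk_out stalk_in. Proof. exact: if_outK. Qed.

Lemma stalk0 n : n <> c -> forall x : stalk n, x = 0.
Proof. exact: stalk_ct0. Qed.

End Stalk.

Section StalkMaps.
Variable R : pzRingType.
Implicit Types (M : fgmod R) (X : cpx R).

Lemma stalk_from M c X (phi : {linear M -> X c}) :
  (forall x, cd X c (phi x) = 0) ->
  exists f : cmap (stalk M c) X, forall x, f c x = phi (stalk_out M c x).
Proof.
move=> dphi; have [f [fc fn]] := single_family (A := fun n => stalk M c n : lmodType R)
  (B := fun n => X n : lmodType R) (phi \o stalk_out M c).
have fE n x : f (n + 1) (cd (stalk M c) n x) = cd X n (f n x).
  rewrite linear0; have [Enc|/eqP nc] := eqVneq n c; last by rewrite fn // linear0.
  by subst n; rewrite fc /= dphi.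
by exists (@Cmap R (stalk M c) X f fE).
Qed.

Lemma stalk_to M c X (phi : {linear X c -> M}) :
  (forall n (e : n + 1 = c) x, phi (castX X e (cd X n x)) = 0) ->
  exists f : cmap X (stalk M c), forall x, f c x = stalk_in M c (phi x).
Proof.
move=> phid; have [f [fc fn]] := single_family (A := fun n => X n : lmodType R)
  (B := fun n => stalk M c n : lmodType R) (stalk_in M c \o phi).
have fE n x : f (n + 1) (cd X n x) = cd (stalk M c) n (f n x).
  have [Enc|/eqP nc] := eqVneq (n + 1) c; last by rewrite fn.
  by subst c; rewrite fc /= (phid n erefl) linear0.
by exists (@Cmap R X (stalk M c) f fE).
Qed.

Lemma projective_stalk M c : projective M -> forall n, projective (stalk M c n).
Proof.
move=> projM n; have [Enc|/eqP nc] := eqVneq n c; last first.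
  by apply: projective0 => x; apply: stalk0 nc x.
by subst n; apply: (proj_retract (stalk_outK (M := M) (c := c))).
Qed.

Lemma perf_stalk_proj M c : projective M -> perf (stalk M c).
Proof.
move=> projM; exists (stalk M c); split; first exact: projective_stalk.
by exists (cmap_id _); apply: quasi_iso_id.
Qed.

Lemma stalk_ses (K P M : fgmod R) (k : {linear K -> P}) (p : {linear P -> M}) c :
  short_exact k p -> exists (f : cmap (stalk K c) (stalk P c))
    (g : cmap (stalk P c) (stalk M c)), ses f g.
Proof.
move=> [kinj psurj pk].
have [f fE] := @stalk_from K c (stalk P c) (stalk_in P c \o k) (fun=> erefl).
have [g gE] := @stalk_from P c (stalk M c) (stalk_in M c \o p) (fun=> erefl).
have inj_in (N : fgmod R) : injective (stalk_in N c) := can_inj (@stalk_inK R N c).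
have inj_out (N : fgmod R) : injective (stalk_out N c) := can_inj (@stalk_outK R N c).
exists f, g => n; have [Enc|/eqP nc] := eqVneq n c; last first.
  split.
  - by move=> x y _; rewrite (stalk0 nc x) (stalk0 nc y).
  - by move=> m; exists 0; rewrite linear0 (stalk0 nc m).
  - move=> x; split=> _; last by apply: stalk0.
    by exists 0; rewrite linear0 (stalk0 nc x).
subst n; split.
- by move=> x y; rewrite !fE /= => /inj_in/kinj/inj_out.
- move=> m; have [x Ex] := psurj (stalk_out M c m); exists (stalk_in P c x).
  by rewrite gE /= stalk_inK -Ex stalk_outK.
- move=> x; rewrite gE /=; split=> [E|[y ->]].
    have [|y Ey] := (pk (stalk_out P c x)).1; first by apply: inj_in; rewrite E linear0.
    by exists (stalk_in K c y); rewrite fE /= stalk_inK -Ey stalk_outK.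
  rewrite fE /= stalk_inK (pk _).2 ?linear0 //; by exists (stalk_out K c y).
Qed.

Lemma perf_stalk_fg_pd n M c : fg_pd_le n M -> perf (stalk M c).
Proof.
elim: n M => [|n IH] M /=; first exact: perf_stalk_proj.
move=> [K [P [k [p [kp projP pdK]]]]]; have [f [g fg]] := stalk_ses c kp.
exact: perf_ses_r fg (IH _ pdK) (perf_stalk_proj c projP).
Qed.

End StalkMaps.

(** * Truncated resolutions and the converse direction *)

Section Tower.
Variables (R : pzRingType) (hR : left_noetherian R).
Implicit Types X Y N P Q : cpx R.

(** One step of a resolution from the top down: [F] is added in degree m + 1 to kill the cohomology
    of [cone k] there. Writing [Q'] as the cone of a map out of a stalk in degree m + 2 makes it a
    complex for free. If [psi] is injective, no new cohomology appears and the resolution is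
    complete. *)
Lemma tower_step Y Q (k : cmap Q Y) (F : fgmod R) (m : int)
    (psi : {linear F -> cone k (m + 1)}) :
  projective F -> (forall n, projective (Q n)) ->
  (forall n, m + 1 < n + 1 -> exact_at (cone k) n) ->
  (forall x, cd (cone k) (m + 1) x = 0 <-> exists z, x = psi z) ->
  exists (Q' : cpx R) (k' : cmap Q' Y),
  [/\ forall n, projective (Q' n),
      forall n, n <> m + 1 -> (forall x : Q n, x = 0) -> forall x : Q' n, x = 0,
      forall n, m < n + 1 -> exact_at (cone k') n
    & injective psi -> (forall n, n <= m + 1 -> forall x : Q n, x = 0) ->
      (forall n, n <= m + 1 -> forall x : Y n, x = 0) -> acyclic (cone k')].
Proof.
move=> projF projQ exk psiK.
have psi0 z : cd (cone k) (m + 1) (psi z) = 0 by apply/psiK; exists z.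
have psi1 z : cd Q (m + 1 + 1) (psi z).1 = 0.
  by have /(congr1 fst)/= /eqP := psi0 z; rewrite oppr_eq0 => /eqP.
have psi2 z : k (m + 1 + 1) (psi z).1 + cd Y (m + 1) (psi z).2 = 0.
  by have /(congr1 snd)/= := psi0 z.
have [f fE] := @stalk_from R F (m + 1 + 1) Q (@fstl R _ _ \o psi) psi1.
pose S := stalk F (m + 1 + 1).
have S0 n : n <> m + 1 -> forall x : S (n + 1), x = 0.
  by move=> nm x; apply: stalk0; apply/eqP; apply: contra_notN nm => /eqP/addIr.
(* The sign makes k f = d g: a cocycle (q, y) of [cone k] satisfies k q = - d y. *)
have [g [gm gn]] := single_family (A := fun n => S (n + 1) : lmodType R)
  (B := fun n => Y n : lmodType R) (b := m + 1) (\- (@sndl R _ _ \o psi \o stalk_out F (m + 1 + 1))).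
have fgE n x : k (n + 1) (f (n + 1) x) = cd Y n (g n x).
  have [Enm|/eqP nm] := eqVneq n (m + 1); last by rewrite (S0 n nm x) !linear0.
  subst n; rewrite fE gm /= linearN.
  by apply/eqP; rewrite -addr_eq0 psi2.
pose Q' := cone f.
pose kf n (p : S (n + 1) * Q n) : Y n := k n p.2 + g n p.1.
have klin n : linear (kf n).
  by move=> a x y; rewrite /kf (linearP (k n)) (linearP (g n)) scalerDr; zmod.
have kE n p : mklin (klin (n + 1)) (cd Q' n p) = cd Y n (mklin (klin n) p).
  case: p => x q; rewrite /= /kf /cone_fun /= oppr0 linear0 addr0 !linearD fgE cfunE.
  by zmod.
pose k' : cmap Q' Y := @Cmap R Q' Y (fun n => mklin (klin n)) kE.
have exk' n : m < n + 1 -> exact_at (cone k') n.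
  move=> mn [[x q] y] [/= _ E1 E2].
  have x0 : x = 0 by apply: S0; lia.
  subst x; move: E1 E2; rewrite /kf /= !linear0 add0r => /eqP.
  rewrite oppr_eq0 => /eqP dq; rewrite addr0 => E2.
  have dqy : cd (cone k) (n + 1) (q, y) = 0 by rewrite /= /cone_fun /= dq oppr0 E2.
  have [Enm|nm] := eqVneq n m.
    subst n; have [z Ez] := (psiK _).1 dqy.
    exists ((- stalk_in F (m + 1 + 1) z, 0), 0).
    have Eq : q = (psi z).1 by rewrite -Ez.
    have Ey : y = (psi z).2 by rewrite -Ez.
    congr pair; [congr pair|]; rewrite /= /kf /= ?linear0 ?oppr0 //.
      by rewrite ?linear0 linearN fE /= stalk_inK addr0 opprK.
    by rewrite ?linear0 linearN gm /= stalk_inK opprK add0r addr0.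
  have [|[q' y'] [Eq Ey]] := exk n _ (q, y) dqy; first by lia.
  exists ((0, q'), y').
  congr pair; [congr pair|]; rewrite /= /kf /= ?linear0 ?oppr0 //.
    by rewrite ?linear0 add0r.
  by rewrite ?linear0 addr0.
exists Q', k'; split=> //.
- by move=> n; apply: projective_pair => //; apply: projective_stalk.
- by move=> n nm Q0 [x q]; congr pair; [apply: S0 | apply: Q0].
- move=> psi_inj Q0 Y0 n; have [mn|nm] := boolP (m < n + 1); first exact: exk'.
  move=> [[x q] y] [/= _ E1 E2].
  have q0 : q = 0 by apply: Q0; lia.
  have y0 : y = 0 by apply: Y0; lia.
  subst q y; have [Enm|/eqP nm'] := eqVneq (n + 1 + 1) (m + 1); last first.
    (* Below the new degree the only term of the cone that may survive is [F], in degree m, where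
       the differential is [psi] up to sign. *)
    by rewrite (S0 _ nm' x); exists 0; exact: (esym (linear0 (cd (cone k') n))).
  have En : n + 1 = m by apply: addIr Enm.
  suff -> : x = 0 by exists 0; exact: (esym (linear0 (cd (cone k') n))).
  move: E1 E2; rewrite linear0 addr0 => /eqP; rewrite oppr_eq0 => /eqP E1 _.
  move: x E1; rewrite /= in Enm *; rewrite Enm => x; rewrite fE /= => E1.
  apply: (can_inj (@stalk_outK R F (m + 1 + 1))); rewrite linear0.
  apply: psi_inj; rewrite linear0; apply: injective_projections; first exact: E1.
  exact: Y0.
Qed.

(** After j steps the complex Q lives in degrees t - j + 1 to t. It starts from 0, which resolves Y
    above degree t. *)
Lemma tower Y (t : int) : (forall n, t < n -> forall x : Y n, x = 0) ->
  forall j : nat, exists (Q : cpx R) (k : cmap Q Y),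
  [/\ forall n, projective (Q n),
      forall n, (n <= t - j%:Z) || (t < n) -> forall x : Q n, x = 0
    & forall n, t - j%:Z < n + 1 -> exact_at (cone k) n].
Proof.
move=> Yt; elim=> [|j [Q [k [projQ Q0 exk]]]].
  pose Z := stalk (zero_fgmod R) 0.
  have Z0 n (x : Z n) : x = 0.
    have [En|/eqP n0] := eqVneq n 0; last exact: stalk0 n0 x.
    by subst n; apply: row0.
  exists Z, (cmap0 Z Y); split=> [n|n _ x|n tn]; first by apply: projective0; apply: Z0.
    exact: Z0.
  by apply: exact_at0 => -[x y]; congr pair; [apply: Z0 | apply: Yt; lia].
have [m Em] := int_pred (t - j%:Z).
have [K [kk [kkinj kkP]]] := kernel_object hR (cd (cone k) (m + 1)).
have [F [p [projF psurj]]] := proj_cover (fg_fin K).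
have [||||Q' [k' [projQ' Q'0 exk' _]]] := @tower_step Y Q k F m (kk \o p).
- exact: projF.
- exact: projQ.
- by move=> n mn; apply: exk; rewrite Em.
- move=> x; split=> [/kkP[y ->]|[z ->]]; last by apply/kkP; exists (p z).
  by have [z ->] := psurj y; exists z.
exists Q', k'; split=> //.
  by move=> n nb; apply: Q'0; [lia | apply: Q0; lia].
by move=> n nb; apply: exk'; lia.
Qed.

(* The lowest syzygy of a long truncated resolution of Y becomes a direct
   summand of a projective module: up to homotopy, 1 - (Q -> P -> Q) is
   concentrated in the lowest degree, where it maps onto the syzygy. *)
Lemma retract_resolution Y N (s : cmap Y N) (r : cmap N Y) (t : int) :
  homotopic (cmap_comp r s) (cmap_id Y) -> perf N ->
  (forall n, t < n -> forall x : Y n, x = 0) ->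
  exists P : cpx R, [/\ forall n, projective (P n),
      forall n, t < n -> forall x : P n, x = 0
    & exists p : cmap P Y, qis p].
Proof.
move=> rs [P [projP [p qp]]] Yt.
have [NP [NP0 P0]] := cpx_bounds P; have [NY [NY0 Y0]] := cpx_bounds Y.
(* Long enough for m + 1 = t - j to lie below the supports of [P] and [Y], and m + 2 below that of
   [P]. *)
pose j : nat := `|t|%N + `|NP|%N + `|NY|%N + 4.
have [Q [k [projQ Q0 exk]]] := tower Yt j.
have [m Em] := int_pred (t - j%:Z).
have mt : m + 1 <= t by rewrite /j in Em; lia.
have mP : m + 1 + 1 < - NP by rewrite /j in Em; lia.
have mY : m + 1 < - NY by rewrite /j in Em; lia.
have Plow n : n <= m + 1 + 1 -> forall x : P n, x = 0.
  by move=> nm x; apply: P0; apply/orP; left; lia.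
have Ylow n : n <= m + 1 -> forall x : Y n, x = 0.
  by move=> nm x; apply: Y0; apply/orP; left; lia.
have Qlow n : n <= m + 1 -> forall x : Q n, x = 0.
  by move=> nm x; apply: Q0; apply/orP; left; lia.
have exk1 n : m + 1 < n + 1 -> exact_at (cone k) n by move=> mn; apply: exk; lia.
(* s k lifts through the resolution [P] of [N], and r p lifts back to [Q] since [P] vanishes
   wherever [cone k] may fail to be exact. The composite [ba] is the identity as seen by k, up to
   homotopy. *)
have [al alE] := lift_quasi_iso (cmap_comp s k) projQ qp.
have [|be beE] := lift_above (s := k) (cmap_comp r p) projP exk1.
  by move=> n nm; apply: Plow; lia.
pose ba : cmap Q Q := cmap_comp be al.
have kba : homotopic k (cmap_comp k ba).
  apply: homotopic_sym.
  have E1 : homotopic (cmap_comp k ba) (cmap_comp (cmap_comp r p) al).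
    exact: (homotopic_comp beE (homotopic_refl al)).
  have E2 : homotopic (cmap_comp (cmap_comp r p) al) (cmap_comp (cmap_comp r s) k).
    exact: (homotopic_comp (homotopic_refl r) alE).
  have E3 : homotopic (cmap_comp (cmap_comp r s) k) k.
    exact: (homotopic_comp rs (homotopic_refl k)).
  exact: homotopic_trans E1 (homotopic_trans E2 E3).
have [h hE] := kba.
pose Gf n (x : Q (n + 1)) : Q (n + 1) * Y n := (x - ba (n + 1) x, - h n x).
have Glin n : linear (Gf n).
  move=> a x y; congr pair; rewrite /= ?(linearP (al (n + 1))) ?(linearP (be (n + 1))) ?(linearP (h n)).
    by rewrite scalerBr; zmod.
  by rewrite scalerN; zmod.
have GE n x : mklin (Glin (n + 1)) (cd (shift_cpx Q) n x) = cd (cone k) n (mklin (Glin n) x).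
  rewrite /= /Gf /cone_fun /=; congr pair; rewrite /=.
    by rewrite !linearN linearB /= !cfunE; zmod.
  rewrite !linearN linearB.
  by have H := hE n x; rewrite /= in H; zlin1 H.
pose G : cmap (shift_cpx Q) (cone k) := @Cmap R (shift_cpx Q) (cone k) (fun n => mklin (Glin n)) GE.
have [G' [[H HE] G'0]] := homotopy_above G (fun n => projQ (n + 1)) exk1.
have [Om [om [ominj omP]]] := kernel_object hR (cd (cone k) (m + 1)).
(* G' vanishes in degree m + 2, so its values in degree m + 1 are cocycles: they lie in the syzygy
   [Om]. *)
have [|rho rhoE] := @lin_lift R (Q (m + 1 + 1)) (cone k (m + 1)) Om om (G' (m + 1)) ominj.
  move=> x; apply/omP.
  by rewrite -(@cfunE R _ _ G' (m + 1) x) G'0 //; lia.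
(* On the syzygy all corrections disappear: [ba] factors through P in degree m + 2, which is 0,
   [H m] has target 0, and the other homotopy term is applied to the differential of a cocycle. *)
have omK z : rho ((om z).1) = z.
  apply: ominj; rewrite rhoE.
  have /omP := ex_intro (fun y => om z = om y) z erefl.
  have Oy : (om z).2 = 0 by apply: Ylow.
  move=> [/eqP]; rewrite oppr_eq0 => /eqP dq _.
  have HEz := HE m (om z).1.
  have H0 : H m (om z).1 = 0.
    by apply: injective_projections; [apply: Qlow; lia | apply: Ylow; lia].
  rewrite H0 linear0 add0r /= dq oppr0 linear0 in HEz.
  move/eqP: HEz; rewrite subr_eq0 => /eqP <-.
  rewrite /Gf; apply: injective_projections; rewrite /=.
    by rewrite (Plow _ _ (al (m + 1 + 1) (om z).1)) // linear0 subr0.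
  by rewrite Oy; apply: Ylow.
have projOm : projective Om.
  exact: (proj_retract (i := @fstl R _ _ \o om) omK (projQ (m + 1 + 1))).
(* Since [Om] is projective and [om] injective, adding [Om] itself as the last term ends the
   resolution. *)
have [Q' [k' [projQ' Q'0 _ ack']]] := @tower_step Y Q k Om m om projOm projQ exk1 omP.
exists Q'; split=> //.
  by move=> n tn; apply: Q'0; [lia | apply: Q0; apply/orP; right].
by exists k'; apply/quasi_iso_acyclic; apply: ack'.
Qed.

(** Term i of the resolution sits in degree t - i. Exactness away from the end holds because [Y] is
    zero there, and the casts come from t - (i + 1) + 1 against t - i. *)
Lemma finite_pd_resolution (M : fgmod R) Y P (t : int) (p : cmap P Y)
    (o : {linear Y t -> M}) :
  (forall n, projective (P n)) -> (forall n, t < n -> forall x : P n, x = 0) ->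
  (forall n, n <> t -> forall x : Y n, x = 0) -> qis p ->
  injective o -> (forall z, exists y, z = o y) -> finite_pd M.
Proof.
move=> projP Pt Yt qp oinj osurj.
have e0 : t - 0%N%:Z = t by rewrite subr0.
have e1 (i : nat) : t - i.+1%:Z + 1 = t - i%:Z by lia.
pose PX i : lmodType R := P (t - i%:Z).
pose dX i : {linear PX i.+1 -> PX i} := castX P (e1 i) \o cd P (t - i.+1%:Z).
pose eps : {linear PX 0%N -> M} := o \o p t \o castX P e0.
have ex n m (e : m + 1 = n) (x : P n) : cd P n x = 0 -> p n x = 0 ->
    exists w, x = castX P e (cd P m w).
  subst n => dx px; have [|w Ew] := (qp m).1 x dx; first by exists 0; rewrite px linear0.
  by exists w.
have castd n m (e : m + 1 = n) (x : P m) : cd P n (castX P e (cd P m x)) = 0.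
  by subst n; rewrite castl_id cdd.
have [N [N0 PN]] := cpx_bounds P.
exists PX, dX, eps, (`|t|%N + `|N|%N); split.
- by move=> i; apply: projP.
- by move=> i Ni x; apply: PN; apply/orP; left; lia.
- move=> z; have [y Ey] := osurj z.
  have [m Em] := int_pred t; subst t.
  have [|x [w [_ Exw]]] := (qp m).2 y; first by apply: Yt; lia.
  exists (castX P (esym e0) x); rewrite /eps /= (castl_trans (A := fun n => P n) _ _ erefl) castl_id.
  rewrite Ey Exw (Yt m _ w) ?linear0 ?addr0 //; lia.
- move=> x; split=> [/= E|[y ->]].
    have px : p t (castX P e0 x) = 0 by apply: oinj; rewrite E linear0.
    have e : t - 1 + 1 = t by rewrite subrK.
    have [|w Ew] := ex t _ e _ _ px; first by apply: Pt; lia.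
    exists w; apply: (castl_inj (A := fun n => P n) (e := e0)); rewrite Ew.
    by rewrite /dX /= (castl_trans (A := fun n => P n) _ _ e).
  rewrite /eps /= (castl_trans (A := fun n => P n) _ _ (etrans (e1 0%N) e0)) cfun_castl cfunE.
  have /Yt Y0 : t - 1%N%:Z <> t by lia.
  by rewrite (Y0 (p _ y)) !linear0.
- move=> i x; split=> [/= E|[y ->]].
    have [||w Ew] := ex _ _ (e1 i.+1) x.
    + by apply: (castl_inj (A := fun n => P n) (e := e1 i)); rewrite E linear0.
    + by apply: Yt; lia.
    by exists w.
  by rewrite /dX /= castd linear0.
Qed.

Notation lsg f := (fmap (sg_quotient R) (ldb f)).

(** Some w out of the stalk, with perf cone, is null-homotopic. The pair (1, -h) is then a section
    of the projection from [cone w] to the shifted stalk, which becomes a retract of a perf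
    complex. *)
Lemma sg_zero_finite_pd (M : fgmod R) (c : int) :
  lsg (cmap_id (stalk M c)) =~ lsg (cmap0 (stalk M c) (stalk M c)) -> finite_pd M.
Proof.
have [t Et] := int_pred c; subst c; set X := stalk M (t + 1).
move=> /sg_eq[W [w [pw [h hE]]]].
pose Y := shift_cpx X.
pose sf n (x : X (n + 1)) : X (n + 1) * W n := (x, - h n x).
have slin n : linear (sf n).
  by move=> a x y; congr pair; rewrite /= linearP scalerN; zmod.
have sE n x : mklin (slin (n + 1)) (cd Y n x) = cd (cone w) n (mklin (slin n) x).
  rewrite /= /sf /cone_fun /=; congr pair.
  have H := hE n x; rewrite /= !linear0 ?subr0 !addr0 in H.
  by rewrite /= (linearN (cd W n)) H subrr !(oppr0, linear0).
pose s : cmap Y (cone w) := @Cmap R Y (cone w) (fun n => mklin (slin n)) sE.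
have Yt n : n <> t -> forall x : Y n, x = 0.
  by move=> nt x; apply: stalk0 => /addIr.
have [||P [projP Pt [p qp]]] := @retract_resolution Y (cone w) s (cone_proj w) t _ pw.
- exact: eq_homotopic.
- by move=> n tn; apply: Yt; lia.
apply: (@finite_pd_resolution M Y P t p (stalk_out M (t + 1)) projP Pt Yt qp).
- exact: can_inj (@stalk_outK R M (t + 1)).
- by move=> z; exists (stalk_in M (t + 1) z); rewrite stalk_inK.
Qed.

End Tower.

(** * Devissage *)

Section Devissage.
Variables (R : pzRingType) (hR : left_noetherian R).
Implicit Types (X Y : cpx R) (M N : fgmod R).

Lemma subcomplex X (D : forall n, X n -> Prop) :
  (forall n, submodule (@D n)) -> (forall n x, D n x -> D (n + 1) (cd X n x)) ->
  exists (C : cpx R) (i : cmap C X), forall n,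
    injective (i n) /\ forall x, D n x <-> exists y, x = i n y.
Proof.
move=> sD Dd.
have ex n : exists K : fgmod R, exists k : {linear K -> X n},
    injective k /\ forall x, D n x <-> exists y, x = k y.
  have [K [k [kinj kP]]] := submodule_object (sD n).
  by exists (FgMod (fin_gen_submodule hR (fg_fin (X n)) (sD n) kinj kP)), k.
pose K n := sval (cid (ex n)); pose k n : {linear K n -> X n} := sval (cid (svalP (cid (ex n)))).
have kP n : injective (k n) /\ forall x, D n x <-> exists y, x = k n y.
  exact: svalP (cid (svalP (cid (ex n)))).
have dex n : exists d : {linear K n -> K (n + 1)}, forall x, k (n + 1) (d x) = cd X n (k n x).
  apply: (@lin_lift R _ _ _ (k (n + 1)) (cd X n \o k n)); first exact: (kP _).1.
  by move=> x; apply/(kP (n + 1)).2/Dd/(kP n).2; exists x.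
pose d n := sval (cid (dex n)).
have dE n x : k (n + 1) (d n x) = cd X n (k n x) := svalP (cid (dex n)) x.
have dd n x : d (n + 1) (d n x) = 0.
  by apply: (kP _).1; rewrite !dE cdd linear0.
have bd : exists B : nat, forall n : int, (B < `|n|)%N -> forall x : K n, x = 0.
  have [B XB] := cbound X; exists B => n nB x.
  by apply: (kP n).1; rewrite linear0; apply: XB.
pose C := @Cpx R K d dd bd.
by exists C, (@Cmap R C X k dE).
Qed.

Lemma perf_stalk_iso M N (f : {linear M -> N}) c :
  injective f -> (forall y, exists x, y = f x) ->
  perf (stalk M c) -> perf (stalk N c).
Proof.
move=> finj fsurj pM.
have ex : short_exact (\0 : {linear zero_fgmod R -> M}) f.
  split=> //; first by move=> x y _; rewrite (row0 x) (row0 y).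
  move=> x; split=> [E|[y ->]]; last by rewrite linear0.
  by exists 0; apply: finj; rewrite E /= linear0.
have [g [h gh]] := stalk_ses c ex.
apply: perf_ses_r gh _ pM; apply: perf_stalk_proj; apply: projective0.
exact: row0.
Qed.

Lemma perf_zero X : (forall n (x : X n), x = 0) -> perf X.
Proof. by move=> X0; apply: perf_acyclic => n; apply: exact_at0. Qed.

(** Induction on the length by brutal truncation: the lowest term, in degree [a], is the quotient of
    X by the subcomplex of the terms above it. *)
Lemma perf_terms X : (forall n c, perf (stalk (X n) c)) -> perf X.
Proof.
have [b [_ Xb]] := cpx_bounds X => pX.
have {Xb} [j Xj] : exists j : nat, forall n, (n <= b - j%:Z) || (b < n) -> forall x : X n, x = 0.
  by exists (`|b|%N + `|b|%N).+1 => n bn x; apply: Xb; lia.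
elim: j X pX Xj => [|j IH] X pX Xj.
  by apply: perf_zero => n x; apply: Xj; lia.
pose a := b - j%:Z.
have sD n : submodule (fun x : X n => n <= a -> x = 0).
  by split=> // r x y Dx Dy na; rewrite Dx // Dy // scaler0 addr0.
have [|C [i iP]] := subcomplex sD.
  by move=> n x Dx na; rewrite Dx ?linear0 //; lia.
have [|g gE] := @stalk_to R (X a) a X idfun.
  by move=> n e x; rewrite (Xj n _ x) ?linear0 //; apply/orP; left; rewrite /a in e; lia.
have gn n : n <> a -> forall x, g n x = 0 by move=> na x; apply: stalk0 na _.
have ex : ses i g.
  move=> n; have [iinj iD] := iP n; split=> //.
    move=> y; have [En|/eqP na] := eqVneq n a.
      by subst n; exists (stalk_out (X a) a y); rewrite gE /= stalk_outK.
    by exists 0; rewrite linear0; apply: stalk0 na _.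
  move=> x; split=> [gx|[y Ey]].
    apply/iD => na; have [En|nea] := eqVneq n a; last first.
      by apply: Xj; apply/orP; left; rewrite /a in na nea *; lia.
    subst n; apply: (can_inj (@stalk_inK R (X a) a)).
    by rewrite linear0 -gE.
  have [En|/eqP nea] := eqVneq n a; last exact: gn.
  by subst n; rewrite ((iD x).2 (ex_intro _ y Ey)) ?linear0.
apply: perf_ses_m ex _ (pX a a).
apply: IH => [n c|n bn x].
  have [iinj iD] := iP n; have [na|an] := boolP (n <= a).
    apply: perf_zero => m x; have [Em|/eqP mc] := eqVneq m c; last exact: stalk0 mc x.
    subst m; apply: (can_inj (@stalk_outK R (C n) c)); apply: iinj; rewrite !linear0.
    by apply/(iD _).2: na; exists (stalk_out (C n) c x).
  have [f [fK Kf]] := @bij_inverse R (C n) (X n) (i n) iinj (fun y => (iD y).1 (fun na => False_ind _ (negP an na))).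
  by apply: (@perf_stalk_iso (X n) (C n) f c (can_inj Kf)) => [y|]; [exists (i n y); rewrite fK | apply: pX].
have [iinj iD] := iP n; apply: iinj; rewrite linear0.
have [nb|bn'] := boolP (b < n); first by apply: Xj; rewrite nb orbT.
by apply: (iD (i n x)).2; [exists x | rewrite /a; lia].
Qed.

Variable e : R.
Hypothesis e_perf : forall M, (forall m : M, e *: m = 0) -> forall c, perf (stalk M c).

(** The terms of X are not killed by e, only its cohomology is, so the truncation must be the
    canonical one. The top cohomology module splits off as a stalk and the rest is shorter. *)
Lemma perf_killed X :
  (forall n (x : X (n + 1)), cd X (n + 1) x = 0 -> exists y, e *: x = cd X n y) ->
  perf X.
Proof.
have [b [_ Xb]] := cpx_bounds X => eX.
have {Xb} [j Xj] : exists j : nat, forall n, (n <= - b - 1) || (- b - 1 + j%:Z < n) -> forall x : X n, x = 0.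
  by exists (`|b|%N + `|b|%N).+2 => n bn x; apply: Xb; lia.
move: (- b - 1) Xj => a.
elim: j X eX => [|j IH] X eX Xj; first by apply: perf_zero => n x; apply: Xj; lia.
(* The top degree is m + 1, and [C] keeps everything below degree m together with the cocycles in
   degree m. *)
pose m := a + j%:Z.
have Xm n : m + 1 < n -> forall x : X n, x = 0.
  by move=> nm x; apply: Xj; apply/orP; right; rewrite /m in nm; lia.
have sD n : submodule (fun x : X n => (m <= n -> cd X n x = 0) /\ (m < n -> x = 0)).
  split=> [|r x y [D1 D2] [D3 D4]]; first by rewrite linear0.
  split=> nm; first by rewrite linearP D1 // D3 // scaler0 addr0.
  by rewrite D2 // D4 // scaler0 addr0.
have [|C [i iP]] := subcomplex sD.
  by move=> n x [D1 D2]; rewrite cdd; split=> // mn; apply: D1; lia.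
have [H0 [pi0 [pisurj0 piK0]]] := quotient_object (image_submodule (cd X m)).
have fH : fin_gen H0.
  by apply: fin_gen_surj (fg_fin (X (m + 1))) => //; exact: pisurj0.
pose H := FgMod fH; pose pi : {linear X (m + 1) -> H} := pi0.
have pisurj (y : H) : exists x, y = pi x := pisurj0 y.
have piK x : pi x = 0 <-> exists y, x = cd X m y := piK0 x.
have [|g gE] := @stalk_to R H (m + 1) X pi.
  move=> n E x; have En : n = m := addIr _ E; subst n; rewrite castl_id.
  by apply/piK; exists x.
have gn n : n <> m + 1 -> forall x, g n x = 0 by move=> nm x; apply: stalk0 nm _.
have iD n y : (m <= n -> cd X n (i n y) = 0) /\ (m < n -> i n y = 0).
  by apply/(iP n).2; exists y.
have gi n y : g n (i n y) = 0.
  have [En|/eqP nm] := eqVneq n (m + 1); last exact: gn.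
  by subst n; rewrite (iD _ y).2 ?linear0 //; lia.
(* C is the truncation of X below the top degree m+1, so the cone of C -> X is
   quasi-isomorphic to the top cohomology module H. *)
pose Gf n (z : C (n + 1) * X n) : stalk H (m + 1) n := g n z.2.
have Glin n : linear (Gf n) by move=> r x y; rewrite /Gf /= linearP.
have GE n z : mklin (Glin (n + 1)) (cd (cone i) n z) = cd (stalk H (m + 1)) n (mklin (Glin n) z).
  by case: z => x y; rewrite /= /Gf /cone_fun /= linearD gi add0r cfunE.
pose G : cmap (cone i) (stalk H (m + 1)) := @Cmap R (cone i) (stalk H (m + 1)) (fun n => mklin (Glin n)) GE.
have qG : qis G.
  move=> n; split.
    move=> [x y] /= [/eqP]; rewrite oppr_eq0 => /eqP dx ixy [_]; rewrite /Gf /= => gy.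
    have x0 : m <= n -> x = 0.
      by move=> mn; apply: (iP _).1; rewrite linear0; apply: (iD _ x).2; lia.
    have [Enm|nm] := eqVneq n m.
      subst n; have [|z Ez] := (piK y).1.
        by apply: (can_inj (@stalk_inK R H (m + 1))); rewrite linear0 -gE.
      by exists (0, z); rewrite /cone_fun /= x0 // !linear0 add0r Ez ?oppr0.
    have [mn|nm'] := boolP (m < n).
      have y0 : y = 0 by apply: Xm; lia.
      exists (0, 0); rewrite /cone_fun /= x0 ?y0; last by lia.
      by rewrite !linear0 ?addr0 ?oppr0.
    have dy : m <= n + 1 -> cd X (n + 1) y = 0.
      move=> mn; rewrite -[RHS]ixy (iD _ x).2 ?add0r //; lia.
    have [|z Ez] := ((iP (n + 1)).2 y).1; first by split=> // mn; lia.
    exists (z, 0); rewrite /cone_fun /= linear0 addr0 -Ez; congr pair.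
    apply: (iP _).1; rewrite linearN cfunE -Ez; apply/eqP.
    by rewrite -addr_eq0; apply/eqP.
  move=> y _; have [Enm|/eqP nm] := eqVneq n m; last first.
    exists 0, 0; rewrite !linear0; split=> //.
    by rewrite addr0; apply: stalk0 => /addIr.
  subst n; have [x Ex] := pisurj (stalk_out H (m + 1) y).
  exists (0, x), 0; split.
    by rewrite /= /cone_fun /= !linear0 add0r (Xm _ _ (cd X (m + 1) x)) ?oppr0 //; lia.
  by rewrite /= /Gf /= gE -Ex stalk_outK addr0.
have pH : perf (stalk H (m + 1)).
  apply: e_perf => y; have [x ->] := pisurj y; rewrite -linearZ; apply/piK.
  by apply: eX; apply: Xm; lia.
have pC : perf C.
  apply: IH => [n x dx|n na x].
    have dix : cd X (n + 1) (i (n + 1) x) = 0 by rewrite -cfunE dx linear0.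
    have [mn|nm] := boolP (m < n + 1).
      exists 0; rewrite linear0; apply: (iP _).1; rewrite linear0 linearZ /=.
      by rewrite (iD _ x).2 // scaler0.
    have [y Ey] := eX n (i (n + 1) x) dix.
    have [|z Ez] := ((iP n).2 y).1; first by split=> mn; lia.
    exists z; apply: (iP _).1; rewrite linearZ /= Ey cfunE -Ez //.
  apply: (iP n).1; rewrite linear0; have [mn|nm] := boolP (m < n).
    exact: (iD n x).2.
  by apply: Xj; apply/orP; left; rewrite /m in nm; lia.
exact: perf_ses_l (cone_incl_ses i) (perf_qis_r qG pH) (perf_shift pC).
Qed.

End Devissage.

(** * The Schur functor *)

Section Equivalences.

Lemma is_inverse_sym (C : category) (X Y : C) (f : hom X Y) (g : hom Y X) :
  is_inverse f g -> is_inverse g f.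
Proof. by case. Qed.

Lemma nat_isomorphic_sym (C D : category) (F G : functor C D) :
  nat_isomorphic F G -> nat_isomorphic G F.
Proof.
move=> [eta [isoe nat]]; exists (fun X => iso_inv (isoe X)); split=> [X|X Y f].
  by exists (eta X); apply/is_inverse_sym/iso_invP.
have [lX rX] := iso_invP (isoe X); have [lY rY] := iso_invP (isoe Y).
rewrite -(comp_idr (iso_inv (isoe Y) <o> _)) -rX -comp_assoc (comp_assoc (fmap G f)) -nat.
rewrite -(comp_assoc (eta Y)) comp_assoc lY comp_idl; reflexivity.
Qed.

Lemma nat_isomorphic_trans (C D : category) (F G H : functor C D) :
  nat_isomorphic F G -> nat_isomorphic G H -> nat_isomorphic F H.
Proof.
move=> [eta [isoe nate]] [th [isot natt]]; exists (fun X => th X <o> eta X); split=> [X|X Y f].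
  exact: comp_iso.
by rewrite -comp_assoc nate comp_assoc natt comp_assoc; reflexivity.
Qed.

Lemma nat_isomorphic_compl (C D E : category) (G : functor D E) (F F' : functor C D) :
  nat_isomorphic F F' -> nat_isomorphic (functor_comp G F) (functor_comp G F').
Proof.
move=> [eta [isoe nate]]; exists (fun X => fmap G (eta X)); split=> [X|X Y f].
  exact: (@fmap_iso _ _ G _ _ (eta X) (isoe X)).
by rewrite /= -!fmap_comp nate; reflexivity.
Qed.

Lemma nat_isomorphic_compr (C D E : category) (F : functor C D) (G G' : functor D E) :
  nat_isomorphic G G' -> nat_isomorphic (functor_comp G F) (functor_comp G' F).
Proof.
by move=> [eta [isoe nate]]; exists (fun X => eta (F X)); split=> [X|X Y f] /=; [apply: isoe | apply: nate].
Qed.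

Lemma nat_isomorphic_equivalence (C D : category) (F F' : functor C D) :
  nat_isomorphic F F' -> is_equivalence F -> is_equivalence F'.
Proof.
move=> FF' [G [GF FG]]; exists G; split.
  apply: nat_isomorphic_trans _ GF.
  exact/nat_isomorphic_compl/nat_isomorphic_sym.
apply: nat_isomorphic_trans _ FG.
exact/nat_isomorphic_compr/nat_isomorphic_sym.
Qed.

Lemma equivalence_faithful (C D : category) (F : functor C D) (X Y : C) (f g : hom X Y) :
  is_equivalence F -> fmap F f =~ fmap F g -> f =~ g.
Proof.
move=> [G [[eta [isoe nat]] _]] fg.
have [h [hl hr]] := isoe X.
have E : f <o> eta X =~ g <o> eta X.
  rewrite -[X in X =~ _](nat X Y f) -[X in _ =~ X](nat X Y g) /= fg; reflexivity.
by rewrite -(comp_idr f) -hr comp_assoc E -comp_assoc hr comp_idr; reflexivity.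
Qed.

End Equivalences.

Section TriangleIso.

Lemma triangle_iso_trans (C : category) (S : functor C C) (X Y Z X' Y' Z' X2 Y2 Z2 : C)
    (f : hom X Y) (g : hom Y Z) (h : hom Z (S X))
    (f' : hom X' Y') (g' : hom Y' Z') (h' : hom Z' (S X'))
    (f2 : hom X2 Y2) (g2 : hom Y2 Z2) (h2 : hom Z2 (S X2)) :
  triangle_iso f g h f' g' h' -> triangle_iso f' g' h' f2 g2 h2 ->
  triangle_iso f g h f2 g2 h2.
Proof.
move=> [a [b [c [[ia ib ic] [E1 E2 E3]]]]] [a' [b' [c' [[ia' ib' ic'] [E1' E2' E3']]]]].
exists (a' <o> a), (b' <o> b), (c' <o> c); split; first by split; apply: comp_iso.
split.
- by rewrite -comp_assoc E1 comp_assoc E1' comp_assoc; reflexivity.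
- by rewrite -comp_assoc E2 comp_assoc E2' comp_assoc; reflexivity.
- by rewrite fmap_comp -comp_assoc E3 comp_assoc E3' comp_assoc; reflexivity.
Qed.

Lemma triangle_iso_heq (C : category) (S : functor C C) (X Y Z : C)
    (f f' : hom X Y) (g g' : hom Y Z) (h h' : hom Z (S X)) :
  f =~ f' -> g =~ g' -> h =~ h' -> triangle_iso f g h f' g' h'.
Proof.
move=> E1 E2 E3; exists (idm X), (idm Y), (idm Z); split; first by split; apply: idm_iso.
split; rewrite ?fmap_id comp_idl comp_idr //.
Qed.

Lemma triangle_iso_map (C D : category) (F : functor C D) (S : functor C C) (S' : functor D D)
    (eta : forall X : C, hom (F (S X)) (S' (F X))) (X Y Z X' Y' Z' : C)
    (f : hom X Y) (g : hom Y Z) (h : hom Z (S X))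
    (f' : hom X' Y') (g' : hom Y' Z') (h' : hom Z' (S X')) :
  @nat_iso C D (functor_comp F S) (functor_comp S' F) eta ->
  triangle_iso f g h f' g' h' ->
  triangle_iso (fmap F f) (fmap F g) (eta X <o> fmap F h)
    (fmap F f') (fmap F g') (eta X' <o> fmap F h').
Proof.
move=> [_ nat] [a [b [c [[ia ib ic] [E1 E2 E3]]]]].
exists (fmap F a), (fmap F b), (fmap F c); split; first by split; apply: fmap_iso.
split.
- by rewrite -!fmap_comp E1; reflexivity.
- by rewrite -!fmap_comp E2; reflexivity.
- rewrite -comp_assoc -fmap_comp -E3 fmap_comp !comp_assoc.
  by rewrite -[X in X <o> fmap F h](nat X X' a); reflexivity.
Qed.

End TriangleIso.

Section SchurFunctor.
Variables (R : pzRingType) (e : R) (he : e * e = e).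
Hypothesis hR : left_noetherian R.
Notation eRe := (corner he).

Lemma corner_proof (x : R) : e * (e * x * e) * e == e * x * e.
Proof. by rewrite !mulrA he -[_ * e * e]mulrA he. Qed.
Definition cor (x : R) : eRe := exist _ (e * x * e) (corner_proof x).

(** A left ideal I of eRe generates a left ideal of R, which has finitely many generators taken from
    I. They generate I over eRe because e c a e = (e c e) a for a in I. *)
Lemma corner_noetherian : left_noetherian eRe.
Proof.
move=> I sI; pose A (x : R^o) := exists a : eRe, I a /\ x = sval a.
have [s sA] := hR (submodule_span A).
have [|t [tA ts]] := @span_finite R R^o A s.
  by move=> x xs; apply: (sA x).2; apply: span_gen.
have [t' [Et t'I]] : exists t' : seq eRe, t = map sval t' /\ forall a, a \in t' -> I a.
  elim: t tA {ts} => [|x t IH] tA; first by exists [::].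
  have [|t' [-> t'I]] := IH; first by move=> y yt; apply: tA; rewrite inE yt orbT.
  have [a [Ia ->]] := tA x (mem_head _ _); exists (a :: t'); split=> // b.
  by rewrite inE => /orP[/eqP->|/t'I].
exists t' => x; split=> [Ix|]; last by apply.
(* Quantifying over the multiplier c makes the predicate stable under scaling by R. *)
pose N (r : R^o) := forall c : R, span (fun y : eRe^o => y \in t') (cor (c * (r : R))).
have : N (sval x).
  have : span (fun y => y \in t) (sval x : R^o).
    apply: span_sub ts _; apply: (sA _).1; apply: span_gen.
    by exists x.
  move=> /(_ N); apply.
    split=> [c|c r r' Nr Nr' d].
      have -> : cor (c * 0) = 0 by apply: val_inj; rewrite /= !(mulr0, mul0r).
      exact: span0.
    have -> : cor (d * (c * r + r')) = cor (d * c * r) + cor (d * r').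
      by apply: val_inj; rewrite /= !(mulrDr, mulrDl) !mulrA.
    exact: (submoduleD (submodule_span _)).
  move=> y yt c; move: yt; rewrite Et => /mapP[a at' ->].
  have -> : cor (c * sval a) = cor c *: (a : eRe^o).
    apply: val_inj; rewrite /= /cor /=; have [ea ae] := cornerP he (valP a).
    by rewrite -[e * c * e * _]mulrA ea -!mulrA ae.
  by apply: (submoduleZ _ (submodule_span _)); apply: span_gen.
move=> /(_ 1); rewrite mul1r.
by have -> : cor (sval x) = x by apply: val_inj; apply/eqP/(valP x).
Qed.

Lemma pd_le_iso (S : pzRingType) n (A B : lmodType S) (f : {linear A -> B}) :
  injective f -> (forall y, exists x, y = f x) -> pd_le n A -> pd_le n B.
Proof.
move=> finj fsurj; have [g [fK gK]] := bij_inverse finj fsurj.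
case: n => [|n] /=; first exact: (proj_retract gK).
move=> [K [P [k [p [[kinj psurj pk] projP pdK]]]]].
exists K, P, k, (f \o p); split=> //; split=> // [m|x].
  by have [x Ex] := psurj (g m); exists x; rewrite /= -Ex gK.
rewrite -pk /=; split=> [E|->]; last by rewrite linear0.
by apply: finj; rewrite linear0.
Qed.

Lemma schur_lin_bij (U V : lmodType R) (f : {linear U -> V}) (g : {linear V -> U}) :
  cancel f g -> cancel (schur_lin he f) (schur_lin he g).
Proof. by move=> fK x; apply: val_inj; apply: fK. Qed.

Lemma pd_le_schur_pair n (U V : lmodType R) :
  pd_le n (schur he U) -> pd_le n (schur he V) -> pd_le n (schur he (U * V)%type).
Proof.
move=> pU pV; have := pd_le_pair pU pV.
apply: (@pd_le_iso _ n _ _ (copair (schur_lin he (@pairl R U V)) (schur_lin he (@pairr R U V)))).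
  move=> [x y] [x' y'] /(congr1 val) [/= E1 E2].
  by congr pair; apply: val_inj; [move: E1 | move: E2]; rewrite !(addr0, add0r).
move=> z; exists (schur_lin he (@fstl R U V) z, schur_lin he (@sndl R U V) z).
by apply: val_inj; rewrite /= {1}(pairE (sval z)).
Qed.

Hypothesis hpd : finite_pd (schur he R^o).

(** The bound on eR passes to e applied to a finite free module, and then to eP as a retract. *)
Lemma perf_schur_stalk (P : fgmod R) c : projective P -> perf (stalk (schur_fg he hR P) c).
Proof.
move=> projP; have [n pdR] := finite_pd_le hpd.
have [F [p [fF projF pdF psurj]]] := free_cover pdR (pd_le_schur_pair (n := n)) (fg_fin P).
have [g gE] := projP F P p idfun (fun v => let: ex_intro x E := psurj v in ex_intro _ x (esym E)).
have gK : cancel g p by move=> x; rewrite gE.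
apply: (@perf_stalk_fg_pd eRe n).
exact: (@pd_le_retract eRe corner_noetherian n (schur_fg he hR P) (schur he F)
  (schur_lin he g) (schur_lin he p) (schur_lin_bij gK) pdF).
Qed.

Notation Sc := (schur_cpx he hR).

(** The Schur functor turns projectives into modules of finite projective dimension, not into
    projectives, so its value on a resolution is handled term by term. *)
Lemma perf_schur X : perf X -> perf (Sc X).
Proof.
move=> [P [projP [p qp]]].
have qSp : qis (schur_cmap he hR p : cmap (Sc P) (Sc X)) by exact: schur_quasi_iso.
apply: perf_qis qSp _; apply: (perf_terms corner_noetherian) => n c.
exact: perf_schur_stalk.
Qed.

Section SchurCone.
Variables (X Y : cpx R) (u : cmap X Y).
Notation Su := (schur_cmap he hR u : cmap (Sc X) (Sc Y)).

Definition schur_cone_fun n : {linear Sc (cone u) n -> cone Su n} :=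
  mkpair (schur_lin he (@fstl R (X (n + 1)) (Y n))) (schur_lin he (@sndl R (X (n + 1)) (Y n))).

Lemma schur_cone_funE n x :
  schur_cone_fun (n + 1) (cd (Sc (cone u)) n x) = cd (cone Su) n (schur_cone_fun n x).
Proof. by congr pair; apply: val_inj. Qed.

Definition schur_cone : cmap (Sc (cone u)) (cone Su) := Cmap schur_cone_funE.

Lemma schur_cone_qis : qis schur_cone.
Proof.
apply: quasi_iso_bij => n.
  move=> x y E; apply: val_inj; apply: injective_projections.
    exact: (congr1 (fun z => val z.1) E).
  exact: (congr1 (fun z => val z.2) E).
move=> [x y].
exists (schur_lin he (@pairl R (X (n + 1)) (Y n)) x + schur_lin he (@pairr R (X (n + 1)) (Y n)) y).
by congr pair; apply: val_inj; rewrite /= ?addr0 ?add0r.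
Qed.

End SchurCone.

Notation S := (schur_Db he hR).

(** The identity in every degree; the two differentials have equal values but carry different
    membership proofs. *)
Definition schur_shift X : cmap (Sc (shift_cpx X)) (shift_cpx (Sc X)) :=
  @Cmap eRe (Sc (shift_cpx X)) (shift_cpx (Sc X))
    (fun n => idfun : {linear Sc (shift_cpx X) n -> shift_cpx (Sc X) n})
    (fun n x => val_inj (erefl : val (cd (Sc (shift_cpx X)) n x) = val (cd (shift_cpx (Sc X)) n x))).

Lemma schur_shift_qis X : qis (schur_shift X).
Proof. by apply: quasi_iso_bij => n; [move=> x y | move=> y; exists y]. Qed.

Definition schur_shift_Db (X : Db R) : hom (S (shift X)) (shift (S X)) :=
  ldb (schur_shift X).

Lemma ldb_eq (R' : pzRingType) (X Y : cpx R') (f g : cmap X Y) :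
  (forall n x, f n x = g n x) -> ldb f =~ ldb g.
Proof. by move=> fg; apply: (@fmap_heq _ _ (loc (@quasi_iso R'))); apply: eq_homotopic. Qed.

Lemma ldb_comp (R' : pzRingType) (X Y Z : cpx R') (g : cmap Y Z) (f : cmap X Y) :
  ldb (cmap_comp g f) =~ ldb g <o> ldb f.
Proof. exact: (@fmap_comp _ _ (loc (@quasi_iso R')) X Y Z g f). Qed.

Lemma schur_shift_nat :
  @nat_iso (Db R) (Db eRe) (functor_comp S shift) (functor_comp shift S) schur_shift_Db.
Proof.
split=> [X|X Y f]; first exact/quasi_iso_Db/schur_shift_qis.
apply: (@loc_natural (Kb R) (Db eRe) (@quasi_iso R) (functor_comp S shift)
  (functor_comp shift S) schur_shift_Db) => {}X {}Y {}f.
apply: heq_trans (heq_sym (ldb_comp (schur_shift Y) (schur_cmap he hR (shift_cmap f)))) _.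
apply: heq_trans (ldb_comp (shift_cmap (schur_cmap he hR f)) (schur_shift X)).
exact: ldb_eq.
Qed.

Lemma schur_dist (X Y Z : Db R) (f : hom X Y) (g : hom Y Z) (h : hom Z (shift X)) :
  dist f g h -> dist (fmap S f) (fmap S g) (schur_shift_Db X <o> fmap S h).
Proof.
move=> [X' [Y' [u T]]]; exists (Sc X'), (Sc Y'), (schur_cmap he hR u).
apply: triangle_iso_trans (triangle_iso_map schur_shift_nat T) _.
exists (idm _), (idm _), (ldb (schur_cone u)).
split; first by split; [apply: idm_iso | apply: idm_iso | exact/quasi_iso_Db/schur_cone_qis].
split.
- by rewrite comp_idl comp_idr; reflexivity.
- rewrite comp_idr.
  apply: heq_trans (heq_sym (ldb_comp (schur_cone u) (schur_cmap he hR (cone_incl u)))) _.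
  by apply: ldb_eq => n x; congr pair; apply: val_inj.
- rewrite fmap_id comp_idl.
  apply: heq_trans (heq_sym (ldb_comp (schur_shift X') (schur_cmap he hR (cone_proj u)))) _.
  apply: heq_trans (ldb_comp (cone_proj (schur_cmap he hR u)) (schur_cone u)).
  by apply: ldb_eq => n x; apply: val_inj.
Qed.

Lemma schur_cone_in (X Y : Db R) (f : hom X Y) :
  cone_in (@perfect R) f -> cone_in (@perfect eRe) (fmap S f).
Proof.
move=> [Z [g [h [T pZ]]]].
exists (S Z), (fmap S g), (schur_shift_Db X <o> fmap S h); split; first exact: schur_dist.
by apply/perfectP/perf_schur/perfectP.
Qed.

Definition schur_sg : functor (Dsg R) (Dsg eRe) := loc_functor schur_cone_in.

Definition schur_shift_sg (X : Dsg R) : hom (schur_sg (shift X)) (shift (schur_sg X)) :=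
  fmap (sg_quotient eRe) (schur_shift_Db X).

Lemma schur_shift_sg_nat :
  @nat_iso (Dsg R) (Dsg eRe) (functor_comp schur_sg shift) (functor_comp shift schur_sg)
    schur_shift_sg.
Proof.
have [iso_eta nat_eta] := schur_shift_nat.
split=> [X|X Y f]; first exact: (fmap_iso (sg_quotient eRe) (iso_eta X)).
apply: (@loc_natural (Db R) (Dsg eRe) (cone_in (@perfect R)) (functor_comp schur_sg shift)
  (functor_comp shift schur_sg) schur_shift_sg) => {}X {}Y {}f.
apply: heq_trans (heq_sym (fmap_comp (sg_quotient eRe) _ _)) _.
apply: heq_trans (fmap_comp (sg_quotient eRe) _ _).
exact: (fmap_heq (sg_quotient eRe) (nat_eta X Y f)).
Qed.

Lemma schur_sg_triangle : triangle_functor schur_sg.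
Proof.
exists schur_shift_sg; split; first exact: schur_shift_sg_nat.
move=> X Y Z f g h [X' [Y' [Z' [f' [g' [h' [T I]]]]]]].
exists (S X'), (S Y'), (S Z'), (fmap S f'), (fmap S g'), (schur_shift_Db X' <o> fmap S h').
split; first exact: schur_dist.
apply: triangle_iso_trans (triangle_iso_map schur_shift_sg_nat I) _.
apply: triangle_iso_heq; try exact: heq_refl.
exact: heq_sym (fmap_comp (sg_quotient eRe) _ _).
Qed.

Lemma schur_sg_induced : induced_by_schur hR schur_sg.
Proof.
split; first exact: schur_sg_triangle.
exists (fun X => idm _); split=> [X|X Y f]; first exact: idm_iso.
by rewrite comp_idl comp_idr; reflexivity.
Qed.

(** Uniqueness in the universal property of D_sg reduces every induced functor to [schur_sg]. *)
Lemma induced_by_schur_iso (F : functor (Dsg R) (Dsg eRe)) :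
  induced_by_schur hR F -> nat_isomorphic F schur_sg.
Proof.
move=> [_ [eta [isoe nat]]]; exists eta; split=> // X Y f.
apply: (@loc_natural (Db R) (Dsg eRe) (cone_in (@perfect R)) F schur_sg eta) => {}X {}Y {}f.
exact: nat.
Qed.

End SchurFunctor.

(** * Induction along the corner *)

Section Induction.
Variables (R : pzRingType) (e : R) (he : e * e = e).
Notation eRe := (corner he).
Notation S := (schur he).
Implicit Types (N : fgmod eRe) (U V : lmodType R).

(* [ind_mod] with [ind_unit] is the tensor product of Re and N over eRe. *)
Record induced N := Induced {
  ind_mod : fgmod R;
  ind_unit : {linear N -> S ind_mod};
  ind_unit_inj : injective ind_unit;
  ind_unit_surj : forall y, exists x, y = ind_unit x;
  ind_univ : forall U (g : {linear N -> S U}),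
    exists h : {linear ind_mod -> U}, forall x, h (val (ind_unit x)) = val (g x);
  ind_uniq : forall U (f g : {linear ind_mod -> U}),
    (forall x, f (val (ind_unit x)) = g (val (ind_unit x))) -> forall t, f t = g t }.

Lemma span_sum (R' : pzRingType) (V : lmodType R') (s : seq V) x :
  span (fun y => y \in s) x ->
  exists a : 'I_(size s) -> R', x = \sum_i a i *: s`_i.
Proof.
move=> H; apply: (H (fun x => exists a : 'I_(size s) -> R', x = \sum_i a i *: s`_i)).
  split=> [|c y z [a ->] [b ->]].
    by exists (fun=> 0); rewrite big1 // => i _; rewrite scale0r.
  exists (fun i => c * a i + b i); rewrite scaler_sumr -big_split.
  by apply: eq_bigr => i _; rewrite scalerDl scalerA.
move=> y ys; have iy : (index y s < size s)%N by rewrite index_mem.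
exists (fun i => (i == Ordinal iy)%:R); rewrite (bigD1 (Ordinal iy)) //= eqxx scale1r nth_index //.
by rewrite big1 ?addr0 // => i /negbTE->; rewrite scale0r.
Qed.

Lemma corE (a : eRe) : cor he (val a) = a.
Proof. by apply: val_inj; apply/eqP/(valP a). Qed.

Lemma corD (x y : R) : cor he (x + y) = cor he x + cor he y.
Proof. by apply: val_inj; rewrite /= mulrDr mulrDl. Qed.

Lemma corner_closed (a : eRe) : e * val a = val a /\ val a * e = val a.
Proof. exact: cornerP he _ (valP a). Qed.

(** The generators of [N] come from a proposition while [induced] is data, so only existence is
    asserted; [ind] chooses. *)
Lemma induced_exists N : exists _ : induced N, True.
Proof.
have [s sN] := fg_fin N; pose k := size s.
pose W : lmodType R := 'rV[R]_k.
pose ev (v : W) : N := \sum_(i < k) cor he (v 0 i) *: s`_i.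
have evD v w : ev (v + w) = ev v + ev w.
  by rewrite -big_split; apply: eq_bigr => i _; rewrite mxE corD scalerDl.
pose cl (v : W) := forall i, e * v 0 i = v 0 i /\ v 0 i * e = v 0 i.
(* Relations presenting Re (x)_{eRe} N as a quotient of R^k: R(1-e) in each
   coordinate, and the eRe-linear relations among the generators of N. *)
pose A (v : W) := (forall i, v 0 i * e = 0) \/ (cl v /\ ev v = 0).
have [Q0 [pi0 [pisurj0 piK0]]] := quotient_object (submodule_span A).
have fQ : fin_gen Q0.
  apply: (@fin_gen_surj R W Q0 pi0 pisurj0); exists [seq delta_mx 0 i | i <- enum 'I_k] => v; split=> // _.
  rewrite [v]row_sum_delta; apply: (big_ind (span _)).
  - exact: span0.
  - by move=> x y; apply: (submoduleD (submodule_span _)).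
  - move=> i _; apply: (submoduleZ _ (submodule_span _)).
    by apply: span_gen; apply: map_f; rewrite mem_enum.
pose Q := FgMod fQ; pose pi : {linear W -> Q} := pi0.
have pisurj (q : Q) : exists x, q = pi x := pisurj0 q.
have piK x : pi x = 0 <-> span A x := piK0 x.
have evB v w : ev v = ev w -> ev (v - w) = 0.
  move=> vw; have : ev (v - w) + ev w = ev w by rewrite -evD subrK.
  by move/eqP; rewrite -subr_eq0 addrK => /eqP.
have pi_eq (v w : W) : cl v -> cl w -> ev v = ev w -> pi v = pi w.
  move=> ve we vw; apply/eqP; rewrite -subr_eq0 -linearB; apply/eqP/piK.
  apply: span_gen; right; split=> [i|]; last exact: evB.
  have [v1 v2] := ve i; have [w1 w2] := we i.
  by rewrite !mxE mulrBr mulrBl v1 v2 w1 w2.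
have ev0 : ev 0 = 0.
  apply: big1 => i _; rewrite mxE.
  have -> : cor he 0 = 0 by apply: val_inj; rewrite /= mulr0 mul0r.
  exact: scale0r.
have evZ (a : eRe) v : cl v -> ev (val a *: v) = a *: ev v.
  move=> ve; rewrite scaler_sumr; apply: eq_bigr => i _.
  rewrite mxE scalerA; congr (_ *: _); apply: val_inj => /=.
  have [v1 v2] := ve i; have [a1 a2] := corner_closed a.
  by rewrite v1 v2 mulrA a1 -mulrA v2.
have evZl (x : R) v : cl v -> ev (x *: v) = ev (val (cor he x) *: v).
  move=> ve; apply: eq_bigr => i _; congr (_ *: _); apply: val_inj => /=.
  by rewrite !mxE /=; have [v1 v2] := ve i; rewrite -!mulrA v2 v1 !mulrA he.
(* Relations evaluate to 0 even after scaling, a form that the span inherits. This gives injectivity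
   of the unit. *)
have A0 v : span A v -> forall x : R, ev (x *: v) = 0.
  move=> H; apply: (H (fun v => forall x : R, ev (x *: v) = 0)).
    split=> [x|c v' w Hv Hw x]; first by rewrite scaler0.
    by rewrite scalerDr evD scalerA Hv Hw addr0.
  move=> v' [v0|[ve v'0]] x; last by rewrite evZl // evZ // v'0 scaler0.
  apply: big1 => i _; rewrite mxE.
  have -> : cor he (x * v' 0 i) = 0.
    by apply: val_inj; rewrite /= -!mulrA v0 !mulr0.
  exact: scale0r.
have reps n : exists v : W, cl v /\ ev v = n.
  have [a Ea] := span_sum ((sN n).1 I); exists (\row_i val (a i)); split=> [i|].
    by rewrite mxE; apply: corner_closed.
  by rewrite Ea; apply: eq_bigr => i _; rewrite mxE corE.
pose rep n := sval (cid (reps n)).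
have repe n : cl (rep n) := (svalP (cid (reps n))).1.
have repE n : ev (rep n) = n := (svalP (cid (reps n))).2.
have clZ v : cl v -> e *: v = v.
  by move=> ve; apply/rowP => i; rewrite mxE; case: (ve i).
have pie v : cl v -> e *: pi v == pi v by move=> ve; rewrite -linearZ clZ.
pose eta n : S Q := exist _ (pi (rep n)) (pie _ (repe n)).
have etaE n v : cl v -> ev v = n -> val (eta n) = pi v.
  by move=> ve vn; apply: pi_eq => //; rewrite repE.
have etalin : linear eta.
  move=> a n m; apply: val_inj.
  rewrite (etaE _ (val a *: rep n + rep m)); first by rewrite linearP.
    move=> i; have [v1 v2] := repe n i; have [w1 w2] := repe m i.
    have [a1 a2] := corner_closed a.
    by rewrite !mxE mulrDr mulrDl mulrA a1 -mulrA v2 w1 w2.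
  by rewrite evD evZ // !repE.
have univ U (g : {linear N -> S U}) : exists h : {linear Q -> U}, forall x, h (val (eta x)) = val (g x).
  pose f0 (v : W) : U := \sum_(i < k) v 0 i *: val (g s`_i).
  have flin : linear f0.
    move=> a v w; rewrite scaler_sumr -big_split; apply: eq_bigr => i _.
    by rewrite !mxE scalerDl scalerA.
  have fE v : cl v -> f0 v = val (g (ev v)).
    move=> ve; rewrite linear_sum.
    have valD (x y : S U) : val (x + y) = val x + val y by [].
    rewrite (big_morph _ valD (erefl : val (0 : S U) = 0)); apply: eq_bigr => i _.
    by rewrite linearZ /=; have [-> ->] := ve i.
  have [|h hE] := @lin_descend R W U Q pi (mklin flin) pisurj.
    move=> v /piK H; apply: (H (fun v => f0 v = 0)); first exact: (kernel_submodule (mklin flin)).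
    move=> w [w0|[we evw]]; last by rewrite fE // evw linear0.
    by apply: big1 => i _; rewrite -schurP scalerA w0 scale0r.
  by exists h => x; rewrite hE /= fE ?repE.
have delta_cl i : cl (e *: delta_mx 0 i).
  move=> l; rewrite !mxE /=; case: (_ == _); rewrite ?mulr1 ?mulr0 ?mul0r ?he //.
have uniq U (f g : {linear Q -> U}) : (forall x, f (val (eta x)) = g (val (eta x))) -> forall t, f t = g t.
  move=> fg t; have [v ->] := pisurj t; rewrite [v]row_sum_delta !linear_sum.
  apply: eq_bigr => i _; rewrite !linearZ; congr (_ *: _).
  (* The two differ by 1 - e in one coordinate, a relation of the first kind; hence the image of the
     unit generates the quotient. *)
  have -> : pi (delta_mx 0 i) = pi (e *: delta_mx 0 i).
    apply/eqP; rewrite -subr_eq0 -linearB; apply/eqP/piK; apply: span_gen; left => l.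
    rewrite !mxE /=; case: (_ == _); rewrite ?(mulr1, mulr0) ?subrr ?mul0r //.
    by rewrite mulrBl mul1r he subrr.
  by rewrite -(etaE _ _ (delta_cl i) erefl) fg.
have etainj : injective eta.
  move=> n m /(congr1 val) /= /eqP; rewrite -subr_eq0 -linearB => /eqP/piK/A0/(_ 1).
  rewrite scale1r => E; rewrite -(repE n) -(repE m).
  by rewrite -[rep n](subrK (rep m)) evD E add0r.
have etasurj y : exists x, y = eta x.
  have [v Ev] := pisurj (val y).
  (* An element of eQ is unchanged by e on the left, and e on the right alters a representative by
     relations in R(1-e). *)
  pose v' : W := \row_i (e * v 0 i * e).
  have clv' : cl v'.
    by move=> i; rewrite mxE; apply: (corner_closed (cor he (v 0 i))).
  exists (ev v'); apply: val_inj; rewrite (etaE _ v') //.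
  rewrite -schurP Ev -linearZ; apply/eqP; rewrite -subr_eq0 -linearB; apply/eqP/piK; apply: span_gen.
  left=> i; rewrite !mxE mulrBl -[_ * e * e]mulrA he subrr //.
by exists (@Induced N Q (mklin etalin) etainj etasurj univ uniq).
Qed.

End Induction.

(** * The induction functor, its unit and its counit *)

Section InductionFunctor.
Variables (R : pzRingType) (e : R) (he : e * e = e).
Hypothesis hR : left_noetherian R.
Notation eRe := (corner he).
Notation S := (schur he).
Notation Sc := (schur_cpx he hR).
Notation Sm := (schur_cmap he hR).

Definition ind (N : fgmod eRe) : induced N := sval (cid (induced_exists N)).
Notation T := (fun N : fgmod eRe => ind_mod (ind N)).
Notation unit N := (ind_unit (ind N)).

Definition ind_lift (N : fgmod eRe) (U : lmodType R) (g : {linear N -> S U}) :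
  {linear T N -> U} := sval (cid (ind_univ (ind N) g)).

Lemma ind_liftE (N : fgmod eRe) (U : lmodType R) (g : {linear N -> S U}) x :
  ind_lift g (val (unit N x)) = val (g x).
Proof. exact: (svalP (cid (ind_univ (ind N) g)) x). Qed.

Definition ind_map (N N' : fgmod eRe) (f : {linear N -> N'}) : {linear T N -> T N'} :=
  ind_lift (unit N' \o f).

Lemma ind_mapE (N N' : fgmod eRe) (f : {linear N -> N'}) x :
  ind_map f (val (unit N x)) = val (unit N' (f x)).
Proof. exact: ind_liftE. Qed.

Lemma ind_map_zero (N N' : fgmod eRe) (f : {linear N -> N'}) :
  (forall x, f x = 0) -> forall t, ind_map f t = 0.
Proof.
move=> f0 t; rewrite -[RHS]/((\0 : {linear T N -> T N'}) t).
by apply: ind_uniq => x; rewrite ind_mapE f0 linear0.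
Qed.

Lemma ind_map_id (N : fgmod eRe) (f : {linear N -> N}) :
  (forall x, f x = x) -> forall t, ind_map f t = t.
Proof.
move=> fE t; rewrite -[RHS]/((idfun : {linear T N -> T N}) t).
by apply: ind_uniq => x; rewrite ind_mapE fE.
Qed.

Lemma ind_map_comp (N N' N2 : fgmod eRe) (g : {linear N' -> N2}) (f : {linear N -> N'})
    (h : {linear N -> N2}) :
  (forall x, g (f x) = h x) -> forall t, ind_map g (ind_map f t) = ind_map h t.
Proof.
move=> gfh t; rewrite -[LHS]/((ind_map g \o ind_map f : {linear T N -> T N2}) t).
by apply: ind_uniq => x; rewrite /= !ind_mapE gfh.
Qed.

Lemma ind_mapD (N N' : fgmod eRe) (f g h : {linear N -> N'}) :
  (forall x, f x = g x + h x) -> forall t, ind_map f t = ind_map g t + ind_map h t.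
Proof.
move=> fgh t; rewrite -[RHS]/((ind_map g \+ ind_map h : {linear T N -> T N'}) t).
by apply: ind_uniq => x; rewrite /= !ind_mapE fgh linearD.
Qed.

Lemma ind_projective (N : fgmod eRe) : projective N -> projective (T N).
Proof.
move=> projN U V p f psurj.
have [|h hE] := projN (S U) (S V) (schur_lin he p) (schur_lin he f \o unit N).
  move=> v; have [u Eu] := psurj (val v); exists (to_schur he u); apply: val_inj.
  by rewrite /= linearZ Eu; apply: schurP.
exists (ind_lift h) => x; rewrite -[LHS]/((p \o ind_lift h : {linear T N -> V}) x).
apply: ind_uniq => y; rewrite /= ind_liftE.
exact: (congr1 val (hE y)).
Qed.

Section IndComplex.
Variable Y : cpx eRe.

Lemma ind_cdd n (t : T (Y n)) : ind_map (cd Y (n + 1)) (ind_map (cd Y n) t) = 0.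
Proof.
rewrite (@ind_map_comp _ _ _ _ _ \0); last by move=> x; rewrite cdd.
exact: ind_map_zero.
Qed.

Lemma ind_bound : exists N : nat,
  forall n : int, (N < `|n|)%N -> forall t : T (Y n), t = 0.
Proof.
have [N YN] := cbound Y; exists N => n nN t.
rewrite -(ind_map_id (f := idfun) (fun x => erefl) t).
by apply: ind_map_zero => x; apply: (YN n nN).
Qed.

Definition ind_cpx : cpx R :=
  @Cpx R (fun n => T (Y n)) (fun n => ind_map (cd Y n)) ind_cdd ind_bound.

End IndComplex.

Lemma ind_cmapE X Y (f : cmap X Y) n (x : ind_cpx X n) :
  ind_map (f (n + 1)) (cd (ind_cpx X) n x) = cd (ind_cpx Y) n (ind_map (f n) x).
Proof.
rewrite /= (@ind_map_comp _ _ _ (f (n + 1)) (cd X n) (f (n + 1) \o cd X n)) //.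
by rewrite (@ind_map_comp _ _ _ (cd Y n) (f n) (f (n + 1) \o cd X n)) // => z; rewrite /= cfunE.
Qed.

Definition ind_cmap X Y (f : cmap X Y) : cmap (ind_cpx X) (ind_cpx Y) :=
  @Cmap R (ind_cpx X) (ind_cpx Y) (fun n => ind_map (f n)) (@ind_cmapE X Y f).

Lemma ind_homotopic X Y (f g : cmap X Y) :
  homotopic f g -> homotopic (ind_cmap f) (ind_cmap g).
Proof.
move=> [h hE]; exists (fun n => ind_map (h n)) => n t.
apply/eqP; rewrite subr_eq; apply/eqP.
rewrite /= (@ind_map_comp _ _ _ (cd Y n) (h n) (cd Y n \o h n)) //.
rewrite (@ind_map_comp _ _ _ (h (n + 1)) (cd X (n + 1)) (h (n + 1) \o cd X (n + 1))) //.
rewrite (@ind_mapD _ _ (f (n + 1)) ((cd Y n \o h n) \+ (h (n + 1) \o cd X (n + 1))) (g (n + 1))).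
  by congr (_ + _); apply: ind_mapD.
by move=> x; rewrite /= -hE subrK.
Qed.

Definition ind_Kb : functor (Kb eRe) (Kb R).
Proof.
apply: (@Functor (Kb eRe) (Kb R) ind_cpx ind_cmap ind_homotopic).
- by move=> X; apply: eq_homotopic => n t; apply: ind_map_id.
- by move=> X Y Z g f; apply: eq_homotopic => n t; apply/esym/ind_map_comp.
Defined.

Lemma unit_cmapE (Y : cpx eRe) n (x : Y n) :
  unit (Y (n + 1)) (cd Y n x) = cd (Sc (ind_cpx Y)) n (unit (Y n) x).
Proof. by apply: val_inj; rewrite /= ind_mapE. Qed.

Definition unit_cmap Y : cmap Y (Sc (ind_cpx Y)) :=
  @Cmap eRe Y (Sc (ind_cpx Y)) (fun n => unit (Y n)) (@unit_cmapE Y).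

Lemma unit_qis Y : qis (unit_cmap Y).
Proof.
by apply: quasi_iso_bij => n; [apply: ind_unit_inj | apply: ind_unit_surj].
Qed.

Lemma unit_nat X Y (f : cmap X Y) n x :
  unit_cmap Y n (f n x) = Sm (ind_cmap f) n (unit_cmap X n x).
Proof. by apply: val_inj; rewrite /= ind_mapE. Qed.

Definition counit (X : cpx R) n : {linear ind_cpx (Sc X) n -> X n} :=
  @ind_lift (Sc X n) (X n) idfun.

Lemma counit_cmapE X n (t : ind_cpx (Sc X) n) :
  @counit X (n + 1) (cd (ind_cpx (Sc X)) n t) = cd X n (@counit X n t).
Proof.
rewrite -[LHS]/((@counit X (n + 1) \o cd (ind_cpx (Sc X)) n : {linear _ -> X (n + 1)}) t).
rewrite -[RHS]/((cd X n \o @counit X n : {linear _ -> X (n + 1)}) t).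
by apply: ind_uniq => x; rewrite /= ind_mapE /counit !ind_liftE.
Qed.

Definition counit_cmap X : cmap (ind_cpx (Sc X)) X :=
  @Cmap R (ind_cpx (Sc X)) X (@counit X) (@counit_cmapE X).

Lemma counit_nat X Y (f : cmap X Y) n t :
  counit_cmap Y n (ind_cmap (Sm f) n t) = f n (counit_cmap X n t).
Proof.
rewrite -[LHS]/((@counit Y n \o ind_map (Sm f n) : {linear _ -> Y n}) t).
rewrite -[RHS]/((f n \o @counit X n : {linear _ -> Y n}) t).
by apply: ind_uniq => x; rewrite /= ind_mapE /counit !ind_liftE.
Qed.

(** The triangle identity makes the Schur image of the counit inverse to the unit, which is
    bijective in each degree. *)
Lemma schur_counit_qis X : qis (Sm (counit_cmap X)).
Proof.
have E n (x : S (X n)) : Sm (counit_cmap X) n (unit (Sc X n) x) = x.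
  by apply: val_inj; rewrite /= /counit ind_liftE.
apply: quasi_iso_bij => n.
  move=> z w; have [x ->] := ind_unit_surj z; have [y ->] := ind_unit_surj w.
  by rewrite !E => ->.
by move=> y; exists (unit (Sc X n) y); rewrite E.
Qed.

Hypothesis e_complete : singularly_complete e.

Lemma perf_stalk_killed (M : fgmod R) :
  (forall m : M, e *: m = 0) -> forall c, perf (stalk M c).
Proof.
move=> eM c; have [|n pdM] := finite_pd_fg hR (M := M); last exact: perf_stalk_fg_pd pdM.
by apply: e_complete => m; rewrite subKr.
Qed.

(** For a cocycle x of [cone f], e x is a cocycle of the acyclic Schur complex, hence a coboundary:
    e kills the cohomology of [cone f]. *)
Lemma perf_cone_schur_qis X Y (f : cmap X Y) : qis (Sm f) -> perf (cone f).
Proof.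
move=> /quasi_iso_acyclic acS; apply: (perf_killed hR perf_stalk_killed) => n x dx.
have qc := @schur_cone_qis R e he hR X Y f.
have dx' : cd (Sc (cone f)) (n + 1) (to_schur he x) = 0.
  apply: val_inj; have E : cd (cone f) (n + 1) (e *: x) = 0.
    by rewrite linearZ_LR dx scaler0.
  exact: E.
have [|w Ew] := (qc n).1 _ dx'; first by apply: acS; rewrite -cfunE dx' linear0.
by exists (val w); apply: (congr1 val Ew).
Qed.

Notation lsg f := (fmap (sg_quotient R) (ldb f)).

(** Induction may destroy a quasi-isomorphism, but naturality of the unit restores it after the
    Schur functor. *)
Lemma perf_cone_ind_qis X Y (f : cmap X Y) : qis f -> perf (cone (ind_cmap f)).
Proof.
move=> qf; apply: perf_cone_schur_qis.
have q1 : qis (cmap_comp (Sm (ind_cmap f)) (unit_cmap X)).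
  apply: quasi_iso_homotopic (quasi_iso_comp (@unit_qis Y) qf).
  by apply: eq_homotopic => n x; apply: unit_nat.
have /quasi_iso_Db := q1 => isoq; apply/quasi_iso_Db.
apply: (iso_comp_l ((quasi_iso_Db _).1 (@unit_qis X))).
by apply: heq_iso isoq; apply: ldb_comp.
Qed.

(** The induced resolution has projective terms; it may fail to resolve the induced complex, but
    only by a perf cone. *)
Lemma perf_ind X : perf X -> perf (ind_cpx X).
Proof.
move=> [P [projP [p qp]]].
have pP : perf (ind_cpx P).
  exists (ind_cpx P); split; first by move=> n; apply: ind_projective.
  by exists (cmap_id _); apply: quasi_iso_id.
exact: perf_ses_l (cone_incl_ses (ind_cmap p)) (perf_cone_ind_qis qp) (perf_shift pP).
Qed.

(** Induction is additive, so it commutes with cones: [th] and [j] are mutually inverse in each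
    degree. *)
Lemma perf_cone_ind X Y (u : cmap X Y) : perf (cone u) -> perf (cone (ind_cmap u)).
Proof.
move=> /perf_ind pC.
pose th n : {linear ind_cpx (cone u) n -> cone (ind_cmap u) n} :=
  mkpair (ind_map (@fstl eRe (X (n + 1)) (Y n) : {linear cone u n -> X (n + 1)}))
    (ind_map (@sndl eRe (X (n + 1)) (Y n) : {linear cone u n -> Y n})).
have thU n (x : cone u n) :
    th n (val (unit (cone u n) x)) = (val (unit _ x.1), val (unit _ x.2)).
  by rewrite /th /= !ind_mapE.
have thE n t : th (n + 1) (cd (ind_cpx (cone u)) n t) = cd (cone (ind_cmap u)) n (th n t).
  rewrite -[LHS]/((th (n + 1) \o cd (ind_cpx (cone u)) n : {linear _ -> cone (ind_cmap u) (n + 1)}) t).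
  rewrite -[RHS]/((cd (cone (ind_cmap u)) n \o th n : {linear _ -> cone (ind_cmap u) (n + 1)}) t).
  apply: ind_uniq => x.
  have dU : cd (ind_cpx (cone u)) n (val (unit (cone u n) x))
    = val (unit (cone u (n + 1)) (cd (cone u) n x)) := ind_mapE _ _.
  rewrite -[LHS]/(th (n + 1) (cd (ind_cpx (cone u)) n (val (unit (cone u n) x)))).
  rewrite -[RHS]/(cd (cone (ind_cmap u)) n (th n (val (unit (cone u n) x)))).
  rewrite dU !thU /= /cone_fun /= !ind_mapE.
  by congr pair; rewrite ?linearN ?linearD.
pose Th : cmap (ind_cpx (cone u)) (cone (ind_cmap u)) :=
  @Cmap R (ind_cpx (cone u)) (cone (ind_cmap u)) th thE.
suff qT : qis Th by apply: perf_qis qT pC.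
pose j n : {linear cone (ind_cmap u) n -> ind_cpx (cone u) n} :=
  copair (ind_map (@pairl eRe (X (n + 1)) (Y n) : {linear X (n + 1) -> cone u n}))
    (ind_map (@pairr eRe (X (n + 1)) (Y n) : {linear Y n -> cone u n})).
have jth n t : j n (th n t) = t.
  rewrite -[LHS]/((j n \o th n : {linear _ -> ind_cpx (cone u) n}) t).
  rewrite -[RHS]/((idfun : {linear ind_cpx (cone u) n -> ind_cpx (cone u) n}) t).
  apply: ind_uniq => x; rewrite [LHS]/= !ind_mapE.
  by rewrite -[RHS](congr1 (fun y => val (unit (cone u n) y)) (esym (pairE x))) linearD.
have thj n z : th n (j n z) = z.
  have th1 a : th n (ind_map (@pairl eRe (X (n + 1)) (Y n) : {linear X (n + 1) -> cone u n}) a) = (a, 0).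
    rewrite -[LHS]/((th n \o ind_map (@pairl eRe (X (n + 1)) (Y n) : {linear X (n + 1) -> cone u n})
      : {linear _ -> cone (ind_cmap u) n}) a).
    rewrite -[RHS]/((pairl _ _ : {linear _ -> cone (ind_cmap u) n}) a).
    by apply: ind_uniq => x; rewrite [LHS]/= !ind_mapE /= linear0.
  have th2 b : th n (ind_map (@pairr eRe (X (n + 1)) (Y n) : {linear Y n -> cone u n}) b) = (0, b).
    rewrite -[LHS]/((th n \o ind_map (@pairr eRe (X (n + 1)) (Y n) : {linear Y n -> cone u n})
      : {linear _ -> cone (ind_cmap u) n}) b).
    rewrite -[RHS]/((pairr _ _ : {linear _ -> cone (ind_cmap u) n}) b).
    by apply: ind_uniq => x; rewrite [LHS]/= !ind_mapE /= linear0.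
  rewrite [j n z]/= linearD th1 th2.
  by case: z => a b; congr pair; rewrite /= ?addr0 ?add0r.
apply: quasi_iso_bij => n; first exact: can_inj (jth n).
by move=> y; exists (j n y); rewrite [RHS]thj.
Qed.

Lemma ind_sg_qis (X Y : Kb eRe) (f : hom X Y) : quasi_iso f ->
  is_iso (lsg (ind_cmap f)).
Proof. by move=> qf; apply/perf_cone_sg_iso/perf_cone_ind_qis. Qed.

Lemma ind_sg_perf (X Y : Kb eRe) (f : hom X Y) : perf_cone_map f ->
  is_iso (lsg (ind_cmap f)).
Proof. by move=> Vf; apply/perf_cone_sg_iso/perf_cone_ind. Qed.

Definition Kb_sg : functor (Kb R) (Dsg R) :=
  functor_comp (sg_quotient R) (loc (@quasi_iso R)).

Definition ind_sg : functor (Dsg eRe) (Dsg R) :=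
  @Dsg_lift eRe (Dsg R) (functor_comp Kb_sg ind_Kb) ind_sg_qis ind_sg_perf.

Hypothesis hpd : finite_pd (schur he R^o).

Lemma ind_schur_sg :
  nat_isomorphic (functor_comp ind_sg (schur_sg hR hpd)) (functor_id (Dsg R)).
Proof.
exists (fun X : Dsg R => lsg (counit_cmap X)); split=> [X|X Y f].
  exact/perf_cone_sg_iso/perf_cone_schur_qis/schur_counit_qis.
apply: (@loc_natural (Db R) (Dsg R) (cone_in (@perfect R))
  (functor_comp ind_sg (schur_sg hR hpd)) (functor_id (Dsg R))
  (fun X => lsg (counit_cmap X))) => {}X {}Y {}f.
apply: (@loc_natural (Kb R) (Dsg R) (@quasi_iso R)
  (functor_comp (functor_comp ind_sg (schur_sg hR hpd)) (sg_quotient R))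
  (functor_comp (functor_id (Dsg R)) (sg_quotient R))
  (fun X => lsg (counit_cmap X))) => {}X {}Y {}f.
apply: heq_trans (heq_sym (@fmap_comp _ _ Kb_sg _ _ _ (counit_cmap Y) (ind_cmap (Sm f)))) _.
apply: heq_trans (@fmap_comp _ _ Kb_sg _ _ _ f (counit_cmap X)).
apply: (@fmap_heq _ _ Kb_sg); apply: eq_homotopic => n t.
exact: counit_nat.
Qed.

Lemma schur_ind_sg :
  nat_isomorphic (functor_comp (schur_sg hR hpd) ind_sg) (functor_id (Dsg eRe)).
Proof.
apply: nat_isomorphic_sym.
pose Kb_sg' : functor (Kb eRe) (Dsg eRe) :=
  functor_comp (sg_quotient eRe) (loc (@quasi_iso eRe)).
pose eta (X : cpx eRe) := fmap (sg_quotient eRe) (ldb (unit_cmap X)).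
exists eta; split=> [X|X Y f].
  exact/perf_cone_sg_iso/perf_cone_qis/unit_qis.
apply: (@loc_natural (Db eRe) (Dsg eRe) (cone_in (@perfect eRe))
  (functor_id (Dsg eRe)) (functor_comp (schur_sg hR hpd) ind_sg) eta) => {}X {}Y {}f.
apply: (@loc_natural (Kb eRe) (Dsg eRe) (@quasi_iso eRe)
  (functor_comp (functor_id (Dsg eRe)) (sg_quotient eRe))
  (functor_comp (functor_comp (schur_sg hR hpd) ind_sg) (sg_quotient eRe)) eta) => {}X {}Y {}f.
apply: heq_trans (heq_sym (@fmap_comp _ _ Kb_sg' _ _ _ (unit_cmap Y) f)) _.
apply: heq_trans (@fmap_comp _ _ Kb_sg' _ _ _ (Sm (ind_cmap f)) (unit_cmap X)).
apply: (@fmap_heq _ _ Kb_sg'); apply: eq_homotopic => n t.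
exact: unit_nat.
Qed.

Lemma schur_sg_equivalence : is_equivalence (schur_sg hR hpd).
Proof. by exists ind_sg; split; [apply: ind_schur_sg | apply: schur_ind_sg]. Qed.

End InductionFunctor.

(** When eM = 0, the identity and the zero map of the stalk of M have the same Schur image, so
    faithfulness identifies them in D_sg(R). *)
Lemma faithful_singularly_complete (R : pzRingType) (hR : left_noetherian R)
    (e : R) (he : e * e = e) (hpd : finite_pd (schur he R^o)) :
  is_equivalence (schur_sg hR hpd) -> singularly_complete e.
Proof.
move=> eqS M; rewrite /ess_kernel => eM.
have {}eM (m : M) : e *: m = 0 by have := eM m; rewrite subKr.
apply: (sg_zero_finite_pd hR (c := 0)); apply: (equivalence_faithful eqS).
apply: (fmap_heq (sg_quotient (corner he))).
apply: (@ldb_eq (corner he) _ _ (schur_cmap he hR (cmap_id (stalk M 0)))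
  (schur_cmap he hR (cmap0 (stalk M 0) (stalk M 0)))) => n x.
apply: val_inj; rewrite /= -schurP; have [En|/eqP n0] := eqVneq n 0; last exact: stalk0.
subst n; rewrite -(stalk_outK (val x)) -linearZ /= eM linear0 //.
Qed.

(** The existence of an induced functor is part of the conclusion, so that the equivalence is not
    about an empty class. *)
Theorem corollary3p3 (R : pzRingType) (hR : left_noetherian R)
    (e : R) (he : e * e = e) (hpd : finite_pd (schur he R^o)) :
  (exists F : functor (Dsg R) (Dsg (corner he)), induced_by_schur hR F) /\
  (forall F : functor (Dsg R) (Dsg (corner he)), induced_by_schur hR F ->
     (is_equivalence F <-> singularly_complete e)).
Proof.
split; first by exists (schur_sg hR hpd); apply: schur_sg_induced.
move=> F /(induced_by_schur_iso hpd) FS; split=> [eqF|ce].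
  apply: (@faithful_singularly_complete R hR e he hpd).
  exact: nat_isomorphic_equivalence FS eqF.
apply: nat_isomorphic_equivalence (nat_isomorphic_sym FS) _.
exact: schur_sg_equivalence.
Qed.
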